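(* Let $G$ be an oriented Poincaré duality group of dimension $n$. The string product $\mu:(\mathcal{L}_G)_p\otimes(\mathcal{L}_G)_q\to(\mathcal{L}_G)_{p+q}$ makes $\mathcal{L}_G$ a graded, associative, (graded-)commutative algebra with unit.
   Context: An oriented Poincaré duality group of dimension $n$ is a (discrete) group $G$ together with a fundamental class $z\in H_n(G;\mathbb{Z})$ such that for every $\mathbb{Z}[G]$-module $A$ and every $p$, capping (on the left) with $z$ is an isomorphism $D:H^p(G;A)\to H_{n-p}(G;A)$. Homology of groups is with $\mathbb{Z}$ coefficients unless indicated. For $g\in G$, $C_g$ denotes the centralizer of $g$ in $G$. The graded abelian group $\mathcal{L}_G$ is $$(\mathcal{L}_G)_p=\bigoplus_{[g]}H_{p+n}(C_g),$$ the sum being over conjugacy classes of elements of $G$ (one representative $g$ per class). Equivalently $(\mathcal{L}_G)_*=H_{*+n}(G;\mathrm{Ad})$, where $\mathrm{Ad}$ is $\mathbb{Z}[G]$ with the conjugation action of $G$. For any $h\in G$, $H_{p+n}(C_h)$ is identified with the summand of the conjugacy class of $h$, via the isomorphism induced by conjugation by any element carrying $h$ to the chosen representative (this does not depend on the choice of the conjugating element). Intersection pairing. For a subgroup $K\le G$, $\mathbb{Z}[G/K]$ is the free abelian group on left cosets with left translation action, and $H_*(K)\cong H_*(G;\mathbb{Z}[G/K])$. Let $K,H\le G$ and let $I$ be a set of representatives for the double cosets $K\backslash G/H$. There is an isomorphism of $\mathbb{Z}[G]$-modules (diagonal action on the source) $$\psi:\mathbb{Z}[G/K]\otimes\mathbb{Z}[G/H]\to\bigoplus_{g\in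 I}\mathbb{Z}[G/(K\cap gHg^{-1})]$$ defined as follows: given $g_1K\otimes g_2H$, let $g\in I$ represent the double coset $K(g_1^{-1}g_2)H$, write $g_1K\otimes g_2H=a(K\otimes gH)$ with $a\in G$, and send it to the coset $a(K\cap gHg^{-1})$. The intersection pairing $$\cap:H_i(K)\otimes H_j(H)\to\bigoplus_{g\in I}H_{i+j-n}(K\cap gHg^{-1})$$ is the composite of: the isomorphism $H_i(K)\otimes H_j(H)\cong H_i(G;\mathbb{Z}[G/K])\otimes H_j(G;\mathbb{Z}[G/H])$; $D^{-1}\otimes D^{-1}$ into $H^{n-i}(G;\mathbb{Z}[G/K])\otimes H^{n-j}(G;\mathbb{Z}[G/H])$; the cup product into $H^{2n-i-j}(G;\mathbb{Z}[G/K]\otimes\mathbb{Z}[G/H])$; $D$ into $H_{i+j-n}(G;\mathbb{Z}[G/K]\otimes\mathbb{Z}[G/H])$; $\psi_*$; and the isomorphism $\bigoplus_{g\in I} H_{i+j-n}(G;\mathbb{Z}[G/(K\cap gHg^{-1})])\cong\bigoplus_{g\in I} H_{i+j-n}(K\cap gHg^{-1})$. String product. For $\alpha,\beta\in G$ one has $gC_\beta g^{-1}=C_{g\beta g^{-1}}$ and an inclusion $j:C_\alpha\cap gC_\beta g^{-1}\hookrightarrow C_{\alpha g\beta g^{-1}}$. The string product $\mu:(\mathcal{L}_G)_p\otimes(\mathcal{L}_G)_q\to(\mathcal{L}_G)_{p+q}$ is defined, on the summand indexed by the conjugacy classes of $\alpha$ and $\beta$ and with $I$ a set of representatives of $C_\alpha\backslash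 G/C_\beta$, as the composite $$\mu=j_*\circ\cap:\;H_{p+n}(C_\alpha)\otimes H_{q+n}(C_\beta)\to\bigoplus_{g\in I}H_{p+q+n}(C_\alpha\cap gC_\beta g^{-1})\to\bigoplus_{g\in I}H_{p+q+n}(C_{\alpha g\beta g^{-1}})\to(\mathcal{L}_G)_{p+q},$$ the last map sending each term to the summand of the conjugacy class of $\alpha g\beta g^{-1}$ via the identification above and summing. Graded-commutative means $\mu(y,x)=(-1)^{pq}\mu(x,y)$ for $x\in(\mathcal{L}_G)_p$, $y\in(\mathcal{L}_G)_q$. *)

(* Defs.v *)
From HB Require Import structures.
From mathcomp Require Import all_boot all_order all_algebra.
From mathcomp Require Import finmap monalg.
From mathcomp Require Import boolp classical_sets functions cardinality fsbigop.

Set Implicit Arguments.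
Unset Strict Implicit.
Unset Printing Implicit Defensive.

Import Order.TTheory GRing.Theory Num.Theory.
Import Quotient.Exports.

Local Open Scope quotient_scope.
Local Open Scope classical_set_scope.
Local Open Scope ring_scope.

Section LinearExtension.
Context {K : choiceType} {A C : zmodType}.

Definition malg_lift (F : K -> A -> C) (c : {malg A[K]}) : C :=
  \sum_(k <- msupp c) F k c@_k.

Lemma malg_liftEw (F : K -> A -> C) (c : {malg A[K]}) (X : {fset K}) :
  (forall k, F k 0 = 0) -> (msupp c `<=` X)%fset ->
  malg_lift F c = \sum_(k <- X) F k c@_k.
Proof.
move=> F0 sX; rewrite /malg_lift (big_fset_incl _ sX) //= => k _ /mcoeff_outdom ->.
exact: F0.
Qed.

Lemma malg_lift_is_zmod_morphism (F : K -> A -> C) :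
  (forall k, zmod_morphism (F k)) -> zmod_morphism (malg_lift F).
Proof.
move=> FB; have F0 k : F k 0 = 0 by rewrite -(subrr 0) FB subrr.
move=> c c'; pose X := (msupp c `|` msupp c')%fset.
rewrite !(@malg_liftEw F _ X) ?fsubsetUl ?fsubsetUr ?msuppB_le //.
by rewrite -sumrB; apply: eq_bigr => k _; rewrite mcoeffB FB.
Qed.

Lemma malg_liftU (F : K -> A -> C) (a : A) (k : K) :
  F k 0 = 0 -> malg_lift F << a *g k >> = F k a.
Proof.
move=> F0; rewrite /malg_lift msuppU; case: eqP => [->|_].
  by rewrite big_seq_fset0 F0.
by rewrite big_seq_fset1 mcoeffUU.
Qed.

End LinearExtension.

Section DirectSum.
Context {I : choiceType} (A : I -> zmodType).

Definition dprod : Type := forall i, A i.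

HB.instance Definition _ := Choice.on dprod.

Definition dprod0 : dprod := fun=> 0.
Definition dprodN (f : dprod) : dprod := fun i => - f i.
Definition dprodD (f g : dprod) : dprod := fun i => f i + g i.

Lemma dprodDA : associative dprodD.
Proof. by move=> f g h; apply: functional_extensionality_dep => i; exact: addrA. Qed.
Lemma dprodDC : commutative dprodD.
Proof. by move=> f g; apply: functional_extensionality_dep => i; exact: addrC. Qed.
Lemma dprod0D : left_id dprod0 dprodD.
Proof. by move=> f; apply: functional_extensionality_dep => i; exact: add0r. Qed.
Lemma dprodND : left_inverse dprod0 dprodN dprodD.
Proof. by move=> f; apply: functional_extensionality_dep => i; exact: addNr. Qed.

HB.instance Definition _ :=
  GRing.isZmodule.Build dprod dprodDA dprodDC dprod0D dprodND.

Definition dsupp (f : dprod) : set I := [set i | f i != 0].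

Definition dfinite : {pred dprod} := fun f => `[< finite_set (dsupp f) >].

Lemma dfinite_zmod_closed : zmod_closed dfinite.
Proof.
split=> [|f g /asboolP fin_f /asboolP fin_g]; apply/asboolP.
  by rewrite (_ : dsupp 0 = set0) // eqEsubset; split=> i //=; rewrite /dsupp /= eqxx.
apply: (@sub_finite_set _ _ (dsupp f `|` dsupp g)); last by rewrite finite_setU.
move=> i; rewrite /dsupp /=; have [f0|] := eqVneq (f i) 0; last by left.
have [g0|] := eqVneq (g i) 0; last by right.
by rewrite [X in X != _](_ : _ = f i - g i) // f0 g0 subrr eqxx.
Qed.

HB.instance Definition _ := GRing.isZmodClosed.Build dprod dfinite dfinite_zmod_closed.

Definition dsum : Type := {f : dprod | f \in dfinite}.

HB.instance Definition _ := SubChoice.on dsum.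
HB.instance Definition _ := [SubChoice_isSubZmodule of dsum by <:].

Definition dsum_fun (x : dsum) : forall i, A i := val x.

Definition dsingle (i : I) (a : A i) : dprod :=
  fun j => if i =P j is ReflectT e then ecast k (A k) e a else 0.

Lemma dsingle_finite (i : I) (a : A i) : dsingle a \in dfinite.
Proof.
apply/asboolP; apply: (@sub_finite_set _ _ [set i]) => //.
by move=> j; rewrite /dsupp /dsingle /=; case: eqP => [e _|]; rewrite ?eqxx.
Qed.

Definition dinj (i : I) (a : A i) : dsum := exist _ (dsingle a) (dsingle_finite a).

(* The homomorphism out of the direct sum with components f i. *)
Definition dsum_lift {C : zmodType} (f : forall i, A i -> C) (x : dsum) : C :=
  \sum_(i \in dsupp (val x)) f i (dsum_fun x i).

End DirectSum.
Arguments dfinite {I} A.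
Coercion dsum_fun : dsum >-> Funclass.

Section GroupModules.
Variable G : groupType.

(* A Z[G]-module is the same thing as an abelian group with an additive
   action of G. *)
Record gmodule := GModule {
  gmod_zmod :> zmodType;
  gact : G -> gmod_zmod -> gmod_zmod;
  gact1 : forall a, gact 1%g a = a;
  gactM : forall g h a, gact (g * h)%g a = gact g (gact h a);
  gactB : forall g, zmod_morphism (gact g)
}.

HB.instance Definition _ (M : gmodule) (g : G) :=
  GRing.isZmodMorphism.Build M M (gact g) (gactB g).

Definition trivZ : gmodule.
Proof. by exists int (fun _ m => m). Defined.

Section DirectSumModule.
Context {I : choiceType} (M : I -> gmodule).

Definition dsum_act_fun (g : G) (x : dsum M) : dprod M := fun i => gact g (x i).

Lemma dsum_act_finite g x : dsum_act_fun g x \in dfinite (fun i => M i).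
Proof.
have /asboolP fx := valP x; apply/asboolP.
apply: sub_finite_set fx => i /eqP; rewrite /dsupp /= => h; apply/eqP => xi0; apply: h.
by rewrite /dsum_act_fun (xi0 : x i = 0) raddf0.
Qed.

Definition dsum_act g x : dsum M :=
  exist (fun f => f \in dfinite (fun i => M i)) _ (dsum_act_finite g x).

Definition dsum_gmodule : gmodule.
Proof.
exists (dsum M) dsum_act.
- move=> x; apply: val_inj; apply: functional_extensionality_dep => i.
  exact: gact1.
- move=> g h x; apply: val_inj; apply: functional_extensionality_dep => i.
  exact: gactM.
- move=> g x y; apply: val_inj; apply: functional_extensionality_dep => i.
  exact: gactB.
Defined.

End DirectSumModule.

Section Tensor.
Variables A B : gmodule.

Definition tensor_relation (t : {malg int[(A * B)%type]}) : Prop :=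
  (exists a a' b, t = << (a + a', b) >> - << (a, b) >> - << (a', b) >>) \/
  (exists a b b', t = << (a, b + b') >> - << (a, b) >> - << (a, b') >>).

(* The subgroup generated by the bilinearity relations. *)
Definition tensor_null : {pred {malg int[(A * B)%type]}} := fun t =>
  `[< forall S : zmodClosed {malg int[(A * B)%type]},
        (forall r, tensor_relation r -> r \in S) -> t \in S >].

Lemma tensor_null_zmod_closed : zmod_closed tensor_null.
Proof.
split=> [|t u /asboolP tS /asboolP uS]; apply/asboolP => S relS.
  exact: rpred0.
by rewrite rpredB ?tS ?uS.
Qed.

HB.instance Definition _ := GRing.isZmodClosed.Build {malg int[(A * B)%type]}
  tensor_null tensor_null_zmod_closed.

Definition tensor : zmodType := Quotient.quot tensor_null.

Definition tens (a : A) (b : B) : tensor := \pi_tensor << (a, b) >>.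

Definition pre_tensor_act (g : G) :
    {malg int[(A * B)%type]} -> {malg int[(A * B)%type]} :=
  malg_lift (fun ab m => << m *g (gact g ab.1, gact g ab.2) >>).

Lemma pre_tensor_act_is_zmod_morphism g : zmod_morphism (pre_tensor_act g).
Proof. by apply: malg_lift_is_zmod_morphism => ab m m'; rewrite monalgUB. Qed.

HB.instance Definition _ g := GRing.isZmodMorphism.Build _ _ (pre_tensor_act g)
  (pre_tensor_act_is_zmod_morphism g).

Lemma pre_tensor_actU g ab m :
  pre_tensor_act g << m *g ab >> = << m *g (gact g ab.1, gact g ab.2) >>.
Proof. by rewrite /pre_tensor_act malg_liftU ?monalgU0. Qed.

Lemma pre_tensor_act_null g t :
  t \in tensor_null -> pre_tensor_act g t \in tensor_null.
Proof.
move=> /asboolP tP; apply/asboolP => S relS.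
pose S' : {pred {malg int[(A * B)%type]}} := fun t => pre_tensor_act g t \in S.
have S'P : zmod_closed S'.
  split=> [|u v]; rewrite ![_ \in S']/(pre_tensor_act g _ \in S).
    by rewrite raddf0; exact: rpred0.
  by rewrite raddfB => uS vS; exact: rpredB.
pose S'c : zmodClosed {malg int[(A * B)%type]} :=
  HB.pack S' (GRing.isZmodClosed.Build _ S' S'P).
apply: (tP S'c) => r rel_r; apply: relS.
case: rel_r => [[a [a' [b ->]]]|[a [b [b' ->]]]]; [left|right].
  exists (gact g a), (gact g a'), (gact g b).
  by rewrite !raddfB /= !pre_tensor_actU /= raddfD.
exists (gact g a), (gact g b), (gact g b').
by rewrite !raddfB /= !pre_tensor_actU /= raddfD.
Qed.

Definition tensor_act (g : G) (t : tensor) : tensor :=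
  \pi_tensor (pre_tensor_act g (repr t)).

Lemma tensor_act_pi g t :
  tensor_act g (\pi_tensor t) = \pi_tensor (pre_tensor_act g t).
Proof.
apply/eqP; rewrite -Quotient.idealrBE -raddfB.
by apply: pre_tensor_act_null; rewrite Quotient.idealrBE reprK.
Qed.

Definition tensor_gmodule : gmodule.
Proof.
exists tensor tensor_act.
- elim/quotW => t; rewrite tensor_act_pi; congr (\pi_tensor _).
  rewrite [RHS]monalgE; apply: eq_bigr => -[a b] _.
  by rewrite !gact1.
- move=> g h; elim/quotW => t; rewrite (tensor_act_pi h) !tensor_act_pi.
  congr (\pi_tensor _).
  rewrite [X in _ = pre_tensor_act g X]/pre_tensor_act /malg_lift raddf_sum /=.
  rewrite [LHS]/pre_tensor_act /malg_lift.
  apply: eq_bigr => -[a b] _.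
  by rewrite [RHS]pre_tensor_actU /= !gactM.
- move=> g; elim/quotW => t; elim/quotW => u; rewrite -raddfB !tensor_act_pi.
  by rewrite raddfB raddfB.
Defined.

(* The map induced by f, for f biadditive *)
Definition tensor_lift {C : zmodType} (f : A -> B -> C) (t : tensor) : C :=
  malg_lift (fun ab m => f ab.1 ab.2 *~ m) (repr t).

End Tensor.

End GroupModules.

(* A graded differential group, as a single group with homogeneous parts indexed
   by int and a differential of degree gc_step: -1 for chains, 1 for cochains.
   Elements are thus not typed by their degree. *)
Record gcomplex := GComplex {
  gc_zmod :> zmodType;
  gc_deg : int -> zmodClosed gc_zmod;
  gc_d : {additive gc_zmod -> gc_zmod};
  gc_step : int
}.

Section Homology.
Variables (C : gcomplex) (k : int).

Definition cycle : {pred C} := fun c => (c \in gc_deg C k) && (gc_d C c == 0).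

Lemma cycle_zmod_closed : zmod_closed cycle.
Proof.
split=> [|c c' /andP[cd /eqP c0] /andP[c'd /eqP c'0]]; apply/andP.
  by rewrite rpred0 raddf0.
by rewrite rpredB // raddfB /= c0 c'0 subrr.
Qed.

HB.instance Definition _ := GRing.isZmodClosed.Build C cycle cycle_zmod_closed.

Definition cycles : Type := {c : C | c \in cycle}.

HB.instance Definition _ := SubChoice.on cycles.
HB.instance Definition _ := [SubChoice_isSubZmodule of cycles by <:].

Definition boundary : {pred cycles} := fun c =>
  `[< exists2 b, b \in gc_deg C (k - gc_step C) & gc_d C b = val c >].

Lemma boundary_zmod_closed : zmod_closed boundary.
Proof.
split=> [|c c' /asboolP[b bd bc] /asboolP[b' b'd b'c]]; apply/asboolP.
  by exists 0; rewrite ?rpred0 // !raddf0.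
by exists (b - b'); rewrite ?rpredB // !raddfB /= bc b'c.
Qed.

HB.instance Definition _ := GRing.isZmodClosed.Build cycles boundary
  boundary_zmod_closed.

Definition homology : zmodType := Quotient.quot boundary.

(* The class of a cycle of degree k; by convention 0 if c is not one. *)
Definition hclass (c : C) : homology := \pi_homology (insubd (0 : cycles) c).

Definition hrep (x : homology) : C := val (repr x).

End Homology.

(* The map induced by a chain map phi of degree l - k *)
Definition hmap (C C' : gcomplex) (k l : int) (phi : C -> C')
  (x : homology C k) : homology C' l := hclass l (phi (hrep x)).

Section BarConstruction.
Context {G : groupType}.

Definition bar_merge (i : nat) (s : seq G) : seq G :=
  take i s ++ (nth 1 s i * nth 1 s i.+1)%g :: drop i.+2 s.

Section Complexes.
Variable A : gmodule G.

(* A tensored over Z[G] with the bar resolution: << a *g [:: g1; ..; gk] >>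
   is the chain a (x) [g1 | ... | gk], where G acts on A on the right through
   the inverse. *)
Definition chain : zmodType := {malg A[seq G]}.

Definition bar_boundary (s : seq G) (a : A) : chain :=
  if s is g :: t then
    << gact g^-1%g a *g t >>
    + \sum_(i < size t) << a *g bar_merge i s >> *~ (-1) ^+ i.+1
    + << a *g take (size t) s >> *~ (-1) ^+ size s
  else 0.

Definition chain_d : chain -> chain := malg_lift bar_boundary.

Lemma chain_d_is_zmod_morphism : zmod_morphism chain_d.
Proof.
apply: malg_lift_is_zmod_morphism => -[|g t] a b; first by rewrite subrr.
have UB s (m : int) : << a - b *g s >> *~ m =
    << a *g s >> *~ m - << b *g s >> *~ m :> chain.
  by rewrite monalgUB mulrzBl.
rewrite /bar_boundary [X in _ = _ + X]opprD [RHS]addrACA [X in _ = _ + X + _]opprD.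
rewrite [X in _ = X + _]addrACA -sumrB; congr (_ + _ + _).
- by rewrite gactB monalgUB.
- by apply: eq_bigr => i _; exact: UB.
- exact: UB.
Qed.

HB.instance Definition _ := GRing.isZmodMorphism.Build chain chain chain_d
  chain_d_is_zmod_morphism.

Definition chain_deg (k : int) : {pred chain} := fun c =>
  all (fun s => (size s)%:Z == k) (msupp c).

Lemma chain_deg_zmod_closed k : zmod_closed (chain_deg k).
Proof.
split=> [|c c' /allP cP /allP c'P]; apply/allP => s; first by rewrite msupp0.
by move=> /(fsubsetP (msuppB_le _ _)); rewrite in_fsetU => /orP[/cP|/c'P].
Qed.

HB.instance Definition _ k := GRing.isZmodClosed.Build chain (chain_deg k)
  (chain_deg_zmod_closed k).

Definition bar_chains : gcomplex :=
  GComplex (fun k => chain_deg k : zmodClosed chain) chain_d (-1).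

Definition cochain : zmodType := (seq G -> A)%type.

Definition cochain_d (f : cochain) : cochain := fun s =>
  if s is g :: t then
    gact g (f t)
    + \sum_(i < size t) f (bar_merge i s) *~ (-1) ^+ i.+1
    + f (take (size t) s) *~ (-1) ^+ size s
  else 0.

Lemma cochain_d_is_zmod_morphism : zmod_morphism cochain_d.
Proof.
move=> f h; apply/funext => -[|g t]; first exact: (esym (subrr (0 : A))).
rewrite [RHS]/(cochain_d f (g :: t) - cochain_d h (g :: t)) /cochain_d.
rewrite [X in _ = _ + X]opprD [RHS]addrACA [X in _ = _ + X + _]opprD.
rewrite [X in _ = X + _]addrACA -sumrB; congr (_ + _ + _).
- exact: gactB.
- by apply: eq_bigr => i _; exact: mulrzBl.
- exact: mulrzBl.
Qed.

HB.instance Definition _ := GRing.isZmodMorphism.Build cochain cochain cochain_d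
  cochain_d_is_zmod_morphism.

Definition cochain_deg (p : int) : {pred cochain} := fun f =>
  `[< forall s, (size s)%:Z != p -> f s = 0 >].

Lemma cochain_deg_zmod_closed p : zmod_closed (cochain_deg p).
Proof.
split=> [|f h /asboolP fP /asboolP hP]; apply/asboolP => s sp //.
by transitivity (f s - h s) => //; rewrite (fP s sp) (hP s sp) subrr.
Qed.

HB.instance Definition _ p := GRing.isZmodClosed.Build cochain (cochain_deg p)
  (cochain_deg_zmod_closed p).

Definition bar_cochains : gcomplex :=
  GComplex (fun p => cochain_deg p : zmodClosed cochain) cochain_d 1.

Definition group_homology (k : int) : zmodType := homology bar_chains k.
Definition group_cohomology (p : int) : zmodType := homology bar_cochains p.

End Complexes.
End BarConstruction.

(* The chain map induced by a homomorphism f and an f-equivariant phi *)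
Definition bar_map {G G' : groupType} {A : gmodule G} {B : gmodule G'}
    (f : G -> G') (phi : A -> B) : chain A -> chain B :=
  malg_lift (fun s a => << phi a *g map f s >>).

Section Products.
Context {G : groupType}.

(* If [g1 | ... | gk] stands for the simplex (1, g1, g1 g2, ..., g1 ... gk) of
   the homogeneous bar resolution, the two products below are
     cup : u and v give u (x_0, ..., x_p) (x) v (x_p, ..., x_{p+q}),
     cap : (x_0, ..., x_k) and u give u (x_0, ..., x_p) (x) (x_p, ..., x_k);
   on a homogeneous cochain only one term of the sums over i is nonzero. *)
Definition cup_cochain {A B : gmodule G} (u : cochain A) (v : cochain B) :
    cochain (tensor_gmodule A B) := fun s =>
  \sum_(i < (size s).+1)
    tens (u (take i s)) (gact (\prod_(g <- take i s) g)%g (v (drop i s))).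

Definition cap_chain {A : gmodule G} (c : chain (trivZ G)) (u : cochain A) :
    chain A :=
  malg_lift (fun s (m : trivZ G) => \sum_(i < (size s).+1)
    << gact (\prod_(g <- take i s) g)^-1%g (u (take i s)) *~ m *g drop i s >>) c.

Definition cup {A B : gmodule G} {p q : int} (u : group_cohomology A p)
    (v : group_cohomology B q) :
    group_cohomology (tensor_gmodule A B) (p + q) :=
  hclass (C := bar_cochains (tensor_gmodule A B)) (p + q)
    (cup_cochain (hrep u) (hrep v)).

(* Meaningful for m = k - p only; the target degree m is a parameter so that
   no transport along equalities of degrees is needed. *)
Definition cap {A : gmodule G} {k p : int} (m : int)
    (z : group_homology (trivZ G) k) (u : group_cohomology A p) : group_homology A m :=
  hclass (C := bar_chains A) m (cap_chain (hrep z) (hrep u)).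

Definition poincare_duality (n : nat) (z : group_homology (trivZ G) n%:Z) :
    Prop :=
  forall (A : gmodule G) (p : int),
    bijective (fun u : group_cohomology A p => cap (n%:Z - p) z u).

(* The inverse of u |-> z cap u, from H^(n - i)(G; A) to H_i(G; A) *)
Definition dual_inv (n : nat) (z : group_homology (trivZ G) n%:Z)
    {A : gmodule G} {i : int} (x : group_homology A i) : group_cohomology A (n%:Z - i) :=
  xget 0 [set u | cap i z u = x].

End Products.

Section Subgroups.
Context {G : groupType}.
Implicit Types K H : groupClosed G.

Definition subgrp K : Type := {x : G | x \in K}.

HB.instance Definition _ K := SubChoice.on (subgrp K).
HB.instance Definition _ K := SubChoice_isSubGroup.Build G _ (subgrp K)
  (conj (@gpred1 G K) (@gpredF G K)).

Definition HZ K (k : int) : zmodType := group_homology (trivZ (subgrp K)) k.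

(* The map x |-> a x a^-1 from K to H, when a K a^-1 is contained in H *)
Definition conj_map (a : G) K H (x : subgrp K) : subgrp H :=
  insubd 1%g (a * val x * a^-1)%g.

Definition HZ_conj (a : G) K H (k l : int) : HZ K k -> HZ H l :=
  hmap (C := bar_chains (trivZ (subgrp K))) (C' := bar_chains (trivZ (subgrp H)))
    l (bar_map (A := trivZ (subgrp K)) (B := trivZ (subgrp H))
         (@conj_map a K H) (fun m : int => m)).

Section LeftCosets.
Variable K : groupClosed G.

Definition lcoset_rel : rel G := fun x y => (x^-1 * y)%g \in K.

Lemma lcoset_rel_is_equiv : equiv_class_of lcoset_rel.
Proof.
split=> [x|x y|y x z]; rewrite /lcoset_rel ?mulVg ?gpred1 //.
  by rewrite -gpredV invgM invgK.
by move=> xy yz; rewrite -(mulVKg y z) mulgA gpredM.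
Qed.

Canonical lcoset_equiv := EquivRelPack lcoset_rel_is_equiv.
Canonical lcoset_enc := defaultEncModRel lcoset_rel.

Definition lcosets : choiceType := {eq_quot lcoset_rel}.

Definition lcoset (x : G) : lcosets := \pi_{eq_quot lcoset_rel} x.

Definition lcoset_act (g : G) (c : lcosets) : lcosets :=
  lcoset (g * repr (c : {eq_quot lcoset_rel}))%g.

Lemma lcoset_actE g x : lcoset_act g (lcoset x) = lcoset (g * x)%g.
Proof.
apply/eqmodP; rewrite /= /lcoset_rel invgM -mulgA mulKg.
by rewrite -/(lcoset_rel _ _); apply/eqmodP; rewrite reprK.
Qed.

Lemma lcoset_act1 c : lcoset_act 1 c = c.
Proof. by rewrite /lcoset_act mul1g /lcoset reprK. Qed.

Lemma lcoset_actM g h c : lcoset_act (g * h) c = lcoset_act g (lcoset_act h c).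
Proof. by rewrite [lcoset_act h c]/lcoset_act lcoset_actE mulgA. Qed.

Definition Zcosets_act (g : G) : {malg int[lcosets]} -> {malg int[lcosets]} :=
  malg_lift (fun c m => << m *g lcoset_act g c >>).

Lemma Zcosets_act_is_zmod_morphism g : zmod_morphism (Zcosets_act g).
Proof. by apply: malg_lift_is_zmod_morphism => c m m'; rewrite monalgUB. Qed.

HB.instance Definition _ g := GRing.isZmodMorphism.Build _ _ (Zcosets_act g)
  (Zcosets_act_is_zmod_morphism g).

Lemma Zcosets_actU g m c : Zcosets_act g << m *g c >> = << m *g lcoset_act g c >>.
Proof. by rewrite /Zcosets_act malg_liftU ?monalgU0. Qed.

(* Z[G/K] *)
Definition Zcosets : gmodule G.
Proof.
exists {malg int[lcosets]} Zcosets_act.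
- move=> x; rewrite [RHS]monalgE; apply: eq_bigr => c _.
  by rewrite lcoset_act1.
- move=> g h x; rewrite [X in _ = Zcosets_act g X]/Zcosets_act /malg_lift.
  rewrite raddf_sum /= [LHS]/Zcosets_act /malg_lift; apply: eq_bigr => c _.
  by rewrite [RHS]Zcosets_actU lcoset_actM.
- exact: Zcosets_act_is_zmod_morphism.
Defined.

End LeftCosets.

(* The isomorphism H_k(K) -> H_k(G; Z[G/K]) of Shapiro's lemma *)
Definition shapiro K (k : int) : HZ K k -> group_homology (Zcosets K) k :=
  hmap (C := bar_chains (trivZ (subgrp K))) (C' := bar_chains (Zcosets K)) k
    (bar_map (A := trivZ (subgrp K)) (B := Zcosets K)
       (val : subgrp K -> G) (fun m : int => << m *g lcoset K 1%g >>)).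

End Subgroups.

Section IntersectionPairing.
Context {G : groupType}.
Implicit Types K H : groupClosed G.

Section SubgroupMeet.
Variables (K H : groupClosed G) (g : G).

(* K :&: g H g^-1; recall that x ^ g = g^-1 x g *)
Definition meet_conj_pred : {pred G} := fun x => (x \in K) && ((x ^ g)%g \in H).

Lemma meet_conj_group_closed : group_closed meet_conj_pred.
Proof.
split=> [|x y /andP[xK xH] /andP[yK yH]]; apply/andP.
  by rewrite conj1g !gpred1.
by rewrite conjMg conjVg !gpredF.
Qed.

Definition meet_conj : groupClosed G := HB.pack meet_conj_pred
  (isMul1Closed.Build G meet_conj_pred (fst meet_conj_group_closed))
  (isMulClosed.Build G meet_conj_pred (group_closedM meet_conj_group_closed))
  (isInvClosed.Build G meet_conj_pred (group_closedV meet_conj_group_closed)).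

Definition dcoset_rel : rel G := fun x y =>
  `[< exists k h, [/\ k \in K, h \in H & y = (k * x * h)%g] >].

Lemma dcoset_rel_is_equiv : equiv_class_of dcoset_rel.
Proof.
have sym x y : dcoset_rel x y -> dcoset_rel y x.
  move=> /asboolP[k [h [kK hH ->]]]; apply/asboolP; exists k^-1%g, h^-1%g.
  by rewrite !gpredV -!mulgA mulKg mulgV mulg1.
split=> [x|x y|y x z]; first 1 last.
- by apply/idP/idP; exact: sym.
- move=> /asboolP[k [h [kK hH ->]]] /asboolP[k' [h' [k'K h'H ->]]].
  by apply/asboolP; exists (k' * k)%g, (h * h')%g; rewrite !gpredM ?mulgA.
- by apply/asboolP; exists 1%g, 1%g; rewrite !gpred1 mul1g mulg1.
Qed.

Canonical dcoset_equiv := EquivRelPack dcoset_rel_is_equiv.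
Canonical dcoset_enc := defaultEncModRel dcoset_rel.

(* K \ G / H *)
Definition dcosets : choiceType := {eq_quot dcoset_rel}.

Definition dcoset (x : G) : dcosets := \pi_{eq_quot dcoset_rel} x.

End SubgroupMeet.

Section Pairing.
(* A choice of representatives, d |-> dc_rep d, for each K \ G / H *)
Variable dc_rep : forall K H, dcosets K H -> G.
Arguments dc_rep {K H}.

Section Psi.
Variables K H : groupClosed G.

Definition meet_at (d : dcosets K H) : groupClosed G := meet_conj K H (dc_rep d).

Definition meet_module : gmodule G :=
  dsum_gmodule (fun d : dcosets K H => Zcosets (meet_at d)).

(* On c = g1 K and c' = g2 H, with g the representative of K g1^-1 g2 H, the
   coset a (K :&: gHg^-1) for any a such that a K = g1 K and a g H = g2 H. *)
Definition psi_basis (c : lcosets K) (c' : lcosets H) : meet_module :=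
  let d := dcoset K H ((repr (c : {eq_quot _}))^-1 * repr (c' : {eq_quot _}))%g in
  let a := xget 1%g [set a | lcoset K a = c /\ lcoset H (a * dc_rep d)%g = c'] in
  dinj (A := fun d => Zcosets (meet_at d)) (i := d) << lcoset (meet_at d) a >>.

Definition psi : tensor_gmodule (Zcosets K) (Zcosets H) -> meet_module :=
  tensor_lift (A := Zcosets K) (B := Zcosets H)
    (fun (x : {malg int[lcosets K]}) (y : {malg int[lcosets H]}) =>
    \sum_(c <- msupp x) \sum_(c' <- msupp y) psi_basis c c' *~ (x@_c * y@_c')).

(* The isomorphism from the direct sum of the H_k(K :&: gHg^-1) to homology of
   G with coefficients in the direct sum of the Z[G / (K :&: gHg^-1)] *)
Definition meet_shapiro (k : int)
    (w : dsum (fun d : dcosets K H => HZ (meet_at d) k)) :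
    group_homology meet_module k :=
  dsum_lift (fun d wd =>
    hmap (C := bar_chains (Zcosets (meet_at d))) (C' := bar_chains meet_module) k
      (bar_map (A := Zcosets (meet_at d)) (B := meet_module) id
         (fun x => dinj (A := fun d => Zcosets (meet_at d)) (i := d) x))
      (shapiro wd)) w.

Definition intersection (n : nat) (z : group_homology (trivZ G) n%:Z) (i j : int)
    (x : HZ K i) (y : HZ H j) :
    dsum (fun d : dcosets K H => HZ (meet_at d) (i + j - n%:Z)) :=
  let w := cap (i + j - n%:Z) z
             (cup (dual_inv z (shapiro x)) (dual_inv z (shapiro y))) in
  let psi_w := hmap (C := bar_chains _) (C' := bar_chains meet_module)
                 (i + j - n%:Z) (bar_map id psi) w in
  xget 0 [set t | meet_shapiro t = psi_w].

End Psi.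
End Pairing.
End IntersectionPairing.

Section StringProduct.
Context {G : groupType}.

Definition centralizer_pred (g : G) : {pred G} := fun x => (x * g == g * x)%g.

Lemma centralizer_group_closed g : group_closed (centralizer_pred g).
Proof.
split=> [|x y /eqP xg /eqP yg]; apply/eqP; first by rewrite mul1g mulg1.
exact/esym/(commuteM (esym xg))/commuteV/esym/yg.
Qed.

Definition centralizer (g : G) : groupClosed G := HB.pack (centralizer_pred g)
  (isMul1Closed.Build G _ (fst (centralizer_group_closed g)))
  (isMulClosed.Build G _ (group_closedM (centralizer_group_closed g)))
  (isInvClosed.Build G _ (group_closedV (centralizer_group_closed g))).

Definition conj_rel : rel G := fun x y => `[< exists a, y = (a * x * a^-1)%g >].

Lemma conj_rel_is_equiv : equiv_class_of conj_rel.
Proof.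
have sym x y : conj_rel x y -> conj_rel y x.
  move=> /asboolP[a ->]; apply/asboolP; exists a^-1%g.
  by rewrite invgK -!mulgA mulVg mulg1 mulKg.
split=> [x|x y|y x z]; first 1 last.
- by apply/idP/idP; exact: sym.
- move=> /asboolP[a ->] /asboolP[b ->]; apply/asboolP; exists (b * a)%g.
  by rewrite invgM !mulgA.
- by apply/asboolP; exists 1%g; rewrite invg1 mul1g mulg1.
Qed.

Canonical conj_equiv := EquivRelPack conj_rel_is_equiv.
Canonical conj_enc := defaultEncModRel conj_rel.

Definition conj_classes : choiceType := {eq_quot conj_rel}.

Definition conj_class (x : G) : conj_classes := \pi_{eq_quot conj_rel} x.

Variables (n : nat) (z : group_homology (trivZ G) n%:Z).
Variable cc_rep : conj_classes -> G.
Variable dc_rep : forall K H : groupClosed G, dcosets K H -> G.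

Definition loop_homology (p : int) : zmodType :=
  dsum (fun c : conj_classes => HZ (centralizer (cc_rep c)) (p + n%:Z)).

(* H_(p+n)(C_h) as the summand of the class of h *)
Definition summand (p : int) (h : G) (x : HZ (centralizer h) (p + n%:Z)) :
    loop_homology p :=
  let c := conj_class h in
  let a := xget 1%g [set a | (a * h * a^-1)%g = cc_rep c] in
  dinj (A := fun c => HZ (centralizer (cc_rep c)) (p + n%:Z)) (i := c)
    (HZ_conj a (centralizer (cc_rep c)) (p + n%:Z) x).

(* The degrees (p + n) + (q + n) - n and (p + q) + n are equal but not
   convertible, which is why HZ_conj has independent degree arguments. *)
Definition string_product (p q : int) (x : loop_homology p)
    (y : loop_homology q) : loop_homology (p + q) :=
  dsum_lift (fun c xc => dsum_lift (fun d yd =>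
    let alpha := cc_rep c in let beta := cc_rep d in
    dsum_lift (fun e w =>
      let g := dc_rep e in
      let h := (alpha * g * beta * g^-1)%g in
      summand (h := h) (HZ_conj 1%g (centralizer h) (p + q + n%:Z) w))
    (intersection dc_rep z xc yd)) y) x.

End StringProduct.
Arguments conj_classes G : clear implicits.
Arguments string_product {G n} z cc_rep dc_rep {p q} x y.

Section GradedAlgebra.
Variables (L : int -> zmodType) (mu : forall p q : int, L p -> L q -> L (p + q)).

Definition recast (p q : int) (e : p = q) (x : L p) : L q :=
  ecast r (L r) e x.

Definition graded_biadditive : Prop :=
  (forall p q (y : L q), zmod_morphism (fun x : L p => mu x y)) /\
  (forall p q (x : L p), zmod_morphism (fun y : L q => mu x y)).

Definition graded_associative : Prop :=
  forall p q r (x : L p) (y : L q) (w : L r),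
    recast (addrA p q r) (mu x (mu y w)) = mu (mu x y) w.

Definition graded_commutative : Prop :=
  forall p q (x : L p) (y : L q),
    recast (addrC q p) (mu y x) = mu x y *~ (-1) ^ (p * q).

Definition graded_unital : Prop :=
  exists e : L 0, forall p (x : L p),
    recast (add0r p) (mu e x) = x /\ recast (addr0 p) (mu x e) = x.

End GradedAlgebra.

(* Main.v *)
(* Let Ad be Z[G] with the conjugation action. Shapiro's lemma, applied to each
   conjugacy class, embeds the loop homology L_p in H_(p+n)(G; Ad), which
   Poincare duality identifies with H^(-p)(G; Ad). Under this identification the
   string product becomes the cup product followed by the equivariant
   multiplication of Ad: the double coset decomposition psi of
   Z[G/C_alpha] (x) Z[G/C_beta] is compatible with the evaluations
   g1 C_alpha |-> g1 alpha g1^-1, g2 C_beta |-> g2 beta g2^-1, because a coset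
   a (C_alpha n g C_beta g^-1) can be evaluated at a (alpha g beta g^-1) a^-1.
   Biadditivity, associativity and the unit, which is dual to 1 in H^0(G; Ad),
   are then visible on cochains. For commutativity, Steenrod's cup-one product
   exchanges the two factors up to (-1)^(pq), and the resulting coefficients xy and
   yx give the same class in the homology of G, since x y = y (y^-1 x y) and
   translating coefficients equivariantly inside their orbits acts trivially.

   All chain level identities are checked in the homogeneous bar resolution, where
   a simplex is a list of elements of G and the boundary has a recursive
   description with respect to the first vertex; the explicit formulas for cup-one
   products, prisms and Leibniz rules are then proved by induction on lists. *)

Require Import Defs.
From HB Require Import structures.
From mathcomp Require Import all_boot all_order all_algebra.
From mathcomp Require Import finmap monalg zify.
From mathcomp Require Import boolp classical_sets functions cardinality fsbigop.

Set Implicit Arguments.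
Unset Strict Implicit.
Unset Printing Implicit Defensive.

Import Order.TTheory GRing.Theory Num.Theory.

Local Open Scope ring_scope.

(** The definition of the product rests on choices: the inverse of duality and the preimage in
    [intersection] are picked by choice, and the representatives of classes and double cosets are
    arbitrary. Identities are therefore tested after the injective map [loop_class], where a class
    of degree p + n is z cap u for a cocycle u of degree -p. Bijectivity of duality gives such a u,
    unique up to a coboundary, so products may be computed from any dual cocycles. Even biadditivity
    of the string product, not visible from its definition, is obtained from [loop_class_mul].

    Degrees such as (p + n) + (q + n) - n and p + q + n are equal without being convertible; hence
    source and target degrees of induced maps are independent and tied by an explicit equation.

    The list calculus includes the empty list, on which homogeneous chains and cochains vanish. The
    general Leibniz rules nevertheless carry terms at the empty list: their inductions freeze the
    first vertex, and [fun t => u (x :: t)] takes the value u (x) there. *)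

Section AbelianGroupTactic.
Context {X : zmodType}.

Inductive zexpr := ZVar of nat | ZAdd of zexpr & zexpr | ZOpp of zexpr | ZZero.

Fixpoint zeval (env : seq X) (e : zexpr) : X :=
  match e with
  | ZVar i => env`_i
  | ZAdd e1 e2 => zeval env e1 + zeval env e2
  | ZOpp e1 => - zeval env e1
  | ZZero => 0
  end.

(* The numbers of positive and of negative occurrences of the i-th atom. *)
Fixpoint zcount (i : nat) (e : zexpr) : nat * nat :=
  match e with
  | ZVar j => (nat_of_bool (j == i), 0%N)
  | ZAdd e1 e2 => let: (p1, n1) := zcount i e1 in let: (p2, n2) := zcount i e2 in
                  ((p1 + p2)%N, (n1 + n2)%N)
  | ZOpp e1 => let: (p, n) := zcount i e1 in (n, p)
  | ZZero => (0%N, 0%N)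
  end.

Lemma zevalE env e :
  zeval env e = \sum_(i < size env)
    (env`_i *+ (zcount i e).1 - env`_i *+ (zcount i e).2).
Proof.
elim: e => [j|e1 IH1 e2 IH2|e1 IH1|] /=.
- have [jlt|jge] := ltnP j (size env).
    rewrite (bigD1 (Ordinal jlt)) //= eqxx subr0 big1 ?addr0 // => i.
    by rewrite -val_eqE eq_sym /= => /negbTE->; rewrite subrr.
  rewrite nth_default // big1 // => i _.
  by rewrite (gtn_eqF (leq_trans (ltn_ord i) jge)) subrr.
- rewrite IH1 IH2 -big_split; apply: eq_bigr => i _ /=.
  case: (zcount i e1) (zcount i e2) => [p1 n1] [p2 n2] /=.
  by rewrite !mulrnDr opprD addrACA.
- by rewrite IH1 -sumrN; apply: eq_bigr => i _; case: zcount => p n; rewrite opprB.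
- by rewrite big1 // => i _; rewrite subrr.
Qed.

(** The coefficient of an atom is the difference p - n of its two counts; comparing p1 + n2 with p2
    + n1 avoids subtraction and keeps the test in closed natural numbers. *)
Fixpoint zcheck (k : nat) (e1 e2 : zexpr) : bool :=
  if k is k'.+1 then
    ((zcount k' e1).1 + (zcount k' e2).2 == (zcount k' e2).1 + (zcount k' e1).2)%N
    && zcheck k' e1 e2
  else true.

Lemma zcheckP env e1 e2 : zcheck (size env) e1 e2 -> zeval env e1 = zeval env e2.
Proof.
move=> chk; rewrite !zevalE; apply: eq_bigr => -[i ilt] _ /=.
suff /eqP e : ((zcount i e1).1 + (zcount i e2).2 == (zcount i e2).1 + (zcount i e1).2)%N.
  by apply/eqP; rewrite subr_eq addrAC eq_sym subr_eq -!mulrnDr e.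
elim: (size env) chk ilt => //= k IH /andP[h1 h2]; rewrite ltnS leq_eqVlt.
by case/orP=> [/eqP->|]; [|exact: IH].
Qed.

End AbelianGroupTactic.

Ltac zindex x env :=
  lazymatch env with
  | cons ?y ?env' =>
      match constr:(Set) with
      | _ => let _ := match constr:(Set) with _ => constr_eq x y end in constr:(0%N)
      | _ => let i := zindex x env' in constr:(S i)
      end
  end.
Ltac zatoms e env :=
  lazymatch e with
  | (?a + ?b)%R => let env1 := zatoms a env in zatoms b env1
  | (- ?a)%R => zatoms a env
  | 0%R => env
  | _ => match constr:(Set) with
         | _ => let _ := zindex e env in env
         | _ => constr:(cons e env)
         end
  end.
Ltac zreify e env :=
  lazymatch e with
  | (?a + ?b)%R => let a' := zreify a env in let b' := zreify b env in constr:(ZAdd a' b')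
  | (- ?a)%R => let a' := zreify a env in constr:(ZOpp a')
  | 0%R => constr:(ZZero)
  | _ => let i := zindex e env in constr:(ZVar i)
  end.
(* Decides equations between sums and differences in an abelian group. *)
Ltac zmod :=
  lazymatch goal with
  | |- @eq ?X ?a ?b =>
      let env0 := zatoms a (@nil X) in
      let env := zatoms b env0 in
      let ea := zreify a env in
      let eb := zreify b env in
      refine (@zcheckP _ env ea eb _); vm_compute; reflexivity
  end.

(** * Additive maps *)

Section ZmodMorphism.
Context {A B : zmodType} (f : A -> B) (fB : zmod_morphism f).

Lemma zmorph0 : f 0 = 0.
Proof. by rewrite -(subrr 0) fB subrr. Qed.

Lemma zmorphN x : f (- x) = - f x.
Proof. by rewrite -[in LHS](sub0r x) fB zmorph0 sub0r. Qed.

Lemma zmorphD x y : f (x + y) = f x + f y.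
Proof. by rewrite -[in LHS](opprK y) fB zmorphN opprK. Qed.

Lemma zmorph_sum (I : Type) (r : seq I) (P : pred I) (F : I -> A) :
  f (\sum_(i <- r | P i) F i) = \sum_(i <- r | P i) f (F i).
Proof. by apply: (big_morph f zmorphD zmorph0). Qed.

Lemma zmorphMn x n : f (x *+ n) = f x *+ n.
Proof. by elim: n => [|n IH]; rewrite ?mulr0n ?zmorph0 // !mulrS zmorphD IH. Qed.

Lemma zmorphMz x m : f (x *~ m) = f x *~ m.
Proof. by case: m => n; rewrite ?NegzE ?mulrNz ?zmorphN -!pmulrn zmorphMn. Qed.

End ZmodMorphism.

Lemma zmorph_comp (A B C : zmodType) (f : B -> C) (g : A -> B) :
  zmod_morphism f -> zmod_morphism g -> zmod_morphism (fun x => f (g x)).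
Proof. by move=> fB gB x y; rewrite gB fB. Qed.

Lemma zmorph_sub (A B : zmodType) (f g : A -> B) :
  zmod_morphism f -> zmod_morphism g -> zmod_morphism (fun x => f x - g x).
Proof. by move=> fB gB x y; rewrite fB gB; zmod. Qed.

Lemma zmorph_mulz (A : zmodType) (m : int) : zmod_morphism (fun x : A => x *~ m).
Proof. by move=> x y; rewrite mulrzBl. Qed.

(** * Boundaries and prisms on lists of vertices *)

Section HomogeneousCalculus.
Context {T : Type}.

(* The transpose of the boundary of the homogeneous bar resolution:
   delta F (x_0, ..., x_k) is the alternating sum of the values of F on the
   faces of (x_0, ..., x_k). *)
Fixpoint delta {X : zmodType} (F : seq T -> X) (l : seq T) : X :=
  if l is x :: s then F s - delta (fun t => F (x :: t)) s else 0.

Lemma eq_delta (X : zmodType) (F H : seq T -> X) : F =1 H -> delta F =1 delta H.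
Proof.
move=> + l; elim: l F H => [//|x l IH] F H FH /=; rewrite FH; congr (_ - _).
by apply: IH => t; exact: FH.
Qed.

Lemma delta_morph (X Y : zmodType) (h : X -> Y) (F : seq T -> X) l :
  zmod_morphism h -> h (delta F l) = delta (fun t => h (F t)) l.
Proof.
by move=> hB; elim: l F => [|x l IH] F /=; rewrite ?(zmorph0 hB) // hB IH.
Qed.

Lemma deltaB (X : zmodType) (F H : seq T -> X) l :
  delta (fun t => F t - H t) l = delta F l - delta H l.
Proof.
elim: l F H => [|x l IH] F H /=; first by rewrite subrr.
by rewrite IH; zmod.
Qed.

Lemma deltaD (X : zmodType) (F H : seq T -> X) l :
  delta (fun t => F t + H t) l = delta F l + delta H l.
Proof.
by elim: l F H => [|x l IH] F H /=; rewrite ?addr0 // IH opprD addrACA.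
Qed.

(* The homotopy between the identity and the vertexwise map f that sends
   (x_0, ..., x_k) to the sum of (-1)^i (x_0, ..., x_i, f x_i, ..., f x_k). *)
Fixpoint prism {X : zmodType} (f : T -> T) (F : seq T -> X) (l : seq T) : X :=
  if l is x :: s
  then F (x :: map f l) - prism f (fun t => F (x :: t)) s else 0.

Lemma eq_prism (X : zmodType) (f : T -> T) (F H : seq T -> X) :
  F =1 H -> prism f F =1 prism f H.
Proof.
move=> + l; elim: l F H => [//|x l IH] F H FH /=; rewrite FH; congr (_ - _).
by apply: IH => t; exact: FH.
Qed.

Lemma prism_morph (X Y : zmodType) (h : X -> Y) f (F : seq T -> X) l :
  zmod_morphism h -> h (prism f F l) = prism f (fun t => h (F t)) l.
Proof.
by move=> hB; elim: l F => [|x l IH] F /=; rewrite ?(zmorph0 hB) // hB IH.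
Qed.

Lemma prismB (X : zmodType) f (F H : seq T -> X) l :
  prism f (fun t => F t - H t) l = prism f F l - prism f H l.
Proof.
elim: l F H => [|x l IH] F H /=; first by rewrite subrr.
by rewrite IH; zmod.
Qed.

End HomogeneousCalculus.

Lemma delta_map (S T : Type) (X : zmodType) (f : S -> T) (F : seq T -> X) l :
  delta F (map f l) = delta (fun t => F (map f t)) l.
Proof. by elim: l F => //= x l IH F; rewrite IH. Qed.

Lemma prism_map (S T : Type) (X : zmodType) (h : S -> T) (f : S -> S) (f' : T -> T)
    (F : seq T -> X) l : (forall x, h (f x) = f' (h x)) ->
  prism f' F (map h l) = prism f (fun t => F (map h t)) l.
Proof.
move=> hf; elim: l F => //= x l IH F; rewrite IH hf -!map_comp.
by congr (F _ - _); congr [:: _, _ & _]; apply: eq_map => y /=.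
Qed.

(** Telescopes through the simplex that keeps its first vertex x and moves all the others. The
    induction hypothesis for the simplices starting at x accounts for the step from x :: l to this
    mixed simplex; the faces of (x, f x, ..., f x_k) that omit x or f x account for the step from
    there to [map f (x :: l)]. *)
Lemma prism_delta (T : Type) (X : zmodType) f (F : seq T -> X) l :
  prism f (delta F) l + delta (prism f F) l = F (map f l) - F l.
Proof.
elim: l F => [|x l IH] F /=; first by rewrite addr0 subrr.
rewrite prismB deltaB -(delta_map f (fun t => F [:: x, f x & t])).
have -> : F (map f (x :: l)) - F (x :: l) = F (f x :: map f l) - F (x :: map f l)
  + (F (x :: map f l) - F (x :: l)) by rewrite subrKA.
rewrite -(IH (fun t => F (x :: t))) /=.
zmod.
Qed.

Lemma zmorph_opp (A : zmodType) : zmod_morphism (-%R : A -> A).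
Proof. by move=> x y; rewrite opprD. Qed.

(** * Front and back face pairings, and the cup-one product *)

Section Pairing.
Context {T : Type} {A X : zmodType}.
Implicit Types (theta : A -> seq T -> X) (u : seq T -> A).

(* The sum of theta (u (x_0, ..., x_i)) (x_i, ..., x_k) over i. *)
Fixpoint pair_split theta u (l : seq T) : X :=
  if l is x :: s then theta (u [:: x]) l + pair_split theta (fun t => u (x :: t)) s
  else 0.

(** For a cochain of degree p this is multiplication by (-1)^(p+1), a p-simplex being a list of p +
    1 vertices. Reading the sign off the list lets the Leibniz rule hold without any homogeneity
    assumption. *)
Definition sign_size u l : A := u l *~ (-1) ^+ size l.

Lemma eq_pair_split theta theta' u u' :
  theta =2 theta' -> u =1 u' -> pair_split theta u =1 pair_split theta' u'.
Proof.
move=> th + l; elim: l u u' => [//|x l IH] u u' uu' /=.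
by rewrite uu' th; congr (_ + _); apply: IH => t; exact: uu'.
Qed.

Lemma eq_pair_splitl theta theta' u :
  theta =2 theta' -> pair_split theta u =1 pair_split theta' u.
Proof. by move=> th; apply: eq_pair_split. Qed.

Lemma eq_pair_splitr theta u u' :
  u =1 u' -> pair_split theta u =1 pair_split theta u'.
Proof. by move=> uu'; apply: eq_pair_split. Qed.

Lemma pair_splitBr theta u u' l : (forall t, zmod_morphism (theta^~ t)) ->
  pair_split theta (fun t => u t - u' t) l
  = pair_split theta u l - pair_split theta u' l.
Proof.
move=> thB; elim: l u u' => [|x l IH] u u' /=; first by rewrite subrr.
by rewrite IH (thB (x :: l)); zmod.
Qed.

Lemma pair_splitMz theta u m l : (forall t, zmod_morphism (theta^~ t)) ->
  pair_split theta (fun t => u t *~ m) l = pair_split theta u l *~ m.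
Proof.
move=> thB; elim: l u => [|x l IH] u /=; first by rewrite mul0rz.
by rewrite IH (zmorphMz (thB (x :: l))) mulrzDl.
Qed.

Lemma pair_splitN theta u l : (forall t, zmod_morphism (theta^~ t)) ->
  pair_split theta (fun t => - u t) l = - pair_split theta u l.
Proof.
move=> thB; elim: l u => [|x l IH] u /=; first by rewrite oppr0.
by rewrite IH (zmorphN (thB (x :: l))) opprD.
Qed.

Lemma pair_splitBl theta theta' u l :
  pair_split (fun a t => theta a t - theta' a t) u l
  = pair_split theta u l - pair_split theta' u l.
Proof.
by elim: l u => [|x l IH] u /=; rewrite ?subrr // IH; zmod.
Qed.

Lemma delta_zmorph theta : (forall t, zmod_morphism (theta^~ t)) ->
  forall l, zmod_morphism (fun a => delta (theta a) l).
Proof. by move=> thB l a b; rewrite -deltaB; apply: eq_delta => t; apply: thB. Qed.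

(** Deleting the cut vertex from the front face at one cut cancels against deleting the first vertex
    of the back face at the preceding cut. At the two ends nothing is left to cancel, which produces
    the two terms at the empty list. *)
Lemma delta_pair_split theta u l : (forall t, zmod_morphism (theta^~ t)) ->
  delta (pair_split theta u) l
  = pair_split theta (delta u) l
    - pair_split (fun a => delta (theta a)) (sign_size u) l
    - theta (u [::]) l + theta (sign_size u l) [::].
Proof.
move=> thB; have dB := delta_zmorph thB; elim: l u => [|x l IH] u /=.
  by rewrite /sign_size expr0 mulr1z; zmod.
have sgx t : sign_size u (x :: t) = - sign_size (fun t => u (x :: t)) t.
  by rewrite /sign_size /= exprS mulN1r mulrNz.
rewrite deltaD {}IH pair_splitBr // subr0 (eq_pair_splitr _ sgx).
rewrite pair_splitN // !sgx (zmorphN (thB [::])) (zmorphN (thB l)).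
have -> : sign_size (fun t => u (x :: t)) [::] = u [:: x].
  by rewrite /sign_size expr0 mulr1z.
have -> : delta (fun t => theta (- u [:: x]) (x :: t)) l
    = - delta (fun t => theta (u [:: x]) (x :: t)) l.
  rewrite (delta_morph _ _ (@zmorph_opp _)); apply: eq_delta => t.
  exact: zmorphN (thB _) _.
zmod.
Qed.

End Pairing.

Lemma pair_split_morph (T : Type) (A X Y : zmodType) (h : X -> Y)
    (theta : A -> seq T -> X) u l : zmod_morphism h ->
  h (pair_split theta u l) = pair_split (fun a t => h (theta a t)) u l.
Proof.
move=> hB; elim: l u => [|x l IH] u /=; rewrite ?(zmorph0 hB) //.
by rewrite (zmorphD hB) IH.
Qed.

(* Steenrod's cup-one product; its terms are, up to sign,
   u (x_0, ..., x_i, x_(i+q), ..., x_k) v (x_i, ..., x_(i+q)) with q the degree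
   of v and sgn its sign (-1)^q. *)
Fixpoint cup1 {T : Type} {A B X : zmodType} (beta : A -> B -> X) (sgn : int)
    (v : seq T -> B) (u : seq T -> A) (l : seq T) : X :=
  if l is x :: s
  then pair_split (fun b t => beta (u (x :: t)) b) v l
       - cup1 beta sgn v (fun t => u (x :: t)) s *~ sgn
  else 0.

Section CupOne.
Context {T : Type} {A B X : zmodType} (beta : A -> B -> X).
Hypotheses (betaBl : forall b, zmod_morphism (beta^~ b))
  (betaBr : forall a, zmod_morphism (beta a)).
Variables (sgn : int) (v : seq T -> B).
Hypotheses (sgn2 : sgn * sgn = 1) (v0 : v [::] = 0) (dv : delta v =1 fun=> 0).
Hypothesis v_deg : forall l, sign_size v l = - v l *~ sgn.

Lemma pair_split_flipB (w : seq T -> B) u u' l :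
  pair_split (fun b t => beta (u t - u' t) b) w l
  = pair_split (fun b t => beta (u t) b) w l - pair_split (fun b t => beta (u' t) b) w l.
Proof. by rewrite -pair_splitBl; apply: eq_pair_splitl => b t; exact: betaBl. Qed.

Lemma cup1B u u' l :
  cup1 beta sgn v (fun t => u t - u' t) l = cup1 beta sgn v u l - cup1 beta sgn v u' l.
Proof.
elim: l u u' => [|x l IH] u u' /=; first by rewrite subrr.
rewrite IH mulrzBl betaBl pair_split_flipB; zmod.
Qed.

(** Here the cocycle v sits on the front face and u on the back face, so only the coboundary of u
    survives, with the sign of moving it past v. The value [u [::]] is kept because the rule is
    applied to a cochain whose first vertex is frozen. *)
Lemma delta_pair_flip (u : seq T -> A) l :
  delta (pair_split (fun b t => beta (u t) b) v) l
  = (pair_split (fun b t => beta (delta u t) b) v l - beta (u [::]) (v l)) *~ sgn.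
Proof.
have thB t : zmod_morphism (beta (u t)) by exact: betaBr.
rewrite delta_pair_split // v0 (zmorph0 (thB _)) subr0 v_deg mulNrz.
rewrite (eq_pair_splitr _ dv).
rewrite [X in _ - X](_ : _ = pair_split (fun b t => beta (delta u t) b)
    (fun t => v t *~ - sgn) l); last first.
  apply: eq_pair_split => [b t|t]; last by rewrite v_deg mulNrz mulrNz.
  by rewrite (delta_morph _ _ (betaBl b)).
rewrite pair_splitMz; last by move=> t; exact: betaBr.
have -> : pair_split (fun b t => beta (u t) b) (fun=> 0) l = 0.
  rewrite -[RHS](mulr0z (pair_split (fun b t => beta (u t) b) v l)).
  by rewrite -pair_splitMz.
by rewrite (zmorphN (thB _)) (zmorphMz (thB _)) mulrNz mulrzBl; zmod.
Qed.

(** Steenrod's coboundary formula: for cocycles, cup-one is a homotopy between the two orders of the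
    product. The sign [sgn ^+ size t] is (-1)^(q(p+1)) when u has degree p and v has degree q. *)
Lemma delta_cup1 (u : seq T -> A) l :
  delta (cup1 beta sgn v u) l
  = (pair_split (fun b t => beta (u t) b) v l - cup1 beta sgn v (delta u) l) *~ sgn
    - pair_split (fun a t => beta a (v t)) (fun t => u t *~ sgn ^+ size t) l.
Proof.
elim: l u => [|x l IH] u /=; first by rewrite subrr mul0rz subrr.
have thB t : zmod_morphism (fun a => beta a (v t)) by exact: betaBl.
(* The leading summand of [cup1] at x :: t is itself a pairing over x :: t; its boundary in t is
   extracted from the flip rule on the whole list x :: l. *)
have := delta_pair_flip (fun t => u (x :: t)) (x :: l); rewrite /=.
rewrite deltaB -(delta_morph _ _ (@zmorph_mulz _ sgn)) IH cup1B.
have e t : u (x :: t) *~ sgn ^+ size (x :: t) = u (x :: t) *~ sgn ^+ size t *~ sgn.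
  by rewrite -mulrzA -exprSr.
rewrite (eq_pair_splitr _ e).
rewrite pair_splitMz // !mulrzBl -!mulrzA sgn2 !mulr1z expr1.
rewrite (zmorphMz (thB (x :: l))).
rewrite !betaBl !pair_split_flipB !mulrzDl !mulNrz !mulrzDl !mulNrz.
move=> /eqP; rewrite subr_eq [X in _ == X]addrC -subr_eq => /eqP <-; zmod.
Qed.

End CupOne.

(** * The bar complexes in homogeneous coordinates *)

Lemma zmorph_malgU (K : choiceType) (A : zmodType) (k : K) :
  zmod_morphism (fun a : A => << a *g k >>).
Proof. by move=> a b; rewrite monalgUB. Qed.

Lemma zmorph_malgE (K : choiceType) (A X : zmodType) (f : {malg A[K]} -> X) c :
  zmod_morphism f -> f c = \sum_(k <- msupp c) f << c@_k *g k >>.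
Proof. by move=> fB; rewrite [in LHS](monalgE c) (zmorph_sum fB). Qed.

Lemma malg_ext (K : choiceType) (A X : zmodType) (f h : {malg A[K]} -> X) :
  zmod_morphism f -> zmod_morphism h ->
  (forall a k, f << a *g k >> = h << a *g k >>) -> f =1 h.
Proof.
move=> fB hB fh c; rewrite (zmorph_malgE _ fB) (zmorph_malgE _ hB).
by apply: eq_bigr => k _.
Qed.

Lemma chain_deg_ind (G : groupType) (A : gmodule G) (X : zmodType)
    (S : zmodClosed X) (f : chain A -> X) k c :
  zmod_morphism f -> c \in chain_deg (A := A) k ->
  (forall a s, (size s)%:Z = k -> f << a *g s >> \in S) -> f c \in S.
Proof.
move=> fB /allP ck fS; rewrite (zmorph_malgE c fB) big_seq.
by apply: rpred_sum => s /ck /eqP /fS.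
Qed.

Lemma chain_degU (G : groupType) (A : gmodule G) (a : A) s k :
  (size s)%:Z = k -> (<< a *g s >> : chain A) \in chain_deg (A := A) k.
Proof.
move=> sk; apply/allP => t /(fsubsetP msuppU_le); rewrite in_fset1 => /eqP->.
exact/eqP.
Qed.

Definition vertices {G : groupType} (x : G) (s : seq G) : seq G := x :: scanl *%g x s.

Definition edges {G : groupType} (x : G) (l : seq G) : seq G :=
  pairmap (fun y z => y^-1 * z)%g x l.

Lemma map_edges (G H : groupType) (f : G -> H) x l :
  (forall y z, f (y * z)%g = f y * f z)%g -> map f (edges x l) = edges (f x) (map f l).
Proof.
move=> fM; have f1 : f 1%g = 1%g by apply: (mulgI (f 1%g)); rewrite -fM !mulg1.
have fV y : f y^-1%g = (f y)^-1%g.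
  by apply: (mulgI (f y)); rewrite -fM !mulgV.
by elim: l x => //= y l IH x; rewrite IH fM fV.
Qed.

Section HomogeneousBar.
Context {G : groupType}.
Implicit Types (x g : G) (s l : seq G).

Lemma verticesK x l : vertices x (edges x l) = x :: l.
Proof. by rewrite /vertices pairmapK // => y z; rewrite mulVKg. Qed.

Lemma edgesK x s : edges x (scanl *%g x s) = s.
Proof. by rewrite /edges scanlK // => y z; rewrite mulKg. Qed.

Lemma size_edges x l : size (edges x l) = size l.
Proof. exact: size_pairmap. Qed.

Lemma size_vertices x s : size (vertices x s) = (size s).+1.
Proof. by rewrite /= size_scanl. Qed.

Lemma edges_mul g x l : edges (g * x)%g (map ( *%g g) l) = edges x l.
Proof. by elim: l x => //= y l IH x; rewrite IH invgM -mulgA mulKg. Qed.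

Lemma map_mul_vertices g x s : map ( *%g g) (vertices x s) = vertices (g * x)%g s.
Proof.
rewrite /vertices /=; congr (_ :: _).
by elim: s x => //= h s IH x; rewrite IH mulgA.
Qed.

Lemma map_mulV_cons x l : map ( *%g x^-1%g) (x :: l) = vertices 1%g (edges x l).
Proof. by rewrite -[x :: l]verticesK map_mul_vertices mulVg. Qed.

(** Multiplying two neighbouring edges deletes the vertex between them, and dropping the last edge
    deletes the last vertex. These are all the faces that keep the first vertex x, so the induction
    absorbs x into F. *)
Lemma sum_inner_faces (X : zmodType) (F : seq G -> X) x g s :
  \sum_(i < size s) F (vertices x (bar_merge i (g :: s))) *~ (-1) ^+ i.+1
  + F (vertices x (take (size s) (g :: s))) *~ (-1) ^+ (size s).+1
  = - delta (fun l => F (x :: l)) (vertices (x * g)%g s).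
Proof.
elim: s x g F => [|h s IH] x g F.
  by rewrite big_ord0 add0r /= expr1 mulrN1z subr0.
rewrite [size (h :: s)]/= big_ord_recl /= expr1 mulrN1z.
under eq_bigr => i _ do rewrite exprS mulN1r mulrNz.
rewrite sumrN exprS mulN1r mulrNz -addrA -!opprD; congr (- _).
congr (_ + _); first by rewrite /vertices /= drop0 mulgA.
exact: (IH (x * g)%g h (fun l => F (x :: l))).
Qed.

Lemma delta_vertices (X : zmodType) (F : seq G -> X) x g s :
  delta F (vertices x (g :: s))
  = F (vertices (x * g)%g s)
    + \sum_(i < size s) F (vertices x (bar_merge i (g :: s))) *~ (-1) ^+ i.+1
    + F (vertices x (take (size s) (g :: s))) *~ (-1) ^+ (size s).+1.
Proof. by rewrite -addrA sum_inner_faces. Qed.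

End HomogeneousBar.

Section Dehomogenize.
Context {G : groupType}.
Variable A : gmodule G.

(* The list x_0, ..., x_k stands for a homogeneous simplex; the empty list, which
   is not a simplex, is sent to 0. *)
Definition hom_cochain (u : cochain A) (l : seq G) : A :=
  if l is x :: t then gact x (u (edges x t)) else 0.

(** The class of a (x) (x_0, ..., x_k) in the coinvariants of the diagonal action, normalized to
    first vertex 1; this is where the factor x^-1 on a comes from. *)
Definition hom_chain (a : A) (l : seq G) : chain A :=
  if l is x :: t then << gact x^-1%g a *g edges x t >> else 0.

Lemma gactK (g : G) : cancel (gact g : A -> A) (gact g^-1%g).
Proof. by move=> a; rewrite -gactM mulVg gact1. Qed.

Lemma gactVK (g : G) : cancel (gact g^-1%g : A -> A) (gact g).
Proof. by move=> a; rewrite -gactM mulgV gact1. Qed.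

Lemma hom_cochain_mul u g l : hom_cochain u (map ( *%g g) l) = gact g (hom_cochain u l).
Proof.
by case: l => [|x t] /=; rewrite ?(zmorph0 (gactB _)) // edges_mul gactM.
Qed.

Lemma hom_chain_mul a g l : hom_chain (gact g a) (map ( *%g g) l) = hom_chain a l.
Proof. by case: l => //= x t; rewrite edges_mul invgM gactM gactK. Qed.

Lemma hom_cochain_vertices u x s : hom_cochain u (vertices x s) = gact x (u s).
Proof. by rewrite /= edgesK. Qed.

Lemma hom_chain_vertices a s : hom_chain a (vertices 1%g s) = << a *g s >>.
Proof. by rewrite /= edgesK invg1 gact1. Qed.

Lemma hom_chainB l : zmod_morphism (hom_chain^~ l).
Proof.
by case: l => [|x t] a b /=; rewrite ?subrr // gactB monalgUB.
Qed.

Lemma cochain_dE u s : cochain_d u s = delta (hom_cochain u) (vertices 1%g s).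
Proof.
case: s => [|g s]; first by rewrite /= subrr.
rewrite delta_vertices mul1g hom_cochain_vertices.
rewrite [LHS]/= hom_cochain_vertices gact1; congr (_ + _ + _).
by apply: eq_bigr => i _; rewrite hom_cochain_vertices gact1.
Qed.

Lemma chain_dE a s : chain_d (<< a *g s >> : chain A) = delta (hom_chain a) (vertices 1%g s).
Proof.
rewrite /chain_d malg_liftU; last first.
  case: s => //= g t; rewrite (zmorph0 (gactB _)) !monalgU0 mul0rz big1 ?addr0 // => i _.
  by rewrite monalgU0 mul0rz.
case: s => [|g s]; first by rewrite /= subrr.
rewrite delta_vertices mul1g -/(vertices _ _).
under [in RHS]eq_bigr => i _ do rewrite hom_chain_vertices.
by rewrite [hom_chain a (vertices g s)]/= edgesK hom_chain_vertices.
Qed.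

Lemma hom_cochain_d u l : hom_cochain (cochain_d u) l = delta (hom_cochain u) l.
Proof.
case: l => // x t; rewrite [LHS]/hom_cochain cochain_dE -map_mulV_cons.
rewrite delta_map -[RHS](gactVK x); congr (gact x _); rewrite (delta_morph _ _ (gactB _)).
by apply: eq_delta => w; exact: hom_cochain_mul.
Qed.

Lemma chain_d_hom a l : chain_d (hom_chain a l) = delta (hom_chain a) l.
Proof.
case: l => [|x t]; first exact: zmorph0 (@chain_d_is_zmod_morphism _ A).
rewrite [hom_chain a _]/hom_chain chain_dE -map_mulV_cons delta_map.
by apply: eq_delta => w; rewrite hom_chain_mul.
Qed.

Lemma hom_cochain_deg u p l : u \in cochain_deg p -> (size l)%:Z != p + 1 ->
  hom_cochain u l = 0.
Proof.
case: l => // x t /asboolP uP /= sz; rewrite uP ?(zmorph0 (gactB _)) //.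
by rewrite size_edges; apply: contra sz => /eqP <-; rewrite -PoszD addn1.
Qed.

End Dehomogenize.

Lemma sum_splits (G : groupType) (A X : zmodType) (theta : A -> seq G -> X) u x s :
  pair_split theta u (vertices x s)
  = \sum_(i < (size s).+1) theta (u (vertices x (take i s)))
      (vertices (x * \prod_(g <- take i s) g)%g (drop i s)).
Proof.
elim: s x u => [|g s IH] x u.
  by rewrite big_ord_recl big_ord0 /= big_nil mulg1.
rewrite big_ord_recl /= big_nil mulg1; congr (_ + _).
have := IH (x * g)%g (fun t => u (x :: t)); rewrite /= => ->.
by apply: eq_bigr => i _; rewrite /= big_cons mulgA.
Qed.

(** * Homology classes and the maps induced by chain maps *)

Section HomologyClasses.
Context {C : gcomplex} {k : int}.
Implicit Types (c : C) (x : homology C k).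

Lemma hrep_cycle x : hrep x \in Defs.cycle (C := C) k.
Proof. exact: valP. Qed.

Lemma hclassK x : hclass k (hrep x) = x.
Proof. by rewrite /hclass valKd; exact: reprK. Qed.

Lemma val_insubd_cycles c : c \in Defs.cycle (C := C) k ->
  val (insubd (0 : cycles C k) c) = c.
Proof. exact: insubdK. Qed.

Lemma hclassB c c' : c \in Defs.cycle (C := C) k -> c' \in Defs.cycle (C := C) k ->
  hclass k (c - c') = hclass k c - hclass k c'.
Proof.
move=> cC c'C; rewrite /hclass -raddfB; congr (\pi_(homology C k) _)%qT.
apply: val_inj; rewrite [LHS]val_insubd_cycles ?rpredB //.
rewrite [RHS]raddfB; congr (_ - _); apply: esym; exact: val_insubd_cycles.
Qed.

Lemma hclass0 : hclass k (0 : C) = 0.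
Proof. by rewrite -(subrr 0) hclassB ?rpred0 ?subrr. Qed.

Lemma hclassN c : c \in Defs.cycle (C := C) k -> hclass k (- c) = - hclass k c.
Proof. by move=> cC; rewrite -sub0r hclassB ?rpred0 // hclass0 sub0r. Qed.

Lemma hclassD c c' : c \in Defs.cycle (C := C) k -> c' \in Defs.cycle (C := C) k ->
  hclass k (c + c') = hclass k c + hclass k c'.
Proof.
by move=> cC c'C; rewrite -[c']opprK hclassB ?rpredN // (hclassN (c := - c')) ?rpredN // !opprK.
Qed.

Lemma hclassMz c m : c \in Defs.cycle (C := C) k -> hclass k (c *~ m) = hclass k c *~ m.
Proof.
move=> cC; have hMn j : hclass k (c *+ j) = hclass k c *+ j.
  elim: j => [|j IH]; first by rewrite !mulr0n hclass0.
  by rewrite !mulrS hclassD ?rpredMn // IH.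
case: m => j; first by rewrite -!pmulrn hMn.
by rewrite NegzE !mulrNz hclassN ?rpredMz // -!pmulrn hMn.
Qed.

Lemma hclass_sum (I : Type) (r : seq I) (F : I -> C) :
  (forall i, F i \in Defs.cycle (C := C) k) ->
  hclass k (\sum_(i <- r) F i) = \sum_(i <- r) hclass k (F i).
Proof.
move=> FC; elim: r => [|i r IH]; first by rewrite !big_nil hclass0.
by rewrite !big_cons -IH hclassD ?rpred_sum.
Qed.

Lemma hclass_eqP c c' : c \in Defs.cycle (C := C) k -> c' \in Defs.cycle (C := C) k ->
  (hclass k c = hclass k c' <->
   exists2 b, b \in gc_deg C (k - gc_step C) & gc_d C b = c - c').
Proof.
move=> cC c'C; rewrite /hclass.
have -> : (exists2 b, b \in gc_deg C (k - gc_step C) & gc_d C b = c - c') <->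
   insubd (0 : cycles C k) c - insubd 0 c' \in boundary (C := C) (k := k).
  have e : val (insubd (0 : cycles C k) c - insubd 0 c') = c - c'.
    by rewrite [LHS]raddfB; congr (_ - _); exact: val_insubd_cycles.
  split=> [[b bd db]|/asboolP[b bd db]]; last by exists b; rewrite // db.
  by apply/asboolP; exists b; rewrite // db.
rewrite Quotient.idealrBE; split=> [->|/eqP//]; exact: eqxx.
Qed.

Lemma hclass_eq c c' b : c \in Defs.cycle (C := C) k -> c' \in Defs.cycle (C := C) k ->
  b \in gc_deg C (k - gc_step C) -> gc_d C b = c - c' -> hclass k c = hclass k c'.
Proof. by move=> cC c'C bd db; apply/(hclass_eqP cC c'C); exists b. Qed.

End HomologyClasses.

Definition chain_map (C C' : gcomplex) (phi : C -> C') : Prop :=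
  [/\ zmod_morphism phi, gc_step C = gc_step C',
      forall k c, c \in gc_deg C k -> phi c \in gc_deg C' k
    & forall c, gc_d C' (phi c) = phi (gc_d C c)].

Section InducedMaps.
Context {C C' : gcomplex} {phi : C -> C'} (phiP : chain_map phi).

Lemma chain_map_cycle k c : c \in Defs.cycle (C := C) k -> phi c \in Defs.cycle (C := C') k.
Proof.
have [phiB _ phi_deg phi_d] := phiP; case/andP=> cd /eqP dc.
by apply/andP; rewrite phi_deg // phi_d dc (zmorph0 phiB).
Qed.

(** Two representatives of a class differ by a boundary, and phi carries boundaries to boundaries;
    so the representative picked by [hrep] can be replaced with any cycle at hand. *)
Lemma hmapE k l c : k = l -> c \in Defs.cycle (C := C) k ->
  hmap l phi (hclass k c) = hclass l (phi c).
Proof.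
have [phiB step phi_deg phi_d] := phiP; move=> <- cC.
have /(hclass_eqP (hrep_cycle _) cC)[b bd db] := hclassK (hclass k c).
apply: (@hclass_eq _ _ _ _ (phi b)); rewrite ?chain_map_cycle ?hrep_cycle //.
  by rewrite -step phi_deg.
by rewrite phi_d db phiB.
Qed.

Lemma hmapB k l : k = l -> zmod_morphism (@hmap C C' k l phi).
Proof.
have [phiB step phi_deg phi_d] := phiP; move=> kl x y.
rewrite -(hclassK x) -(hclassK y) -hclassB ?hrep_cycle //.
rewrite !hmapE ?rpredB ?hrep_cycle // phiB hclassB // -kl chain_map_cycle //;
exact: hrep_cycle.
Qed.

End InducedMaps.

Lemma hmap_comp (C C' C'' : gcomplex) (phi : C -> C') (psi : C' -> C'') k l m
    (x : homology C k) : k = l -> l = m -> chain_map phi -> chain_map psi ->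
  hmap m psi (hmap l phi x) = hmap m (psi \o phi) x.
Proof.
move=> kl lm phiP psiP; subst l m; rewrite -(hclassK x).
have compP : chain_map (psi \o phi).
  have [phiB step phi_deg phi_d] := phiP; have [psiB step' psi_deg psi_d] := psiP.
  split; [exact: zmorph_comp | by rewrite step | | by move=> c; rewrite /= psi_d phi_d].
  by move=> k' c /phi_deg/psi_deg.
have xP := hrep_cycle x.
by rewrite (hmapE phiP) // (hmapE psiP) ?(hmapE compP) // (chain_map_cycle phiP xP).
Qed.

Lemma eq_hmap (C C' : gcomplex) (phi psi : C -> C') k l :
  phi =1 psi -> @hmap C C' k l phi =1 hmap l psi.
Proof. by move=> e x; rewrite /hmap e. Qed.

Lemma hmap_id (C : gcomplex) k (phi : C -> C) (x : homology C k) :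
  phi =1 id -> hmap k phi x = x.
Proof. by move=> e; rewrite /hmap e hclassK. Qed.

Lemma chain_dB (G : groupType) (A : gmodule G) : zmod_morphism (@chain_d G A).
Proof. exact: chain_d_is_zmod_morphism. Qed.

Section BarMap.
Context {G G' : groupType} {A : gmodule G} {B : gmodule G'} {f : G -> G'} {phi : A -> B}.
Hypothesis phiB : zmod_morphism phi.

Lemma bar_mapB : zmod_morphism (bar_map f phi).
Proof.
by apply: malg_lift_is_zmod_morphism => s a b; rewrite phiB monalgUB.
Qed.

Lemma bar_mapU a s : bar_map f phi << a *g s >> = << phi a *g map f s >>.
Proof. by rewrite /bar_map malg_liftU ?(zmorph0 phiB) ?monalgU0. Qed.

Lemma bar_map_deg k c : c \in chain_deg (A := A) k -> bar_map f phi c \in chain_deg (A := B) k.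
Proof.
move=> ck; apply: chain_deg_ind ck _ => [|a s <-]; first exact: bar_mapB.
by rewrite bar_mapU chain_degU ?size_map.
Qed.

Hypothesis fM : forall x y, f (x * y)%g = (f x * f y)%g.
Hypothesis phi_act : forall g a, phi (gact g a) = gact (f g) (phi a).

Lemma bar_map_hom a l : bar_map f phi (hom_chain a l) = hom_chain (phi a) (map f l).
Proof.
case: l => [|x t] /=; first exact: zmorph0 bar_mapB.
have f1 : f 1%g = 1%g by apply: (mulgI (f 1%g)); rewrite -fM !mulg1.
have fV : f x^-1%g = (f x)^-1%g by apply: (mulgI (f x)); rewrite -fM !mulgV.
by rewrite bar_mapU phi_act map_edges // fV.
Qed.

Lemma bar_map_d c : chain_d (bar_map f phi c) = bar_map f phi (chain_d c).
Proof.
move: c; apply: malg_ext => [||a s].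
- exact: zmorph_comp (@chain_dB _ _) bar_mapB.
- exact: zmorph_comp bar_mapB (@chain_dB _ _).
rewrite -hom_chain_vertices bar_map_hom !chain_d_hom delta_map.
by rewrite (delta_morph _ _ bar_mapB); apply: eq_delta => t; rewrite bar_map_hom.
Qed.

Lemma bar_map_chain_map : chain_map (C := bar_chains A) (C' := bar_chains B) (bar_map f phi).
Proof. split; [exact: bar_mapB | by [] | exact: bar_map_deg | exact: bar_map_d]. Qed.

End BarMap.

Lemma bar_map_comp (G G' G'' : groupType) (A : gmodule G) (B : gmodule G')
    (D : gmodule G'') (f : G -> G') (f' : G' -> G'') (phi : A -> B) (phi' : B -> D) c :
  zmod_morphism phi -> zmod_morphism phi' ->
  bar_map f' phi' (bar_map f phi c) = bar_map (f' \o f) (phi' \o phi) c.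
Proof.
move=> phiB phi'B; have phi2B := zmorph_comp phi'B phiB.
move: c; apply: malg_ext => [||a s]; first exact: zmorph_comp (bar_mapB _) (bar_mapB _).
  exact: bar_mapB.
by rewrite !bar_mapU // -map_comp.
Qed.

Lemma eq_bar_map (G G' : groupType) (A : gmodule G) (B : gmodule G') (f f' : G -> G')
  (phi phi' : A -> B) : f =1 f' -> phi =1 phi' -> bar_map f phi =1 bar_map f' phi'.
Proof.
move=> ff pp c; apply: eq_bigr => s _; rewrite pp.
by congr (<< _ *g _ >>); apply: eq_map.
Qed.

(** * Cap and cup products *)

Lemma pair_split_map (S T : Type) (A X : zmodType) (f : S -> T)
    (theta : A -> seq T -> X) u l :
  pair_split theta u (map f l)
  = pair_split (fun a t => theta a (map f t)) (fun t => u (map f t)) l.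
Proof. by elim: l u => //= x l IH u; rewrite IH. Qed.

Lemma pair_split_comp (T : Type) (A B X : zmodType) (h : A -> B)
    (theta : B -> seq T -> X) u l :
  pair_split theta (fun t => h (u t)) l = pair_split (fun a => theta (h a)) u l.
Proof. by elim: l u => //= x l IH u; rewrite IH. Qed.

Lemma pair_split_mul (G : groupType) (A X : zmodType) (h : A -> A) (k : X -> X)
    (theta : A -> seq G -> X) u (g : G) l :
  zmod_morphism k -> (forall t, u (map ( *%g g) t) = h (u t)) ->
  (forall a t, theta (h a) (map ( *%g g) t) = k (theta a t)) ->
  pair_split theta u (map ( *%g g) l) = k (pair_split theta u l).
Proof.
move=> kB uh thk; rewrite pair_split_map (eq_pair_splitr _ uh) pair_split_comp.
by rewrite (pair_split_morph _ _ _ kB); apply: eq_pair_splitl => a t.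
Qed.

Definition parity (p : int) : int := (-1) ^ p.

Lemma parityD p q : parity (p + q) = parity p * parity q.
Proof. by rewrite /parity exprzDr ?unitrN1. Qed.

Lemma parity_nat (n : nat) : parity n = (-1) ^+ n.
Proof. by []. Qed.

Lemma parity_sqr p : parity p * parity p = 1.
Proof. by rewrite -exprzMl ?unitrN1 // mulrNN mulr1 exp1rz. Qed.

Lemma parity_exp p (n : nat) : parity p ^+ n = parity (p * n).
Proof. by rewrite /parity -exprz_exp. Qed.

Section Cap.
Context {G : groupType} {A : gmodule G}.
Implicit Types (c : chain (trivZ G)) (u : cochain A).

Lemma sign_size_hom u p l : u \in cochain_deg p ->
  sign_size (hom_cochain u) l = hom_cochain u l *~ - parity p.
Proof.
move=> up; rewrite /sign_size; have [sz|sz] := eqVneq ((size l)%:Z) (p + 1).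
  by congr (_ *~ _); rewrite -parity_nat sz parityD /parity expr1z mulrN1.
by rewrite (hom_cochain_deg up sz) !mul0rz.
Qed.

Definition cap_hom u (l : seq G) : chain A := pair_split (@hom_chain G A) (hom_cochain u) l.

Lemma cap_hom_mul u g l : cap_hom u (map ( *%g g) l) = cap_hom u l.
Proof.
apply: (@pair_split_mul _ _ _ (gact g) id) => // [t|a t].
  exact: hom_cochain_mul.
exact: hom_chain_mul.
Qed.

Lemma cap_chainBl u : zmod_morphism (cap_chain^~ u).
Proof.
apply: malg_lift_is_zmod_morphism => s m m'; rewrite -sumrB.
by apply: eq_bigr => i _; rewrite mulrzBr monalgUB.
Qed.

Lemma cap_chainU m s u : cap_chain << m *g s >> u = cap_hom u (vertices 1%g s) *~ m.
Proof.
rewrite /cap_chain malg_liftU; last by rewrite big1 // => i _; rewrite mulr0z monalgU0.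
rewrite /cap_hom sum_splits mulrz_suml; apply: eq_bigr => i _.
rewrite hom_cochain_vertices gact1 mul1g /= edgesK.
by rewrite (zmorphMz (@zmorph_malgU _ _ _)).
Qed.

Lemma cap_chain_hom m l u : cap_chain (hom_chain (m : trivZ G) l) u = cap_hom u l *~ m.
Proof.
case: l => [|x t]; first by rewrite (zmorph0 (cap_chainBl u)) mul0rz.
by rewrite [hom_chain m _]/hom_chain cap_chainU -map_mulV_cons cap_hom_mul.
Qed.

(** The Leibniz rule for [hom_chain] expresses (dc) cap u through d (c cap u) and c cap du. It is
    solved here for d (c cap u), which puts the sign (-1)^p on both terms; the corrections vanish
    because chains and cochains are zero on the empty list. *)
Lemma chain_d_cap u p c : u \in cochain_deg p ->
  chain_d (cap_chain c u)
  = (cap_chain (chain_d c) u - cap_chain c (cochain_d u)) *~ parity p.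
Proof.
move=> up; move: c; apply: malg_ext => [||m s].
- exact: zmorph_comp (@chain_dB _ _) (cap_chainBl u).
- apply: zmorph_comp (@zmorph_mulz _ _) _; apply: zmorph_sub (cap_chainBl _).
  exact: zmorph_comp (cap_chainBl u) (@chain_dB _ _).
rewrite chain_dE (delta_morph _ _ (cap_chainBl u)) !cap_chainU.
rewrite (eq_delta (H := fun l => cap_hom u l *~ m)); last by move=> t; exact: cap_chain_hom.
rewrite -(delta_morph _ _ (@zmorph_mulz _ m)) (zmorphMz (@chain_dB _ _)).
rewrite -mulrzBl -mulrzA mulrC mulrzA; congr (_ *~ _).
rewrite delta_pair_split; last exact: hom_chainB.
rewrite (eq_pair_splitr _ (fun l => sign_size_hom l up)).
rewrite pair_splitMz; last exact/delta_zmorph/hom_chainB.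
rewrite (zmorph0 (hom_chainB _)) subr0 addr0 mulrNz opprK.
have <- : chain_d (cap_hom u (vertices 1%g s))
    = pair_split (fun a => delta (hom_chain a)) (hom_cochain u) (vertices 1%g s).
  rewrite (pair_split_morph _ _ _ (@chain_dB _ _)).
  by apply: eq_pair_splitl => a t; rewrite chain_d_hom.
have -> : cap_hom (cochain_d u) (vertices 1%g s)
    = pair_split (@hom_chain G A) (delta (hom_cochain u)) (vertices 1%g s).
  exact: eq_pair_splitr (hom_cochain_d u) _.
by rewrite addrAC subrr add0r -mulrzA parity_sqr mulr1z.
Qed.

Lemma cap_chain_deg u p k c : u \in cochain_deg p -> c \in chain_deg (A := trivZ G) k ->
  cap_chain c u \in chain_deg (A := A) (k - p).
Proof.
move=> /asboolP up ck; apply: chain_deg_ind ck _ => [|m s sk]; first exact: cap_chainBl.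
rewrite /cap_chain malg_liftU; last by rewrite big1 // => i _; rewrite mulr0z monalgU0.
apply: rpred_sum => i _; have si : (size (take i s))%:Z = i.
  by rewrite size_takel // -ltnS.
have [ip|ip] := eqVneq (i : int) p; last first.
  by rewrite up ?si // (zmorph0 (gactB _)) mul0rz monalgU0 rpred0.
by apply: chain_degU; rewrite size_drop -ip -sk subzn // -ltnS.
Qed.

Lemma cap_chainBr c : zmod_morphism (cap_chain c : cochain A -> chain A).
Proof.
move=> u u'; rewrite -[RHS]/((fun c => cap_chain c u - cap_chain c u') c).
move: c; apply: malg_ext => [||m s].
- exact: cap_chainBl.
- exact: zmorph_sub (cap_chainBl _) (cap_chainBl _).
rewrite !cap_chainU -mulrzBl; congr (_ *~ _).
rewrite -pair_splitBr; last exact: hom_chainB.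
apply: eq_pair_splitr => -[|x t] /=; first by rewrite subrr.
exact: gactB.
Qed.

End Cap.

Lemma bar_map_cap (G : groupType) (A B : gmodule G) (f : A -> B) c (u : cochain A) :
  zmod_morphism f -> (forall g a, f (gact g a) = gact g (f a)) ->
  bar_map (fun g => g) f (cap_chain c u) = cap_chain c (fun s => f (u s)).
Proof.
move=> fB f_act; move: c; apply: malg_ext => [||m s].
- exact: zmorph_comp (bar_mapB fB) (cap_chainBl u).
- exact: cap_chainBl.
rewrite !cap_chainU (zmorphMz (bar_mapB fB)); congr (_ *~ _).
rewrite /cap_hom (pair_split_morph _ _ _ (bar_mapB fB)).
have fu t : hom_cochain (fun s => f (u s)) t = f (hom_cochain u t).
  by case: t => [|x t] /=; rewrite ?(zmorph0 fB) ?f_act.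
rewrite [RHS](eq_pair_splitr _ fu).
rewrite pair_split_comp; apply: eq_pair_splitl => a t.
by rewrite bar_map_hom // map_id.
Qed.

Section Cup.
Context {G : groupType} {A B D : gmodule G} {beta : A -> B -> D}.

(** One construction for three coefficient pairings: the tensor product ([cup_cochain] is the case
    of [tens]), the multiplication of Ad, and the pairing of Ad with itself into Z[G x G]. *)
Definition cup_with (b : A -> B -> D) (u : cochain A) (v : cochain B) : cochain D :=
  fun s => \sum_(i < (size s).+1)
    b (u (take i s)) (gact (\prod_(g <- take i s) g)%g (v (drop i s))).

Hypotheses (betaBl : forall b, zmod_morphism (beta^~ b))
  (betaBr : forall a, zmod_morphism (beta a))
  (beta_act : forall g a b, beta (gact g a) (gact g b) = gact g (beta a b)).

Lemma hom_cup u v l :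
  hom_cochain (cup_with beta u v) l
  = pair_split (fun a t => beta a (hom_cochain v t)) (hom_cochain u) l.
Proof.
case: l => // x t; have -> : x :: t = map ( *%g x) (vertices 1%g (edges x t)).
  by rewrite map_mul_vertices mulg1 verticesK.
rewrite hom_cochain_mul hom_cochain_vertices gact1.
rewrite (@pair_split_mul _ _ _ (gact x) (gact x)); last 3 first.
- exact: gactB.
- exact: hom_cochain_mul.
- by move=> a w; rewrite hom_cochain_mul beta_act.
rewrite sum_splits /cup_with; congr (gact x _); apply: eq_bigr => i _.
by rewrite !hom_cochain_vertices gact1 mul1g.
Qed.

Lemma cupE u v s : cup_with beta u v s
  = pair_split (fun a t => beta a (hom_cochain v t)) (hom_cochain u) (vertices 1%g s).
Proof. by rewrite -hom_cup hom_cochain_vertices gact1. Qed.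

Lemma cochain_d_cup u v p s : u \in cochain_deg p ->
  cochain_d (cup_with beta u v) s
  = cup_with beta (cochain_d u) v s + cup_with beta u (cochain_d v) s *~ parity p.
Proof.
move=> up; rewrite cochain_dE (eq_delta (hom_cup u v)) !cupE.
rewrite delta_pair_split; last by move=> t; exact: betaBl.
rewrite (eq_pair_splitr _ (fun l => sign_size_hom l up)).
rewrite pair_splitMz; last by apply: delta_zmorph => t; exact: betaBl.
rewrite (zmorph0 (betaBl _)) subr0 (zmorph0 (betaBr _)) addr0 mulrNz opprK.
rewrite [in RHS](eq_pair_splitr _ (hom_cochain_d u)); congr (_ + _ *~ _).
by apply: eq_pair_splitl => a t; rewrite hom_cochain_d (delta_morph _ _ (betaBr a)).
Qed.

Lemma cup_deg u v p q : u \in cochain_deg p -> v \in cochain_deg q ->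
  cup_with beta u v \in cochain_deg (p + q).
Proof.
move=> /asboolP up /asboolP vq; apply/asboolP => s spq.
rewrite /cup_with big1 // => i _; have ile : (i <= size s)%N by rewrite -ltnS.
have [ip|ip] := eqVneq (i : int) p; last first.
  by rewrite up ?(zmorph0 (betaBl _)) // size_takel.
rewrite vq ?(zmorph0 (gactB _)) ?(zmorph0 (betaBr _)) // size_drop.
apply: contra spq => /eqP <-; rewrite -ip -PoszD subnKC //.
Qed.

End Cup.

(** * Homotopies on permutation modules *)

Record gset (G : groupType) := GSet {
  gset_sort :> choiceType;
  gset_act : G -> gset_sort -> gset_sort;
  gset_act1 : forall s, gset_act 1%g s = s;
  gset_actM : forall g h s, gset_act (g * h)%g s = gset_act g (gset_act h s)
}.

Section PermutationModule.
Context {G : groupType} (S : gset G).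

Definition perm_act (g : G) : {malg int[S]} -> {malg int[S]} :=
  malg_lift (fun s m => << m *g gset_act g s >>).

Lemma perm_actB g : zmod_morphism (perm_act g).
Proof. by apply: malg_lift_is_zmod_morphism => s m m'; rewrite monalgUB. Qed.

Lemma perm_actU g m s : perm_act g << m *g s >> = << m *g gset_act g s >>.
Proof. by rewrite /perm_act malg_liftU ?monalgU0. Qed.

Lemma perm_act1 x : perm_act 1%g x = x.
Proof.
move: x; apply: malg_ext => [||m s]; [exact: perm_actB | by move=> x y|].
by rewrite perm_actU gset_act1.
Qed.

Lemma perm_actM g h x : perm_act (g * h)%g x = perm_act g (perm_act h x).
Proof.
move: x; apply: malg_ext => [||m s]; first exact: perm_actB.
  exact: zmorph_comp (perm_actB g) (perm_actB h).
by rewrite !perm_actU gset_actM.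
Qed.

(* Z[S] *)
Definition perm_module : gmodule G := GModule perm_act1 perm_actM perm_actB.

(** Extends to chains a function of a homogeneous simplex with coefficient m s, evaluated on the
    representative with first vertex 1. Additivity in m makes the extension additive, and invariance
    under G makes it correct on every other representative. *)
Definition chain_lift {X : zmodType} (F : int -> S -> seq G -> X) :
    chain perm_module -> X :=
  malg_lift (fun s (x : {malg int[S]}) => malg_lift (fun b m => F m b (vertices 1%g s)) x).

Section ChainLift.
Context {X : zmodType} (F : int -> S -> seq G -> X).
Hypothesis F_B : forall b l, zmod_morphism (fun m => F m b l).

Lemma chain_liftB : zmod_morphism (chain_lift F).
Proof.
apply: malg_lift_is_zmod_morphism => s; apply: malg_lift_is_zmod_morphism => b.
exact: F_B.
Qed.

Lemma chain_liftU m b s :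
  chain_lift F << << m *g b >> *g s >> = F m b (vertices 1%g s).
Proof.
have F0 b' l : F 0 b' l = 0 by exact: zmorph0 (F_B b' l).
rewrite /chain_lift malg_liftU ?malg_liftU //.
by rewrite /malg_lift msupp0 big_seq_fset0.
Qed.

Hypothesis F0 : forall m b, F m b [::] = 0.
Hypothesis F_act : forall m b g l, F m (gset_act g b) (map ( *%g g) l) = F m b l.

Lemma chain_lift_hom m b l :
  chain_lift F (hom_chain (<< m *g b >> : perm_module) l) = F m b l.
Proof.
case: l => [|x t]; first by rewrite F0; exact: zmorph0 chain_liftB.
rewrite /hom_chain [gact _ _]perm_actU chain_liftU -map_mulV_cons.
exact: F_act.
Qed.
End ChainLift.

Lemma perm_chain_ext (X : zmodType) (f h : chain perm_module -> X) :
  zmod_morphism f -> zmod_morphism h ->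
  (forall m b s, f (hom_chain (<< m *g b >> : perm_module) (vertices 1%g s))
               = h (hom_chain (<< m *g b >> : perm_module) (vertices 1%g s))) ->
  f =1 h.
Proof.
move=> fB hB fh; apply: malg_ext => // a s; move: a.
apply: malg_ext => [||m b].
- exact: zmorph_comp fB (@zmorph_malgU _ _ _).
- exact: zmorph_comp hB (@zmorph_malgU _ _ _).
by rewrite -(hom_chain_vertices (A := perm_module)).
Qed.

Lemma perm_chain_deg_ind (X : zmodType) (P : zmodClosed X) (f : chain perm_module -> X) k c :
  zmod_morphism f -> c \in chain_deg (A := perm_module) k ->
  (forall m b s, (size s)%:Z = k ->
     f (hom_chain (<< m *g b >> : perm_module) (vertices 1%g s)) \in P) -> f c \in P.
Proof.
move=> fB ck fP; apply: chain_deg_ind ck _ => // a s sk.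
rewrite (@zmorph_malgE _ _ _ (fun x : {malg int[S]} => f << (x : perm_module) *g s >>)).
  by apply: rpred_sum => b _; rewrite -(hom_chain_vertices (A := perm_module)) fP.
exact: zmorph_comp fB (@zmorph_malgU _ _ _).
Qed.

Section ChainLiftMap.
Context {G' : groupType} {B : gmodule G'} (F : int -> S -> seq G -> chain B).
Hypothesis F_B : forall b l, zmod_morphism (fun m => F m b l).
Hypothesis F0 : forall m b, F m b [::] = 0.
Hypothesis F_act : forall m b g l, F m (gset_act g b) (map ( *%g g) l) = F m b l.
Hypothesis F_deg : forall m b l k, (size l)%:Z = k + 1 -> F m b l \in chain_deg (A := B) k.
Hypothesis F_d : forall m b l, chain_d (F m b l) = delta (F m b) l.

Lemma chain_lift_map :
  chain_map (C := bar_chains perm_module) (C' := bar_chains B) (chain_lift F).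
Proof.
have liftB := chain_liftB F_B; split=> // [k c ck|].
  apply: perm_chain_deg_ind ck _ => // m b s sk.
  rewrite chain_lift_hom //; apply: F_deg; rewrite size_vertices -addn1 PoszD sk //.
apply: perm_chain_ext => [||m b s].
- exact: zmorph_comp (@chain_dB _ _) liftB.
- exact: zmorph_comp liftB (@chain_dB _ _).
rewrite chain_lift_hom // [gc_d _ _]F_d [gc_d _ _]chain_d_hom (delta_morph _ _ liftB).
by apply: eq_delta => l; rewrite chain_lift_hom.
Qed.
End ChainLiftMap.

Lemma prism_closed (T : Type) (X : zmodType) (P : zmodClosed X) f (F : seq T -> X) l :
  (forall t, size t = (size l).+1 -> F t \in P) -> prism f F l \in P.
Proof.
elim: l F => [|x l IH] F FP /=; first exact: rpred0.
by rewrite rpredB ?FP ?IH //= ?size_map // => t st; rewrite FP //= st.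
Qed.

Lemma hom_chain_deg (G' : groupType) (A : gmodule G') (a : A) l k :
  (size l)%:Z = k + 1 -> hom_chain a l \in chain_deg (A := A) k.
Proof.
case: l => [|x l] sk /=; first exact: rpred0.
by apply: chain_degU; apply: (addIr 1); rewrite size_edges -sk -PoszD addn1.
Qed.

Section Homotopy.
Variable F : S -> G -> G.
Hypothesis F_act : forall g s x, F (gset_act g s) (g * x)%g = (g * F s x)%g.

(* On a simplex with coefficient s, replaces each vertex x with F s x. *)
Definition move_vertices : chain perm_module -> chain perm_module :=
  chain_lift (fun m s l => hom_chain (<< m *g s >> : perm_module) (map (F s) l)).

Let perm_hom m s l := hom_chain (<< m *g s >> : perm_module) l.

Lemma perm_homB s l : zmod_morphism (fun m => perm_hom m s l).
Proof.
move=> m m'; rewrite /perm_hom monalgUB; exact: (hom_chainB l).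
Qed.

Lemma perm_hom_act m s g l : perm_hom m (gset_act g s) (map ( *%g g) l) = perm_hom m s l.
Proof.
by rewrite /perm_hom -perm_actU; exact: (hom_chain_mul (A := perm_module)).
Qed.

Lemma move_vertices_act m s g l :
  perm_hom m (gset_act g s) (map (F (gset_act g s)) (map ( *%g g) l))
  = perm_hom m s (map (F s) l).
Proof.
rewrite -map_comp -(perm_hom_act m s g) -map_comp; congr (perm_hom _ _ _).
by apply: eq_map => x /=; rewrite F_act.
Qed.

Lemma move_vertices_hom m s l : move_vertices (perm_hom m s l) = perm_hom m s (map (F s) l).
Proof.
apply: chain_lift_hom => // [b t|m' b g t]; first exact: perm_homB.
exact: move_vertices_act.
Qed.

Lemma move_vertices_map : chain_map (C := bar_chains perm_module) (C' := bar_chains perm_module)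
  move_vertices.
Proof.
apply: chain_lift_map => // [b l|m b g l|m b l k lk|m b l].
- exact: perm_homB.
- exact: move_vertices_act.
- by apply: hom_chain_deg; rewrite size_map.
- by rewrite chain_d_hom delta_map.
Qed.

Definition prism_chain : chain perm_module -> chain perm_module :=
  chain_lift (fun m s => prism (F s) (perm_hom m s)).

Lemma prism_chain_lin s l : zmod_morphism (fun m => prism (F s) (perm_hom m s) l).
Proof.
by move=> m m'; rewrite -prismB; apply: eq_prism => t; exact: perm_homB.
Qed.

Lemma prism_chain_hom m s l : prism_chain (perm_hom m s l) = prism (F s) (perm_hom m s) l.
Proof.
apply: (chain_lift_hom (F := fun m s => prism (F s) (perm_hom m s))) => //.
  exact: prism_chain_lin.
move=> m' b g t; rewrite (prism_map (f := F b)) => [|x]; last by rewrite F_act.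
by apply: eq_prism => w; exact: perm_hom_act.
Qed.

(** The prism between a simplex and its displaced copy is taken with the vertex map of its
    coefficient. Equivariance of F lets this homotopy descend to coinvariants, although the
    displacement varies with the coefficient. *)
Lemma move_vertices_homologous k c : c \in Defs.cycle (C := bar_chains perm_module) k ->
  hclass (C := bar_chains perm_module) k (move_vertices c) = hclass k c.
Proof.
move=> cC; have PB : zmod_morphism prism_chain by apply: chain_liftB; exact: prism_chain_lin.
have [MB _ _ _] := move_vertices_map.
have P c' : chain_d (prism_chain c') = (move_vertices c' - c') - prism_chain (chain_d c').
  move: c'; apply: perm_chain_ext => [||m s l].
  - exact: zmorph_comp (@chain_dB _ _) PB.
  - apply: zmorph_sub (zmorph_sub MB _) _; first by move=> x y.
    exact: zmorph_comp PB (@chain_dB _ _).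
  rewrite -/(perm_hom _ _ _) prism_chain_hom move_vertices_hom chain_d_hom.
  rewrite (delta_morph _ _ PB) (eq_delta (prism_chain_hom m s)) -(prism_delta (F s)).
  rewrite addrK (prism_morph _ _ _ (@chain_dB _ _)).
  by apply: eq_prism => t; rewrite chain_d_hom.
apply: (@hclass_eq (bar_chains perm_module) k _ _ (prism_chain c) _ cC).
- exact: chain_map_cycle move_vertices_map _ _ cC.
- case/andP: cC => ck _; apply: (perm_chain_deg_ind PB ck) => m s l lk.
  rewrite -/(perm_hom _ _ _) prism_chain_hom; apply: prism_closed => t tl.
  by apply: hom_chain_deg; rewrite tl size_vertices -lk opprK -!PoszD !addn1.
- case/andP: cC => _ /eqP dc; apply: etrans (P c) _.
  by rewrite [chain_d c](dc : chain_d c = 0) (zmorph0 PB) subr0.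
Qed.
End Homotopy.
End PermutationModule.

(** * Bilinear extension, associativity and graded commutativity of cup products *)

Section BilinearExtension.
Context {S T : choiceType} {X : zmodType}.
Implicit Types (f : S -> T -> X).

(** Written exactly as the function inside [psi], so that [psi] on pure tensors is an instance of it
    by conversion. *)
Definition bilift f (x : {malg int[S]}) (y : {malg int[T]}) : X :=
  \sum_(s <- msupp x) \sum_(t <- msupp y) f s t *~ (x@_s * y@_t).

Lemma biliftE f x y :
  bilift f x y = malg_lift (fun s m => malg_lift (fun t m' => f s t *~ (m * m')) y) x.
Proof. by []. Qed.

Lemma biliftBl f y : zmod_morphism (bilift f ^~ y).
Proof.
move=> x x'; rewrite !biliftE; move: x x'; apply: malg_lift_is_zmod_morphism => s m m'.
by rewrite -sumrB; apply: eq_bigr => t _; rewrite mulrBl mulrzBr.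
Qed.

Lemma biliftBr f x : zmod_morphism (bilift f x).
Proof.
move=> y y'; rewrite -sumrB; apply: eq_bigr => s _.
apply: (malg_lift_is_zmod_morphism (F := fun t m' => f s t *~ (x@_s * m'))) => t m m'.
by rewrite mulrBr mulrzBr.
Qed.

Lemma biliftU f m s m' t : bilift f << m *g s >> << m' *g t >> = f s t *~ (m * m').
Proof.
rewrite biliftE malg_liftU; last by apply: big1 => t' _; rewrite mul0r mulr0z.
by rewrite malg_liftU // mulr0 mulr0z.
Qed.

End BilinearExtension.

Lemma bilift_ext (S T : choiceType) (X : zmodType)
    (F H : {malg int[S]} -> {malg int[T]} -> X) :
  (forall y, zmod_morphism (F^~ y)) -> (forall x, zmod_morphism (F x)) ->
  (forall y, zmod_morphism (H^~ y)) -> (forall x, zmod_morphism (H x)) ->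
  (forall s t, F << s >> << t >> = H << s >> << t >>) -> F =2 H.
Proof.
move=> FBl FBr HBl HBr FH x y; move: x.
have UE (K : choiceType) m (k : K) : << m *g k >> = << k >> *~ m :> {malg int[K]}.
  by rewrite -(zmorphMz (@zmorph_malgU _ _ _)) intz.
apply: malg_ext => // m s; move: y; apply: malg_ext => // m' t.
rewrite (UE _ m s) (UE _ m' t) (zmorphMz (FBl _)) (zmorphMz (FBr _)) FH.
by rewrite (zmorphMz (HBl _)) (zmorphMz (HBr _)).
Qed.

(** Both sides sum over two cuts i <= j, with u, v and w on the front, middle and back faces. The
    induction separates the terms whose first cut is at the first vertex. *)
Lemma pair_split_assoc (T : Type) (A B D X Y Z : zmodType)
    (beta : A -> B -> X) (beta' : X -> D -> Z) (gamma : B -> D -> Y) (gamma' : A -> Y -> Z)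
    (u : seq T -> A) (v : seq T -> B) (w : seq T -> D) l :
  (forall d, zmod_morphism (beta'^~ d)) -> (forall a, zmod_morphism (gamma' a)) ->
  (forall a b d, beta' (beta a b) d = gamma' a (gamma b d)) ->
  pair_split (fun x t => beta' x (w t)) (pair_split (fun a t => beta a (v t)) u) l
  = pair_split (fun a t => gamma' a (pair_split (fun b t => gamma b (w t)) v t)) u l.
Proof.
move=> bB gB e; elim: l u => //= x l IH u; rewrite addr0 e (zmorphD (gB _)) -addrA.
congr (_ + _); rewrite -IH.
have thB t : zmod_morphism (fun x => beta' x (w t)) by exact: bB.
have -> : gamma' (u [:: x]) (pair_split (fun b t => gamma b (w t)) (fun t => v (x :: t)) l)
  = pair_split (fun x t => beta' x (w t)) (fun t => beta (u [:: x]) (v (x :: t))) l.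
  rewrite (pair_split_morph _ _ _ (gB _)).
  rewrite (@pair_split_comp _ _ _ _ (beta (u [:: x])) _ (fun t => v (x :: t))).
  by apply: eq_pair_splitl => b t; rewrite e.
rewrite -[X in _ + X]opprK -pair_splitN // -pair_splitBr //.
by apply: eq_pair_splitr => t; rewrite opprK.
Qed.

Lemma cupA (G : groupType) (A B D X Y Z : gmodule G)
    (beta : A -> B -> X) (beta' : X -> D -> Z) (gamma : B -> D -> Y) (gamma' : A -> Y -> Z)
    (u : cochain A) (v : cochain B) (w : cochain D) :
  (forall d, zmod_morphism (beta'^~ d)) -> (forall a, zmod_morphism (gamma' a)) ->
  (forall g a b, beta (gact g a) (gact g b) = gact g (beta a b)) ->
  (forall g a b, gamma (gact g a) (gact g b) = gact g (gamma a b)) ->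
  (forall g a b, beta' (gact g a) (gact g b) = gact g (beta' a b)) ->
  (forall g a b, gamma' (gact g a) (gact g b) = gact g (gamma' a b)) ->
  (forall a b d, beta' (beta a b) d = gamma' a (gamma b d)) ->
  cup_with beta' (cup_with beta u v) w =1 cup_with gamma' u (cup_with gamma v w).
Proof.
move=> bB gB b_act g_act b'_act g'_act e s; rewrite !cupE //.
rewrite (eq_pair_splitr _ (hom_cup b_act u v)).
rewrite (pair_split_assoc _ _ _ _ bB gB e).
by apply: eq_pair_splitl => a t; rewrite hom_cup.
Qed.

(** The front and back faces share the cut vertex, so their sizes add up to [size l + 1]. *)
Lemma pair_split_vanish (T : Type) (A X : zmodType) (theta : A -> seq T -> X)
    (u : seq T -> A) (a b : int) l :
  (forall t, zmod_morphism (theta^~ t)) ->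
  (forall t, (size t)%:Z != a -> u t = 0) ->
  (forall x t, (size t)%:Z != b -> theta x t = 0) ->
  (size l)%:Z + 1 != a + b -> pair_split theta u l = 0.
Proof.
move=> thB; elim: l a u => //= x l IH a u ua thb sz.
rewrite (IH (a - 1)) ?addr0 //.
- have [sa|/ua->] := eqVneq ((size [:: x])%:Z) a; last exact: zmorph0 (thB _).
  apply: thb; apply: contra sz => /eqP /= <-; rewrite -sa /= addrC eqxx //.
- by move=> t st; apply: ua => /=; rewrite -addn1 PoszD; apply: contra st => /eqP <-; rewrite addrK.
- by apply: contra sz => /eqP e; rewrite -addn1 PoszD e addrAC subrK.
Qed.

Section CupOneInvariance.
Context {A B X : zmodType} (beta : A -> B -> X) (sgn : int).

Lemma cup1_map (S T : Type) (f : S -> T) v u l :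
  cup1 beta sgn v u (map f l)
  = cup1 beta sgn (fun t => v (map f t)) (fun t => u (map f t)) l.
Proof.
elim: l u => //= x l IH u; rewrite IH; congr (_ + _ - _).
by rewrite pair_split_map.
Qed.

Lemma eq_cup1 (T : Type) (v v' : seq T -> B) (u u' : seq T -> A) : v =1 v' -> u =1 u' ->
  cup1 beta sgn v u =1 cup1 beta sgn v' u'.
Proof. by move=> /funext -> /funext ->. Qed.

Lemma cup1_morph (T : Type) (h : A -> A) (h' : B -> B) (k : X -> X)
    (v : seq T -> B) (u : seq T -> A) l :
  zmod_morphism k -> (forall a b, beta (h a) (h' b) = k (beta a b)) ->
  cup1 beta sgn (fun t => h' (v t)) (fun t => h (u t)) l = k (cup1 beta sgn v u l).
Proof.
move=> kB e; elim: l u => [|x l IH] u /=; first by rewrite (zmorph0 kB).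
rewrite IH kB (zmorphD kB) (zmorphMz kB) e; congr (_ + _ - _).
rewrite pair_split_comp (pair_split_morph _ _ _ kB).
by apply: eq_pair_splitl => b t; rewrite e.
Qed.

(** In a term of the cup-one product the arguments of u and v share two vertices, so their sizes add
    up to [size l + 2]; this is why the product has degree p + q - 1. *)
Lemma cup1_vanish (T : Type) (v : seq T -> B) (u : seq T -> A) (a b : int) l :
  (forall a, zmod_morphism (beta a)) -> (forall b, zmod_morphism (beta^~ b)) ->
  (forall t, (size t)%:Z != a -> u t = 0) -> (forall t, (size t)%:Z != b -> v t = 0) ->
  (size l)%:Z + 2 != a + b -> cup1 beta sgn v u l = 0.
Proof.
move=> betaBr betaBl; elim: l a u => //= x l IH a u ua vb sz.
have e1 (k : nat) : (k.+1)%:Z = k%:Z + 1 by rewrite -addn1 PoszD.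
have u1 t : (size t)%:Z != a - 1 -> u (x :: t) = 0.
  by move=> st; apply: ua; rewrite /= e1; apply: contra st => /eqP <-; rewrite addrK.
rewrite (IH (a - 1)) //; last first.
  by apply: contra sz; rewrite e1 => /eqP e; rewrite addrAC e addrAC subrK.
rewrite mul0rz subr0.
rewrite -[LHS]/(pair_split (fun b t => beta (u (x :: t)) b) v (x :: l)).
apply: (@pair_split_vanish _ _ _ _ _ b (a - 1)) => // [y t st|].
  by rewrite u1 // (zmorph0 (betaBl y)).
apply: contra sz; rewrite /= e1 => /eqP e.
by rewrite -[2]/(1 + 1 : int) addrA e addrA subrK addrC.
Qed.

End CupOneInvariance.

Section CupCommutativity.
Context {G : groupType} {A B D : gmodule G} {beta : A -> B -> D}.
Hypotheses (betaBl : forall b, zmod_morphism (beta^~ b))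
  (betaBr : forall a, zmod_morphism (beta a))
  (beta_act : forall g a b, beta (gact g a) (gact g b) = gact g (beta a b)).

(** Only the faces are exchanged: on the left v sits on the front face, but the values are still
    beta a b with a from u and b from v. Exchanging the coefficients is a separate matter, settled
    in homology. *)
Lemma cup_commutative (u : cochain A) (v : cochain B) p q :
  u \in Defs.cycle (C := bar_cochains A) p -> v \in Defs.cycle (C := bar_cochains B) q ->
  exists2 w : cochain D, w \in cochain_deg (p + q - 1) & forall s,
    cup_with (fun b a => beta a b) v u s
    = cup_with beta u v s *~ parity (p * q) + cochain_d w s.
Proof.
move=> /andP[up /eqP du] /andP[vq /eqP dv]; pose sgn := parity q.
pose hu := hom_cochain u; pose hv := hom_cochain v.
pose K := cup1 beta sgn hv hu.
(* In the coboundary of cup-one the product with v in front carries the sign (-1)^q; multiplying by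
   [sgn] removes it and leaves (-1)^(pq) on the other product. *)
pose w : cochain D := fun s => K (vertices 1%g s) *~ sgn.
have K_act g l : K (map ( *%g g) l) = gact g (K l).
  rewrite /K cup1_map -(@cup1_morph _ _ _ beta sgn _ (gact g) (gact g)) => [||a b]; last 2 first.
  - exact: gactB.
  - exact: beta_act.
  by apply: eq_cup1 => t; exact: hom_cochain_mul.
have homw l : hom_cochain w l = K l *~ sgn.
  case: l => [|x t]; first by rewrite mul0rz.
  rewrite -[x :: t]verticesK hom_cochain_vertices (zmorphMz (gactB _)) -K_act.
  by rewrite map_mul_vertices mulg1.
exists w.
  apply/asboolP => s sz; rewrite /w [K _](@cup1_vanish _ _ _ _ _ _ _ _ (p + 1) (q + 1)) ?mul0rz //.
  - by move=> t; exact: hom_cochain_deg.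
  - by move=> t; exact: hom_cochain_deg.
  rewrite size_vertices; apply: contra sz => /eqP e.
  apply/eqP; move: e; rewrite -addn1 PoszD; lia.
move=> s; rewrite cochain_dE (eq_delta homw) -(delta_morph _ _ (@zmorph_mulz _ sgn)).
have hv0 : hv [::] = 0 by [].
have dhv l : delta hv l = 0.
  by rewrite -hom_cochain_d [cochain_d v]dv; case: l => //= x t; rewrite (zmorph0 (gactB _)).
have dhu l : delta hu l = 0.
  by rewrite -hom_cochain_d [cochain_d u]du; case: l => //= x t; rewrite (zmorph0 (gactB _)).
have hv_deg l : sign_size hv l = - hv l *~ sgn.
  by rewrite (sign_size_hom _ vq) mulrNz mulNrz.
rewrite (delta_cup1 betaBl betaBr (parity_sqr q) hv0 dhv hv_deg).
have -> l : cup1 beta sgn hv (delta hu) l = 0.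
  rewrite (eq_cup1 _ _ (frefl _) dhu) -[RHS](subrr (cup1 beta sgn hv (fun=> 0) l)).
  rewrite -(cup1B betaBl); apply: eq_cup1 => // t.
  by rewrite subrr.
have -> : pair_split (fun a t => beta a (hv t)) (fun t => hu t *~ sgn ^+ size t) (vertices 1%g s)
   = cup_with beta u v s *~ (parity (p * q) * sgn).
  rewrite cupE // -pair_splitMz; last by move=> t; exact: betaBl.
  apply: eq_pair_splitr => t; have [st|st] := eqVneq ((size t)%:Z) (p + 1); last first.
    by rewrite /hu (hom_cochain_deg up st) !mul0rz.
  by rewrite /sgn parity_exp st mulrDr mulr1 parityD [q * p]mulrC.
by rewrite subr0 !mulrzBl -!mulrzA -mulrA parity_sqr mulr1 mulr1z addrC subrK cupE //.
Qed.

End CupCommutativity.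

(** * Poincare duality and the adjoint module *)

Section Duality.
Context {G : groupType} {n : nat} (z : group_homology (trivZ G) n%:Z).

Local Notation zeta := (hrep z).

Lemma zeta_deg : zeta \in chain_deg (A := trivZ G) n.
Proof. by have /andP[] := hrep_cycle z. Qed.

Lemma zeta_d : chain_d zeta = 0.
Proof. by have /andP[_ /eqP] := hrep_cycle z. Qed.

Section Coefficients.
Context {A : gmodule G}.
Implicit Types (u b : cochain A) (p m : int).

Definition cocycle (p : int) : {pred cochain A} := Defs.cycle (C := bar_cochains A) p.

Lemma cocycleP p u : u \in cocycle p -> u \in cochain_deg p /\ cochain_d u = 0.
Proof. by case/andP=> ? /eqP. Qed.

Lemma cocycleB p u u' : u \in cocycle p -> u' \in cocycle p -> u - u' \in cocycle p.
Proof. by rewrite /cocycle => uC u'C; apply: rpredB. Qed.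

Lemma cocycleMz p u m : u \in cocycle p -> u *~ m \in cocycle p.
Proof. by rewrite /cocycle => uC; apply: rpredMz. Qed.

Definition capz u : chain A := cap_chain zeta u.

Lemma capzB u u' : capz (u - u') = capz u - capz u'.
Proof. exact: cap_chainBr. Qed.

Lemma capzMz u m : capz (u *~ m) = capz u *~ m.
Proof. exact: zmorphMz (cap_chainBr _) _ _. Qed.

Lemma capz_deg p m u : n%:Z - p = m -> u \in cochain_deg p ->
  capz u \in chain_deg (A := A) m.
Proof. by move=> <- up; apply: cap_chain_deg up zeta_deg. Qed.

Lemma chain_d_capz p u : u \in cochain_deg p ->
  chain_d (capz u) = - capz (cochain_d u) *~ parity p.
Proof.
move=> up; rewrite /capz (chain_d_cap _ up) zeta_d (zmorph0 (cap_chainBl u)) sub0r.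
by rewrite mulNrz.
Qed.

Lemma capz_cycle p m u : n%:Z - p = m -> u \in cocycle p ->
  capz u \in Defs.cycle (C := bar_chains A) m.
Proof.
move=> npm /cocycleP[up du]; apply/andP; split; first exact: capz_deg npm up.
apply/eqP/(etrans (chain_d_capz up)).
by rewrite du [capz 0](zmorph0 (cap_chainBr zeta)) oppr0 mul0rz.
Qed.

Lemma hclass_capzB p m u u' : n%:Z - p = m -> u \in cocycle p -> u' \in cocycle p ->
  hclass (C := bar_chains A) m (capz (u - u'))
  = hclass (C := bar_chains A) m (capz u) - hclass (C := bar_chains A) m (capz u').
Proof.
move=> npm uC u'C; rewrite capzB.
exact: hclassB (capz_cycle npm uC) (capz_cycle npm u'C).
Qed.

Lemma capz_coboundary p m u u' b : n%:Z - p = m ->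
  u \in cocycle p -> u' \in cocycle p -> b \in cochain_deg (p - 1) ->
  cochain_d b = u - u' ->
  hclass (C := bar_chains A) m (capz u) = hclass (C := bar_chains A) m (capz u').
Proof.
move=> npm uC u'C bd db.
(* For b of degree p - 1 the boundary of z cap b is -(-1)^(p-1) times z cap db; the factor on
   [capz b] cancels this sign. *)
apply: (@hclass_eq (bar_chains A) m _ _ (capz b *~ - parity (p - 1))).
- exact: capz_cycle npm uC.
- exact: capz_cycle npm u'C.
- rewrite mulrNz rpredN; apply: rpredMz; apply: (capz_deg _ bd); rewrite /=; lia.
rewrite [LHS](zmorphMz (@chain_dB _ _)) (chain_d_capz bd) db capzB.
by rewrite mulrNz mulNrz mulNrz opprK -mulrzA parity_sqr mulr1z.
Qed.

Lemma cap_hclass p m u : n%:Z - p = m -> u \in cocycle p ->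
  cap m z (hclass (C := bar_cochains A) p u) = hclass (C := bar_chains A) m (capz u).
Proof.
move=> npm uC; have rC := hrep_cycle (hclass (C := bar_cochains A) p u).
have /(hclass_eqP rC uC)[b bd db] := hclassK (hclass (C := bar_cochains A) p u).
exact: (capz_coboundary npm rC uC bd db).
Qed.

Hypothesis z_fundamental : poincare_duality z.

Lemma cap_bij p m : n%:Z - p = m ->
  bijective (fun u : group_cohomology A p => cap m z u).
Proof. by move=> <-; exact: z_fundamental. Qed.

Lemma dual_cocycle p m (x : group_homology A m) : n%:Z - p = m ->
  exists2 u, u \in cocycle p & x = hclass (C := bar_chains A) m (capz u).
Proof.
move=> npm; have [D _ DK] := cap_bij npm.
by exists (hrep (D x)); [exact: hrep_cycle | rewrite -[LHS]DK].
Qed.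

(** Injectivity of duality in terms of cocycles; it is the reason why products do not depend on the
    dual cocycles chosen. *)
Lemma dual_cocycle_uniq p m u u' : n%:Z - p = m -> u \in cocycle p -> u' \in cocycle p ->
  hclass (C := bar_chains A) m (capz u) = hclass (C := bar_chains A) m (capz u') ->
  exists2 b, b \in cochain_deg (p - 1) & cochain_d b = u - u'.
Proof.
move=> npm uC u'C; rewrite -(cap_hclass npm uC) -(cap_hclass npm u'C).
move/(bij_inj (cap_bij npm))/(hclass_eqP uC u'C) => [b bd db].
by exists b.
Qed.

Lemma dual_invP i (x : group_homology A i) : cap i z (dual_inv z x) = x.
Proof.
rewrite /dual_inv; case: xgetP => [u -> //|none].
have ni : n%:Z - (n%:Z - i) = i by rewrite opprB addrC subrK.
have [D _ DK] := cap_bij ni; have := none (D x); rewrite /=.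
by rewrite DK.
Qed.

End Coefficients.
End Duality.

Section InnerAutomorphisms.
Context {G : groupType} (S : gset G).

Lemma edges_mulr (x b : G) l :
  edges (x * b^-1)%g (map (fun y => y * b^-1)%g l)
  = map (fun y => b * y * b^-1)%g (edges x l).
Proof. by elim: l x => //= y l IH x; rewrite IH invgM invgK !mulgA. Qed.

(** Right translation of the vertices by b^-1 commutes with the left action, so it is homotopic to
    the identity. It conjugates the edges by b, and normalizing the first vertex b^-1 back to 1 lets
    b act on the coefficient. *)
Lemma inner_homologous (b : G) k c : c \in Defs.cycle (C := bar_chains (perm_module S)) k ->
  hclass (C := bar_chains (perm_module S)) k
    (bar_map (fun x => b * x * b^-1)%g (gact b : perm_module S -> perm_module S) c)
  = hclass k c.
Proof.
move=> cC; pose F (s : S) x := (x * b^-1)%g.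
have F_act g s x : F (gset_act g s) (g * x)%g = (g * F s x)%g by rewrite /F mulgA.
rewrite -(move_vertices_homologous F_act cC); congr (hclass _ _).
have [MB _ _ _] := move_vertices_map F_act.
move: {cC} c; apply: perm_chain_ext => [||m s l].
- exact: bar_mapB (gactB _).
- exact: MB.
rewrite (move_vertices_hom F_act) hom_chain_vertices (bar_mapU (gactB _)).
by rewrite [RHS]/= edges_mulr edgesK /F mul1g invgK.
Qed.

End InnerAutomorphisms.

Lemma cup_cocycle (G : groupType) (A B D : gmodule G) (beta : A -> B -> D) u v p q :
  (forall b, zmod_morphism (beta^~ b)) -> (forall a, zmod_morphism (beta a)) ->
  (forall g a b, beta (gact g a) (gact g b) = gact g (beta a b)) ->
  u \in cocycle p -> v \in cocycle q -> cup_with beta u v \in cocycle (p + q).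
Proof.
move=> bBl bBr b_act /cocycleP[up du] /cocycleP[vq dv]; apply/andP; split.
  exact: cup_deg up vq.
apply/eqP/funext => s; apply: etrans (cochain_d_cup bBl bBr b_act _ _ up) _.
rewrite du dv.
have -> : cup_with beta 0 v s = 0.
  by apply: big1 => i _; exact: (zmorph0 (bBl (gact _ _))).
have -> : cup_with beta u 0 s = 0.
  by apply: big1 => i _; rewrite [gact _ _](zmorph0 (gactB _)) (zmorph0 (bBr _)).
by rewrite mul0rz addr0.
Qed.

Section AdjointModule.
Context {G : groupType}.

Lemma conj_act1 (x : G) : (1 * x * 1^-1)%g = x.
Proof. by rewrite mul1g invg1 mulg1. Qed.

Lemma conj_actM (g h x : G) : (g * h * x * (g * h)^-1)%g = (g * (h * x * h^-1) * g^-1)%g.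
Proof. by rewrite invgM !mulgA. Qed.

Definition conj_gset : gset G := @GSet G G (fun g x => g * x * g^-1)%g conj_act1 conj_actM.

Definition pair_act (g : G) (x : G * G) : G * G := ((g * x.1 * g^-1)%g, (g * x.2 * g^-1)%g).

Lemma pair_act1 x : pair_act 1%g x = x.
Proof. by case: x => x y; rewrite /pair_act !conj_act1. Qed.

Lemma pair_actM g h x : pair_act (g * h)%g x = pair_act g (pair_act h x).
Proof. by rewrite /pair_act /= !conj_actM. Qed.

Definition pair_gset : gset G := @GSet G (G * G)%type pair_act pair_act1 pair_actM.

Definition Ad : gmodule G := perm_module conj_gset.
(** Z[G x G] keeps the two factors of a product apart, so that the cup-one homotopy can be applied
    before the order of multiplication is decided. *)
Definition Ad2 : gmodule G := perm_module pair_gset.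

Definition ad_mul : Ad -> Ad -> Ad := bilift (fun x y : G => << (x * y)%g >>).
Definition ad_pair : Ad -> Ad -> Ad2 := bilift (fun x y : G => << (x, y) >>).
Definition ad_map (f : G * G -> G) : Ad2 -> Ad := malg_lift (fun s m => << m *g f s >>).

Lemma ad_mulBl y : zmod_morphism (ad_mul^~ y). Proof. exact: biliftBl. Qed.
Lemma ad_mulBr x : zmod_morphism (ad_mul x). Proof. exact: biliftBr. Qed.
Lemma ad_pairBl y : zmod_morphism (ad_pair^~ y). Proof. exact: biliftBl. Qed.
Lemma ad_pairBr x : zmod_morphism (ad_pair x). Proof. exact: biliftBr. Qed.

Lemma ad_mulU m x m' y : ad_mul << m *g x >> << m' *g y >> = << (m * m') *g (x * y)%g >>.
Proof.
by rewrite /ad_mul biliftU -(zmorphMz (@zmorph_malgU _ _ _)) intz.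
Qed.

Lemma ad_pairU m x m' y : ad_pair << m *g x >> << m' *g y >> = << (m * m') *g (x, y) >>.
Proof.
by rewrite /ad_pair biliftU -(zmorphMz (@zmorph_malgU _ _ _)) intz.
Qed.

Lemma ad_mapB f : zmod_morphism (ad_map f).
Proof. by apply: malg_lift_is_zmod_morphism => s m m'; rewrite monalgUB. Qed.

Lemma ad_mapU f m s : ad_map f << m *g s >> = << m *g f s >>.
Proof. by rewrite /ad_map malg_liftU ?monalgU0. Qed.

Lemma ad_actU g m x : gact g (<< m *g x >> : Ad) = << m *g (g * x * g^-1)%g >>.
Proof. exact: perm_actU. Qed.

Lemma ad2_actU g m s : gact g (<< m *g s >> : Ad2) = << m *g pair_act g s >>.
Proof. exact: perm_actU. Qed.

Lemma conj_actMr (g x y : G) : (g * x * g^-1 * (g * y * g^-1))%g = (g * (x * y) * g^-1)%g.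
Proof. by rewrite -!mulgA mulKg. Qed.

Lemma ad_mul_act g x y : ad_mul (gact g x) (gact g y) = gact g (ad_mul x y).
Proof.
move: x y; apply: bilift_ext => [y|x|y|x|s t].
- exact: zmorph_comp (ad_mulBl _) (@gactB _ Ad g).
- exact: zmorph_comp (ad_mulBr _) (@gactB _ Ad g).
- exact: zmorph_comp (@gactB _ Ad g) (ad_mulBl _).
- exact: zmorph_comp (@gactB _ Ad g) (ad_mulBr _).
by rewrite !ad_actU !ad_mulU ad_actU conj_actMr.
Qed.

Lemma ad_pair_act g x y : ad_pair (gact g x) (gact g y) = gact g (ad_pair x y).
Proof.
move: x y; apply: bilift_ext => [y|x|y|x|s t].
- exact: zmorph_comp (ad_pairBl _) (@gactB _ Ad g).
- exact: zmorph_comp (ad_pairBr _) (@gactB _ Ad g).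
- exact: zmorph_comp (@gactB _ Ad2 g) (ad_pairBl _).
- exact: zmorph_comp (@gactB _ Ad2 g) (ad_pairBr _).
by rewrite !ad_actU !ad_pairU ad2_actU.
Qed.

Lemma ad_map_act f g x : (forall s, f (pair_act g s) = (g * f s * g^-1)%g) ->
  ad_map f (gact g x) = gact g (ad_map f x).
Proof.
move=> f_act; move: x; apply: malg_ext => [||m s].
- exact: zmorph_comp (ad_mapB _) (@gactB _ Ad2 g).
- exact: zmorph_comp (@gactB _ Ad g) (ad_mapB _).
by rewrite ad2_actU !ad_mapU ad_actU f_act.
Qed.

Lemma ad_mulA x y w : ad_mul (ad_mul x y) w = ad_mul x (ad_mul y w).
Proof.
move: w; apply: malg_ext => [||m t].
- exact: ad_mulBr.
- exact: zmorph_comp (ad_mulBr _) (ad_mulBr _).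
move: x y; apply: bilift_ext => [y|x|y|x|s r].
- exact: zmorph_comp (ad_mulBl _) (ad_mulBl _).
- exact: zmorph_comp (ad_mulBl _) (ad_mulBr _).
- exact: ad_mulBl.
- exact: zmorph_comp (ad_mulBr _) (ad_mulBl _).
by rewrite !ad_mulU mulrA mulgA.
Qed.

Definition star (u v : cochain Ad) : cochain Ad := cup_with ad_mul u v.

Lemma starA u v w : star (star u v) w = star u (star v w).
Proof.
apply/funext/cupA; try exact: ad_mul_act.
- exact: ad_mulBl.
- exact: ad_mulBr.
- exact: ad_mulA.
Qed.

Lemma starBl v : zmod_morphism (star^~ v).
Proof.
move=> u u'; apply/funext => s; rewrite -[RHS]/(star u v s - star u' v s) -sumrB.
by apply: eq_bigr => i _; exact: ad_mulBl.
Qed.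

Lemma starBr u : zmod_morphism (star u).
Proof.
move=> v v'; apply/funext => s; rewrite -[RHS]/(star u v s - star u v' s) -sumrB.
apply: eq_bigr => i _; rewrite -ad_mulBr; congr (ad_mul _ _); exact: gactB.
Qed.

Lemma star_cocycle u v p q : u \in cocycle p -> v \in cocycle q ->
  star u v \in cocycle (p + q).
Proof.
exact: cup_cocycle ad_mulBl ad_mulBr ad_mul_act.
Qed.

End AdjointModule.

Lemma cochain_d_coef (G : groupType) (A B : gmodule G) (f : A -> B) (u : cochain A) s :
  zmod_morphism f -> (forall g a, f (gact g a) = gact g (f a)) ->
  cochain_d (fun t => f (u t) : B) s = f (cochain_d u s).
Proof.
move=> fB f_act; rewrite !cochain_dE (delta_morph _ _ fB); apply: eq_delta.
by case=> [|x t] /=; rewrite ?(zmorph0 fB) ?f_act.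
Qed.

Lemma coef_cocycle (G : groupType) (A B : gmodule G) (f : A -> B) (u : cochain A) p :
  zmod_morphism f -> (forall g a, f (gact g a) = gact g (f a)) ->
  u \in cocycle p -> (fun t => f (u t) : B) \in cocycle p.
Proof.
move=> fB f_act /cocycleP[/asboolP up du]; apply/andP; split.
  by apply/asboolP => s /up ->; exact: zmorph0 fB.
apply/eqP/funext => s; apply: etrans (cochain_d_coef u s fB f_act) _.
by rewrite du [LHS](zmorph0 fB).
Qed.

(** * The algebra structure on H_*(G; Ad) *)

Section AdjointAlgebra.
Context {G : groupType} {n : nat} (z : group_homology (trivZ G) n%:Z).
Implicit Types (p q m : int).

(* The coefficients (x, y) and (y^-1 x y, y) lie in one orbit and differ by an
   element of G that depends equivariantly on (x, y), so exchanging them does not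
   change the homology class; the products taken in the two orders agree after it. *)
Lemma ad_map_swap k c : c \in Defs.cycle (C := bar_chains (@Ad2 G)) k ->
  hclass (C := bar_chains Ad) k (bar_map id (ad_map (fun s => s.2 * s.1)%g) c)
  = hclass (C := bar_chains Ad) k (bar_map id (ad_map (fun s => s.1 * s.2)%g) c).
Proof.
move=> cC; pose F (s : pair_gset) (x : G) := (s.2 * x)%g.
have F_act g s x : F (gset_act g s) (g * x)%g = (g * F s x)%g.
  by rewrite /F /= -!mulgA mulKg.
have swapP (f : G * G -> G) : (forall g s, f (pair_act g s) = (g * f s * g^-1)%g) ->
    chain_map (C := bar_chains Ad2) (C' := bar_chains Ad) (bar_map id (ad_map f)).
  move=> f_act; apply: bar_map_chain_map => // [|g a]; first exact: ad_mapB.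
  exact: ad_map_act.
have f1 (g : G) (s : G * G) : ((pair_act g s).2 * (pair_act g s).1 = g * (s.2 * s.1) * g^-1)%g.
  exact: conj_actMr.
rewrite -(hmapE (swapP _ f1) (erefl k) cC) -(move_vertices_homologous F_act cC).
rewrite (hmapE (swapP _ f1) (erefl k)); last first.
  exact: chain_map_cycle (move_vertices_map F_act) _ _ cC.
congr (hclass _ _); have [MB _ _ _] := move_vertices_map F_act.
move: {cC} c; apply: perm_chain_ext => [||m s l].
- exact: zmorph_comp (bar_mapB (ad_mapB _)) MB.
- exact: bar_mapB (ad_mapB _).
rewrite (move_vertices_hom F_act) -/Ad2.
(* With s = (x, y) every vertex has been multiplied by y. Translating back by y^-1 restores the
   simplex and turns the coefficient into (y^-1 x y, y), whose factors multiplied in the opposite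
   order give x y. *)
rewrite -[<< m *g s >> in LHS](@gactVK _ Ad2 s.2) hom_chain_mul !hom_chain_vertices.
rewrite !bar_mapU; try exact: ad_mapB.
by rewrite ad2_actU !ad_mapU /pair_act /= invgK mulVg mul1g !mulgA mulgV mul1g.
Qed.

(** Both products come from the single cocycle [w] with values in Z[G x G]: [f1] sends it to
    [star u v], and [f2] sends it to [star v u] up to (-1)^(pq) and a coboundary. Since
    [ad_map_swap] compares [f1] and [f2] on cycles, [w] is first capped with z and the coefficient
    maps are moved across the cap product. *)
Lemma star_comm p q m (u v : cochain (@Ad G)) : n%:Z - (p + q) = m ->
  u \in cocycle p -> v \in cocycle q ->
  hclass (C := bar_chains Ad) m (capz z (star v u))
  = hclass (C := bar_chains Ad) m (capz z (star u v)) *~ parity (p * q).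
Proof.
move=> npm uC vC; have [w' w'd comm] :=
  cup_commutative (@ad_pairBl G) (@ad_pairBr G) (@ad_pair_act G) uC vC.
have m1 (g : G) s : ((pair_act g s).1 * (pair_act g s).2 = g * (s.1 * s.2) * g^-1)%g.
  exact: conj_actMr.
have m2 (g : G) s : ((pair_act g s).2 * (pair_act g s).1 = g * (s.2 * s.1) * g^-1)%g.
  exact: conj_actMr.
pose f1 := ad_map (fun s : G * G => s.1 * s.2)%g.
pose f2 := ad_map (fun s : G * G => s.2 * s.1)%g.
have f1_act (g : G) a : f1 (gact g a) = gact g (f1 a) by exact: ad_map_act.
have f2_act (g : G) a : f2 (gact g a) = gact g (f2 a) by exact: ad_map_act.
pose w : cochain Ad2 := cup_with (@ad_pair G) u v.
have wC : w \in cocycle (p + q).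
  exact: cup_cocycle (@ad_pairBl G) (@ad_pairBr G) (@ad_pair_act G) uC vC.
have f1w : star u v = fun s => f1 (w s).
  apply/funext => s; rewrite [RHS](zmorph_sum (ad_mapB _)); apply: eq_bigr => i _.
  move: (u _) (gact _ _); apply: bilift_ext => [y|x|y|x|a b].
  - exact: ad_mulBl.
  - exact: ad_mulBr.
  - exact: zmorph_comp (ad_mapB _) (ad_pairBl _).
  - exact: zmorph_comp (ad_mapB _) (ad_pairBr _).
  by rewrite ad_mulU ad_pairU ad_mapU.
have f2w : star v u = fun s => f2 (w s) *~ parity (p * q) + f2 (cochain_d w' s).
  apply/funext => s; rewrite /f2 -(zmorphMz (ad_mapB _)) -(zmorphD (ad_mapB _)) -comm.
  rewrite [RHS](zmorph_sum (ad_mapB _)); apply: eq_bigr => i _.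
  move: (v _) (gact _ _); apply: bilift_ext => [y|x|y|x|a b].
  - exact: ad_mulBl.
  - exact: ad_mulBr.
  - exact: zmorph_comp (ad_mapB _) (ad_pairBr _).
  - exact: zmorph_comp (ad_mapB _) (ad_pairBl _).
  by rewrite ad_mulU ad_pairU ad_mapU mulrC.
pose w2 : cochain Ad := fun s => f2 (w s).
have w2C : w2 \in cocycle (p + q) by apply: coef_cocycle wC => //; exact: ad_mapB.
have vuC : star v u \in cocycle (p + q) by rewrite addrC; exact: star_cocycle.
pose b : cochain Ad := fun s => f2 (w' s).
have bd : b \in cochain_deg (p + q - 1).
  by apply/asboolP => s; move/asboolP: w'd => /[apply] e; rewrite /b e; exact: zmorph0 (ad_mapB _).
have db : cochain_d b = star v u - w2 *~ parity (p * q).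
  apply/funext => s; apply: etrans (cochain_d_coef w' s (ad_mapB _) f2_act) _.
  rewrite f2w; set r := w2 *~ _.
  have rE : r s = f2 (w s) *~ parity (p * q).
    exact: (@zmorphMz _ _ (fun h : cochain Ad => h s)).
  rewrite -[RHS]/(f2 (w s) *~ parity (p * q) + f2 (cochain_d w' s) - r s) rE.
  by rewrite addrAC subrr add0r.
have w2sC : w2 *~ parity (p * q) \in cocycle (p + q) by exact: cocycleMz.
have e : hclass (C := bar_chains Ad) m (capz z w2)
    = hclass (C := bar_chains Ad) m (capz z (star u v)).
  have wz := capz_cycle z npm wC.
  rewrite /capz -(bar_map_cap _ _ (ad_mapB _) f2_act) (ad_map_swap wz).
  by rewrite (bar_map_cap _ _ (ad_mapB _) f1_act) f1w.
apply: etrans (capz_coboundary z npm vuC w2sC bd db) _.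
rewrite capzMz hclassMz; last exact: capz_cycle npm w2C.
exact: (congr1 (fun t => t *~ parity (p * q)) e).
Qed.

End AdjointAlgebra.

Section IntersectionAlgebra.
Context {G : groupType} {n : nat} (z : group_homology (trivZ G) n%:Z).
Implicit Types (p q m : int) (u v b : cochain (@Ad G)).

Lemma star_dl p v b : b \in cochain_deg p -> cochain_d v = 0 ->
  cochain_d (star b v) = star (cochain_d b) v.
Proof.
move=> bp dv; apply/funext => s.
apply: etrans (cochain_d_cup ad_mulBl ad_mulBr ad_mul_act _ _ bp) _.
rewrite dv -[cup_with _ b 0]/(star b 0) (zmorph0 (starBr b)).
by rewrite mul0rz addr0.
Qed.

Lemma star_dr p u b : u \in cochain_deg p -> cochain_d u = 0 ->
  cochain_d (star u b *~ parity p) = star u (cochain_d b).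
Proof.
move=> up du; rewrite [LHS](zmorphMz (cochain_d_is_zmod_morphism (A := Ad))).
apply/funext => s; rewrite [LHS](zmorphMz (f := fun h : cochain Ad => h s)) //.
rewrite [X in X *~ _](cochain_d_cup ad_mulBl ad_mulBr ad_mul_act _ _ up) du.
rewrite -[cup_with _ 0 b]/(star 0 b) (zmorph0 (starBl b)) add0r.
by rewrite -mulrzA parity_sqr mulr1z.
Qed.

Lemma capz_starl p q m u u' v b : n%:Z - (p + q) = m ->
  u \in cocycle p -> u' \in cocycle p -> v \in cocycle q ->
  b \in cochain_deg (p - 1) -> cochain_d b = u - u' ->
  hclass (C := bar_chains Ad) m (capz z (star u v))
  = hclass (C := bar_chains Ad) m (capz z (star u' v)).
Proof.
move=> npm uC u'C vC bd db; have [vq dv] := cocycleP vC.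
have uvC := star_cocycle uC vC; have u'vC := star_cocycle u'C vC.
apply: (@capz_coboundary _ _ z _ _ _ _ _ (star b v) npm uvC u'vC).
  by rewrite addrAC; apply: cup_deg bd vq; [exact: ad_mulBl | exact: ad_mulBr].
by rewrite (star_dl bd dv) db; exact: starBl.
Qed.

Lemma capz_starr p q m u v v' b : n%:Z - (p + q) = m ->
  u \in cocycle p -> v \in cocycle q -> v' \in cocycle q ->
  b \in cochain_deg (q - 1) -> cochain_d b = v - v' ->
  hclass (C := bar_chains Ad) m (capz z (star u v))
  = hclass (C := bar_chains Ad) m (capz z (star u v')).
Proof.
move=> npm uC vC v'C bd db; have [up du] := cocycleP uC.
have uvC := star_cocycle uC vC; have uv'C := star_cocycle uC v'C.
apply: (@capz_coboundary _ _ z _ _ _ _ _ (star u b *~ parity p) npm uvC uv'C).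
  rewrite -addrA; have ubd : star u b \in cochain_deg (p + (q - 1)).
    by apply: cup_deg up bd; [exact: ad_mulBl | exact: ad_mulBr].
  exact: rpredMz.
by rewrite (star_dr _ up du) db; exact: starBr.
Qed.

Hypothesis z_fundamental : poincare_duality z.

(** A dual cocycle of degree -p; [dual_inv] would produce the degree n - (p + n), which is equal but
    not convertible to it. *)
Definition dual_rep p (x : group_homology (@Ad G) (p + n%:Z)) : cochain (@Ad G) :=
  xget 0 [set u | u \in cocycle (- p) /\
                  x = hclass (C := bar_chains Ad) (p + n%:Z) (capz z u)].

Lemma dual_deg p : n%:Z - (- p) = p + n%:Z.
Proof. by rewrite opprK addrC. Qed.

Lemma dual_repP p (x : group_homology (@Ad G) (p + n%:Z)) :
  dual_rep x \in cocycle (- p) /\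
  x = hclass (C := bar_chains Ad) (p + n%:Z) (capz z (dual_rep x)).
Proof.
rewrite /dual_rep; case: xgetP => [u -> //|none].
have [u uC xu] := dual_cocycle z_fundamental x (dual_deg p).
by case: (none u).
Qed.

(* The product on H_*(G; Ad) dual to the cup product. *)
Definition dual_mul p q (x : group_homology (@Ad G) (p + n%:Z))
    (y : group_homology (@Ad G) (q + n%:Z)) : group_homology (@Ad G) (p + q + n%:Z) :=
  hclass (C := bar_chains Ad) (p + q + n%:Z) (capz z (star (dual_rep x) (dual_rep y))).

Lemma dual_mul_deg p q : n%:Z - (- p + - q) = p + q + n%:Z.
Proof. by rewrite -opprD opprK addrC. Qed.

(** The chosen cocycles differ from u and v by coboundaries, and the product of a cocycle with a
    coboundary is a coboundary. The two factors are replaced one at a time. *)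
Lemma dual_mulE p q u v : u \in cocycle (- p) -> v \in cocycle (- q) ->
  dual_mul (hclass (C := bar_chains Ad) (p + n%:Z) (capz z u))
           (hclass (C := bar_chains Ad) (q + n%:Z) (capz z v))
  = hclass (C := bar_chains Ad) (p + q + n%:Z) (capz z (star u v)).
Proof.
move=> uC vC; rewrite /dual_mul.
have [] := dual_repP (hclass (C := bar_chains Ad) (p + n%:Z) (capz z u)).
have [] := dual_repP (hclass (C := bar_chains Ad) (q + n%:Z) (capz z v)).
move: (dual_rep _) (dual_rep _) => v0 u0 v0C vv0 u0C uu0.
have [b bd db] := dual_cocycle_uniq z_fundamental (dual_deg p) u0C uC (esym uu0).
have [c cd dc] := dual_cocycle_uniq z_fundamental (dual_deg q) v0C vC (esym vv0).
apply: etrans (capz_starl (dual_mul_deg p q) u0C uC v0C bd db) _.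
exact: capz_starr (dual_mul_deg p q) uC v0C vC cd dc.
Qed.

Lemma dual_mulBl p q (y : group_homology (@Ad G) (q + n%:Z)) :
  zmod_morphism (fun x : group_homology (@Ad G) (p + n%:Z) => dual_mul x y).
Proof.
move=> x x'; have [uC ->] := dual_repP x; have [u'C ->] := dual_repP x'.
have [vC ->] := dual_repP y; move: (dual_rep x) (dual_rep x') (dual_rep y) uC u'C vC.
move=> u u' v uC u'C vC.
have e1 := hclass_capzB z (dual_deg p) uC u'C.
apply: etrans (congr1 (fun t => dual_mul t _) (esym e1)) _.
apply: etrans (dual_mulE (cocycleB uC u'C) vC) _.
have e2 := hclass_capzB z (dual_mul_deg p q) (star_cocycle uC vC) (star_cocycle u'C vC).
have e3 := dual_mulE uC vC; have e4 := dual_mulE u'C vC.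
have e0 : star (u - u') v = star u v - star u' v := starBl v u u'.
move: e0 e2 e3 e4; move: (star (u - u') v) (star u v) (star u' v) => s t r -> e2 e3 e4.
apply: etrans e2 _.
exact: (congr2 (fun a b : homology (bar_chains Ad) (p + q + n%:Z) => a - b) (esym e3) (esym e4)).
Qed.

Lemma dual_mulBr p q (x : group_homology (@Ad G) (p + n%:Z)) :
  zmod_morphism (fun y : group_homology (@Ad G) (q + n%:Z) => dual_mul x y).
Proof.
move=> y y'; have [uC ->] := dual_repP x; have [vC ->] := dual_repP y.
have [v'C ->] := dual_repP y'; move: (dual_rep x) (dual_rep y) (dual_rep y') uC vC v'C.
move=> u v v' uC vC v'C.
have e1 := hclass_capzB z (dual_deg q) vC v'C.
apply: etrans (congr1 (dual_mul _) (esym e1)) _.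
apply: etrans (dual_mulE uC (cocycleB vC v'C)) _.
have e2 := hclass_capzB z (dual_mul_deg p q) (star_cocycle uC vC) (star_cocycle uC v'C).
have e3 := dual_mulE uC vC; have e4 := dual_mulE uC v'C.
have e0 : star u (v - v') = star u v - star u v' := starBr u v v'.
move: e0 e2 e3 e4; move: (star u (v - v')) (star u v) (star u v') => s t r -> e2 e3 e4.
apply: etrans e2 _.
exact: (congr2 (fun a b : homology (bar_chains Ad) (p + q + n%:Z) => a - b) (esym e3) (esym e4)).
Qed.

End IntersectionAlgebra.

(** * Shapiro's lemma and direct sums *)

Section DirectSums.
Context {I : choiceType} {A : I -> zmodType}.
Implicit Types (x y : dsum A).

Lemma dsumP x y : (forall i, x i = y i) -> x = y.
Proof. by move=> xy; apply: val_inj; apply: functional_extensionality_dep. Qed.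

Lemma dsumB x y i : dsum_fun (x - y) i = x i - y i.
Proof. by []. Qed.

Lemma dsum_coefB i : zmod_morphism (fun x : dsum A => x i).
Proof. by []. Qed.

Lemma dinj_same i (a : A i) : dinj a i = a.
Proof. by rewrite /dsum_fun /= /dsingle; case: eqP => // e; rewrite eq_axiomK. Qed.

Lemma dinj_other i j (a : A i) : i <> j -> dinj a j = 0.
Proof. by rewrite /dsum_fun /= /dsingle; case: eqP. Qed.

Lemma dinjB i : zmod_morphism (@dinj I A i).
Proof.
move=> a b; apply: dsumP => j; rewrite dsumB.
have [e|ij] := pselect (i = j); first by subst j; rewrite !dinj_same.
by rewrite !dinj_other ?subrr.
Qed.

Lemma dsum_support x : exists2 r : seq I, uniq r & forall i, i \notin r -> x i = 0.
Proof.
have /asboolP /finite_fsetP[X xX] := valP x.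
exists X; first exact: fset_uniq.
move=> i iX; apply/eqP; apply: contraNT iX => xi.
by have : [set` X]%classic i by rewrite -xX.
Qed.

Lemma dsum_decomp x (r : seq I) : uniq r -> (forall i, i \notin r -> x i = 0) ->
  x = \sum_(i <- r) dinj (x i).
Proof.
move=> r_uniq xr; apply: dsumP => j; rewrite (zmorph_sum (dsum_coefB j)).
have [jr|jr] := boolP (j \in r); last first.
  rewrite xr // big_seq big1 // => i ir; apply: dinj_other => ij.
  by rewrite -ij ir in jr.
rewrite (bigD1_seq j) //= dinj_same big1 ?addr0 // => i /eqP ij.
exact: dinj_other.
Qed.

Lemma dsum_ext (C : zmodType) (f h : dsum A -> C) : zmod_morphism f -> zmod_morphism h ->
  (forall i (a : A i), f (dinj a) = h (dinj a)) -> f =1 h.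
Proof.
move=> fB hB fh x; have [r r_uniq xr] := dsum_support x.
rewrite (dsum_decomp r_uniq xr) (zmorph_sum fB) (zmorph_sum hB).
by apply: eq_bigr => i _.
Qed.

Section Lift.
Context {C : zmodType} (f : forall i, A i -> C).
Hypothesis fB : forall i, zmod_morphism (@f i).

Lemma dsum_liftE x (r : seq I) : uniq r -> (forall i, i \notin r -> x i = 0) ->
  dsum_lift f x = \sum_(i <- r) f (x i).
Proof.
move=> r_uniq xr; apply: fsbig_fwiden => // [i /eqP xi|i [_ /negP]] /=.
  by apply/negPn/negP => /xr.
by rewrite negbK => /eqP xi; exact: etrans (congr1 (@f i) xi) (zmorph0 (@fB i)).
Qed.

Lemma dsum_liftB : zmod_morphism (dsum_lift f).
Proof.
move=> x y; have [r r_uniq xr] := dsum_support x; have [s s_uniq ys] := dsum_support y.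
pose t := undup (r ++ s); have t_uniq : uniq t := undup_uniq _.
have xt i : i \notin t -> dsum_fun x i = 0.
  by rewrite mem_undup mem_cat negb_or => /andP[/xr].
have yt i : i \notin t -> dsum_fun y i = 0.
  by rewrite mem_undup mem_cat negb_or => /andP[_ /ys].
rewrite !(dsum_liftE t_uniq) // => [|i it]; last by rewrite dsumB xt // yt // subrr.
by rewrite -sumrB; apply: eq_bigr => i _; rewrite dsumB fB.
Qed.

Lemma dsum_lift_dinj i (a : A i) : dsum_lift f (dinj a) = f a.
Proof.
rewrite (@dsum_liftE _ [:: i]) // => [|j]; first by rewrite big_seq1 dinj_same.
by rewrite inE => /eqP ji; apply: dinj_other => ij; apply: ji.
Qed.
End Lift.
End DirectSums.

Section Shapiro.
Context {G : groupType} (K : groupClosed G).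

Lemma lcoset_eqP (x y : G) : reflect (lcoset K x = lcoset K y) ((x^-1 * y)%g \in K).
Proof. by apply: (iffP idP) => [xy|/eqmodP//]; exact/eqmodP. Qed.

Definition coset_gset : gset G := GSet (@lcoset_act1 G K) (@lcoset_actM G K).

Definition shapiro_map : chain (trivZ (subgrp K)) -> chain (Zcosets K) :=
  bar_map (A := trivZ (subgrp K)) (B := Zcosets K) (val : subgrp K -> G)
    (fun m : int => << m *g lcoset K 1%g >>).

Lemma Zcosets_actE (g : G) m c : gact g (<< m *g c >> : Zcosets K) = << m *g lcoset_act g c >>.
Proof. exact: Zcosets_actU. Qed.

Lemma lcoset_val (k : subgrp K) : lcoset K (val k) = lcoset K 1%g.
Proof. by apply/lcoset_eqP; rewrite mulg1 gpredV; exact: valP. Qed.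

Lemma shapiro_map_chain_map :
  chain_map (C := bar_chains (trivZ (subgrp K))) (C' := bar_chains (Zcosets K)) shapiro_map.
Proof.
apply: bar_map_chain_map => [|x y|g m]; first exact: zmorph_malgU.
  by [].
by rewrite Zcosets_actE lcoset_actE mulg1 lcoset_val.
Qed.

(* Representing K by 1 makes the retraction below a strict left inverse of the
   chain map of Shapiro's lemma. *)
Definition coset_rep (c : lcosets K) : G :=
  if c == lcoset K 1%g then 1%g else repr (c : {eq_quot (lcoset_rel K)}%qT).

Lemma coset_repK c : lcoset K (coset_rep c) = c.
Proof. by rewrite /coset_rep; case: eqP => [->//|_]; exact: reprK. Qed.

Lemma coset_rep1 : coset_rep (lcoset K 1%g) = 1%g.
Proof. by rewrite /coset_rep eqxx. Qed.

(** Moves the vertex x into the coset c by an element depending only on x^-1 c, which is unchanged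
    when x and c are translated together; hence the map is equivariant. *)
Definition slide (c : coset_gset) (x : G) : G := (x * coset_rep (lcoset_act x^-1%g c))%g.

Lemma slide_act g (c : coset_gset) x :
  slide (gset_act g c) (g * x)%g = (g * slide c x)%g.
Proof. by rewrite /slide invgM lcoset_actM -(lcoset_actM g^-1%g g) mulVg lcoset_act1 mulgA. Qed.

Lemma lcoset_slide c x : lcoset K (slide c x) = c.
Proof.
by rewrite /slide -lcoset_actE coset_repK -lcoset_actM mulgV lcoset_act1.
Qed.

(** After [slide] every vertex lies in the coset c, and dividing on the left by the representative
    of c brings it into K. The default value of [insubd] is never reached, by [val_retract]. *)
Definition retract (c : coset_gset) (x : G)  : subgrp K :=
  insubd 1%g ((coset_rep c)^-1 * slide c x)%g.

Lemma val_retract c x : val (retract c x) = ((coset_rep c)^-1 * slide c x)%g.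
Proof. by rewrite insubdK //; apply/lcoset_eqP; rewrite coset_repK lcoset_slide. Qed.

Definition retract_hom m c l : chain (trivZ (subgrp K)) :=
  hom_chain (m : trivZ (subgrp K)) (map (retract c) l).

Lemma retract_homB c l : zmod_morphism (fun m => retract_hom m c l).
Proof. by move=> m m'; exact: (hom_chainB _ (m : trivZ (subgrp K)) m'). Qed.

(** Passing from (c, x) to (g c, g x) multiplies all retracted vertices on the left by the same
    element [k] of K, and a homogeneous chain over K does not see such a translation. *)
Lemma retract_hom_act m (c : coset_gset) g l :
  retract_hom m (gset_act g c) (map ( *%g g) l) = retract_hom m c l.
Proof.
have kK : ((coset_rep (gset_act g c))^-1 * (g * coset_rep c))%g \in K.
  by apply/lcoset_eqP; rewrite -lcoset_actE !coset_repK.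
pose k : subgrp K := exist (fun x : G => x \in K) _ kK.
rewrite /retract_hom -[RHS](hom_chain_mul (m : trivZ (subgrp K)) k); congr (hom_chain _ _).
rewrite -!map_comp; apply: eq_map => x; apply: val_inj.
rewrite [RHS]/= -/(val _) val_retract /= val_retract slide_act.
by rewrite -!mulgA mulVKg.
Qed.

Definition retract_map : chain (Zcosets K) -> chain (trivZ (subgrp K)) :=
  chain_lift (S := coset_gset) retract_hom.

Lemma retract_map_chain_map :
  chain_map (C := bar_chains (Zcosets K)) (C' := bar_chains (trivZ (subgrp K))) retract_map.
Proof.
apply: (@chain_lift_map _ coset_gset) => // [c l|m c g l|m c l k lk|m c l].
- exact: retract_homB.
- exact: retract_hom_act.
- by apply: hom_chain_deg; rewrite size_map.
- by rewrite chain_d_hom delta_map.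
Qed.
End Shapiro.

Section ShapiroIso.
Context {G : groupType} (K : groupClosed G).

Lemma shapiro_mapU m s : @shapiro_map G K << m *g s >> = << << m *g lcoset K 1%g >> *g map val s >>.
Proof. by rewrite /shapiro_map bar_mapU //; exact: zmorph_malgU. Qed.

Lemma retract_mapK c : retract_map (@shapiro_map G K c) = c.
Proof.
have [RB _ _ _] := retract_map_chain_map K; have [SB _ _ _] := shapiro_map_chain_map K.
move: c; apply: malg_ext => [||m s]; [exact: zmorph_comp RB SB | by move=> c c' |].
rewrite shapiro_mapU /retract_map [LHS](chain_liftU (@retract_homB _ K)).
rewrite /retract_hom -[RHS](hom_chain_vertices (A := trivZ (subgrp K))); congr (hom_chain _ _).
have -> : vertices 1%g (map val s) = map val (vertices (1%g : subgrp K) s).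
  have sE (x : subgrp K) : map val (scanl *%g x s) = scanl *%g (val x) (map val s).
    by elim: s x => //= k s IH x; rewrite IH.
  by rewrite [RHS]/= sE.
rewrite -map_comp -[RHS]map_id; apply: eq_map => k; apply: val_inj.
rewrite [LHS]val_retract coset_rep1 invg1 mul1g /slide.
have -> : lcoset_act (val k)^-1%g (lcoset K 1%g) = lcoset K 1%g.
  by rewrite lcoset_actE mulg1; apply/lcoset_eqP; rewrite mulg1 invgK; exact: valP.
by rewrite coset_rep1 mulg1.
Qed.

(** The composite is the displacement of vertices by [slide], after translation by the
    representative of the coset, and is therefore homotopic to the identity. *)
Lemma shapiro_retract k c : c \in Defs.cycle (C := bar_chains (Zcosets K)) k ->
  hclass (C := bar_chains (Zcosets K)) k (@shapiro_map G K (retract_map c)) = hclass k c.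
Proof.
move=> cC; have F_act := @slide_act _ K.
have [RB _ _ _] := retract_map_chain_map K; have [SB _ _ _] := shapiro_map_chain_map K.
have MP := move_vertices_map (S := coset_gset K) F_act.
have E c' : @shapiro_map G K (retract_map c')
    = move_vertices (S := coset_gset K) (@slide _ K) c'.
  have [MB _ _ _] := MP; move: c'; apply: (@perm_chain_ext _ (coset_gset K)) => [||m b s].
  - exact: zmorph_comp SB RB.
  - exact: MB.
  rewrite (move_vertices_hom F_act).
  have -> : retract_map (hom_chain (<< m *g b >> : perm_module (coset_gset K)) (vertices 1%g s))
      = retract_hom m b (vertices 1%g s).
    apply: (@chain_lift_hom _ (coset_gset K)) => //; first exact: retract_homB.
    by move=> *; exact: retract_hom_act.
  rewrite /shapiro_map /retract_hom bar_map_hom; last 3 first.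
  - exact: zmorph_malgU.
  - by [].
  - by move=> g a; rewrite Zcosets_actE lcoset_actE mulg1 lcoset_val.
  rewrite -[LHS](hom_chain_mul (A := Zcosets K) _ (coset_rep b)) Zcosets_actE lcoset_actE mulg1.
  rewrite coset_repK -!map_comp (@eq_map _ _ _ (@slide _ K b)) // => x.
  by rewrite [LHS]/= -/(val _) val_retract mulVKg.
(* [Zcosets K] and the permutation module on the cosets have the same group and action but are
   packaged separately, so the cycle condition is unpacked and rebuilt. *)
have cC' : c \in Defs.cycle (C := bar_chains (perm_module (coset_gset K))) k.
  by case/andP: cC => ck dc; apply/andP; split; [exact: ck | exact: dc].
have /(hclass_eqP (chain_map_cycle MP cC') cC')[b bd db] := move_vertices_homologous F_act cC'.
apply: (@hclass_eq (bar_chains (Zcosets K)) k _ _ b _ cC).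
- exact: chain_map_cycle (shapiro_map_chain_map K) _ _
    (chain_map_cycle (retract_map_chain_map K) cC).
- exact: bd.
by rewrite E; exact: db.
Qed.

Lemma shapiroE k (x : HZ K k) :
  shapiro x = hmap (C := bar_chains _) (C' := bar_chains _) k (@shapiro_map G K) x.
Proof. by []. Qed.

Lemma shapiroB k : zmod_morphism (@shapiro G K k).
Proof. exact: hmapB (shapiro_map_chain_map K) _ _ (erefl k). Qed.

Lemma shapiro_inj k : injective (@shapiro G K k).
Proof.
apply: (can_inj (g := hmap (C := bar_chains (Zcosets K))
  (C' := bar_chains (trivZ (subgrp K))) k (@retract_map _ K))) => x.
rewrite shapiroE (hmap_comp _ _ _ (shapiro_map_chain_map K) (retract_map_chain_map K)) //.
by apply: hmap_id => c; exact: retract_mapK.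
Qed.

Lemma shapiro_surj k (y : group_homology (Zcosets K) k) : exists x : HZ K k, shapiro x = y.
Proof.
have yC := hrep_cycle y; have rC := chain_map_cycle (retract_map_chain_map K) yC.
exists (hclass (C := bar_chains (trivZ (subgrp K))) k (retract_map (hrep y))).
rewrite shapiroE (hmapE (shapiro_map_chain_map K) (erefl k) rC).
by rewrite (shapiro_retract yC) hclassK.
Qed.

End ShapiroIso.

Section DirectSumHomology.
Context {G : groupType} {I : choiceType} (M : I -> gmodule G).

Definition dsum_inj_map (i : I) : chain (M i) -> chain (dsum_gmodule M) :=
  bar_map (A := M i) (B := dsum_gmodule M) id (fun x => dinj (A := M) (i := i) x).

Definition dsum_proj_map (i : I) : chain (dsum_gmodule M) -> chain (M i) :=
  bar_map (A := dsum_gmodule M) (B := M i) id (fun x => dsum_fun x i).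

Lemma dsum_inj_chain_map i :
  chain_map (C := bar_chains (M i)) (C' := bar_chains (dsum_gmodule M)) (@dsum_inj_map i).
Proof.
apply: bar_map_chain_map => // [|g a]; first exact: dinjB.
apply: dsumP => j; rewrite [RHS]/(gact g (dsum_fun (dinj a) j)).
have [e|ij] := pselect (i = j); first by subst j; rewrite !dinj_same.
rewrite [LHS]dinj_other //; apply: esym; rewrite -[RHS](zmorph0 (gactB g)).
by congr (gact g _); exact: dinj_other.
Qed.

Lemma dsum_proj_chain_map i :
  chain_map (C := bar_chains (dsum_gmodule M)) (C' := bar_chains (M i)) (@dsum_proj_map i).
Proof. by apply: bar_map_chain_map. Qed.

(** A chain has finitely many simplices, each with a coefficient of finite support, so only finitely
    many components occur. Projections and inclusions are chain maps, and a cycle is the sum of its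
    components, which are cycles. *)
Lemma dsum_homology k (y : group_homology (dsum_gmodule M) k) :
  exists r : seq I, y = \sum_(i <- r)
    hmap (C := bar_chains (M i)) (C' := bar_chains (dsum_gmodule M)) k (@dsum_inj_map i)
      (hmap (C := bar_chains (dsum_gmodule M)) (C' := bar_chains (M i)) k (@dsum_proj_map i) y).
Proof.
have yC := hrep_cycle y; set c := hrep y in yC.
pose supp (s : seq G) := projT1 (cid2 (dsum_support (mcoeff s c : dsum M))).
have suppP (s : seq G) i : i \notin supp s -> dsum_fun (mcoeff s c : dsum M) i = 0.
  by rewrite /supp; case: cid2 => /= r _; apply.
pose r := undup (flatten [seq supp s | s <- msupp c]).
have cr s i : i \notin r -> dsum_fun (mcoeff s c : dsum M) i = 0.
  move=> ir; have [sc|sc] := boolP (s \in msupp c); last by rewrite mcoeff_outdom.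
  apply: suppP; apply: contra ir => is_; rewrite mem_undup; apply/flattenP.
  by exists (supp s) => //; apply: map_f.
exists r; have pC i := chain_map_cycle (dsum_proj_chain_map i) yC.
have ipC i := chain_map_cycle (dsum_inj_chain_map i) (pC i).
have yE : c = \sum_(i <- r) dsum_inj_map (dsum_proj_map i c).
  rewrite [LHS]monalgE.
  have -> : \sum_(i <- r) dsum_inj_map (dsum_proj_map i c)
      = \sum_(i <- r) \sum_(s <- msupp c)
          << (dinj (A := M) (dsum_fun (mcoeff s c : dsum M) i) : dsum_gmodule M) *g s >>.
    apply: eq_bigr => i _; have [iB _ _ _] := dsum_inj_chain_map i.
    rewrite /dsum_proj_map /bar_map /malg_lift (zmorph_sum iB); apply: eq_bigr => s _.
    rewrite /dsum_inj_map bar_mapU; last exact: dinjB.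
    by rewrite !map_id.
  rewrite exchange_big; apply: eq_bigr => s _.
  rewrite {1}(dsum_decomp (undup_uniq _) (cr s)).
  exact: (zmorph_sum (@zmorph_malgU _ (dsum_gmodule M) s)).
rewrite -[LHS]hclassK -/c yE (hclass_sum _ ipC); apply: eq_bigr => i _.
rewrite -(hmapE (dsum_inj_chain_map i) (erefl k) (pC i)).
by rewrite -(hmapE (dsum_proj_chain_map i) (erefl k) yC) hclassK.
Qed.

End DirectSumHomology.

(** * Maps out of the tensor product *)

Section Tensor.
Context {G : groupType} {A B : gmodule G}.

Let null_rel (t : {malg int[(A * B)%type]}) :
  tensor_relation t -> t \in tensor_null (A := A) (B := B).
Proof. by move=> rt; apply/asboolP => S; exact. Qed.

Lemma tensBl (b : B) : zmod_morphism (fun a : A => tens a b).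
Proof.
move=> a a'; apply/eqP; rewrite /tens -raddfB -Quotient.idealrBE.
rewrite -rpredN;
apply: null_rel; left; exists (a - a'), a', b.
by rewrite subrK opprB addrAC.
Qed.

Lemma tensBr (a : A) : zmod_morphism (fun b : B => tens a b).
Proof.
move=> b b'; apply/eqP; rewrite /tens -raddfB -Quotient.idealrBE.
rewrite -rpredN; apply: null_rel; right; exists a, (b - b'), b'.
by rewrite subrK opprB addrAC.
Qed.

Lemma tens_act g (a : A) (b : B) :
  gact g (tens a b : tensor_gmodule A B) = tens (gact g a) (gact g b).
Proof. by rewrite [LHS]tensor_act_pi pre_tensor_actU. Qed.
Lemma tensor_ext (X : zmodType) (f h : tensor A B -> X) :
  zmod_morphism f -> zmod_morphism h -> (forall a b, f (tens a b) = h (tens a b)) -> f =1 h.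
Proof.
move=> fB hB fh t; rewrite -(reprK t); move: (repr t) => {t} t.
have piB : zmod_morphism (\pi_(tensor A B)%qT : {malg int[(A * B)%type]} -> tensor A B).
  exact: raddfB.
move: t; apply: malg_ext => [||m [a b]]; try exact: zmorph_comp.
have -> : << m *g (a, b) >> = << (a, b) >> *~ m :> {malg int[(A * B)%type]}.
  by rewrite -(zmorphMz (@zmorph_malgU _ _ _)) intz.
by rewrite (zmorphMz piB) (zmorphMz fB) (zmorphMz hB) [f _]fh.
Qed.

Section Lift.
Context {X : zmodType} (f : A -> B -> X).
Hypotheses (fBl : forall b, zmod_morphism (f^~ b)) (fBr : forall a, zmod_morphism (f a)).

Let lift := malg_lift (fun (ab : A * B) (m : int) => f ab.1 ab.2 *~ m).

Let liftB : zmod_morphism lift.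
Proof. by apply: malg_lift_is_zmod_morphism => ab m m'; rewrite mulrzBr. Qed.

Let liftU a b : lift << (a, b) >> = f a b.
Proof.
by rewrite /lift malg_liftU /= ?mulr0z ?mulr1z.
Qed.

Let lift_null t : t \in tensor_null (A := A) (B := B) -> lift t = 0.
Proof.
move=> /asboolP tP; pose P : {pred {malg int[(A * B)%type]}} := fun t => lift t == 0.
have PE u : (u \in P) = (lift u == 0) by [].
have Pz : zmod_closed P.
  split=> [|u v]; rewrite !PE; first by rewrite (zmorph0 liftB).
  by move=> /eqP u0 /eqP v0; rewrite liftB u0 v0 subrr.
pose Pc : zmodClosed {malg int[(A * B)%type]} :=
  HB.pack P (GRing.isZmodClosed.Build _ P Pz).
apply/eqP/(tP Pc) => r rel_r; rewrite [_ \in _]PE.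
case: rel_r => [[a [a' [b ->]]]|[a [b [b' ->]]]].
  by rewrite !liftB !liftU (zmorphD (fBl b)) addrAC addrK subrr.
by rewrite !liftB !liftU (zmorphD (fBr a)) addrAC addrK subrr.
Qed.

Lemma tensor_lift_pi t : tensor_lift f (\pi_(tensor A B) t)%qT = lift t.
Proof.
apply/eqP; rewrite -subr_eq0 -[tensor_lift _ _]/(lift _) -liftB; apply/eqP/lift_null.
by rewrite Quotient.idealrBE reprK.
Qed.

Lemma tensor_liftB : zmod_morphism (tensor_lift f).
Proof.
move=> t u; rewrite -(reprK t) -(reprK u) -raddfB !tensor_lift_pi; exact: liftB.
Qed.

Lemma tensor_lift_tens a b : tensor_lift f (tens a b) = f a b.
Proof. by rewrite tensor_lift_pi liftU. Qed.
End Lift.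

End Tensor.

(** * From the homology of centralizers to adjoint coefficients *)

Section LoopClasses.
Context {G : groupType}.

(* For K centralizing h, the inclusion of the orbit of h turns H_*(K), which is
   H_*(G; Z[G/K]), into H_*(G; Ad). *)
Definition theta_map (h : G) (K : groupClosed G) : chain (trivZ (subgrp K)) -> chain Ad :=
  bar_map (A := trivZ (subgrp K)) (B := @Ad G) (val : subgrp K -> G)
    (fun m : int => << m *g h >>).

Lemma theta_mapB (h : G) (K : groupClosed G) : zmod_morphism (@theta_map h K).
Proof. by apply: bar_mapB; exact: zmorph_malgU. Qed.

Definition theta (h : G) (K : groupClosed G) k l (x : HZ K k) : group_homology (@Ad G) l :=
  hmap (C := bar_chains (trivZ (subgrp K))) (C' := bar_chains Ad) l (@theta_map h K) x.

Lemma theta_mapU (h : G) (K : groupClosed G) m s :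
  @theta_map h K << m *g s >> = << << m *g h >> *g map val s >>.
Proof. by rewrite /theta_map bar_mapU //; exact: zmorph_malgU. Qed.

Lemma theta_map_chain_map (h : G) (K : groupClosed G) :
  (forall x, x \in K -> (x * h * x^-1)%g = h) ->
  chain_map (C := bar_chains (trivZ (subgrp K))) (C' := bar_chains Ad) (@theta_map h K).
Proof.
move=> Kh; apply: bar_map_chain_map => [|x y|x m]; first exact: zmorph_malgU.
  by [].
by rewrite ad_actU Kh //; exact: valP.
Qed.

Lemma centralizerE (h x : G) : (x \in centralizer h) = (x * h == h * x)%g.
Proof. by []. Qed.

Lemma centralizer_fix (h x : G) : x \in centralizer h -> (x * h * x^-1)%g = h.
Proof. by rewrite centralizerE => /eqP ->; rewrite mulgK. Qed.

Lemma val_conj_map (a : G) (K H : groupClosed G) (u : subgrp K) :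
  (forall x, x \in K -> (a * x * a^-1)%g \in H) ->
  val (conj_map a H u) = (a * val u * a^-1)%g.
Proof. by move=> KH; rewrite /conj_map insubdK //; apply: KH; exact: valP. Qed.

Lemma conj_map_chain_map (a : G) (K H : groupClosed G) :
  (forall x, x \in K -> (a * x * a^-1)%g \in H) ->
  chain_map (C := bar_chains (trivZ (subgrp K))) (C' := bar_chains (trivZ (subgrp H)))
    (bar_map (A := trivZ (subgrp K)) (B := trivZ (subgrp H)) (@conj_map G a K H)
      (fun m : int => m)).
Proof.
move=> KH; apply: bar_map_chain_map => // x y; apply: val_inj.
by rewrite [RHS]/= -/(val _) -/(val _) !val_conj_map // conj_actMr.
Qed.

(** Inside H_*(G; Ad) conjugation by a is the effect of an inner automorphism of G, which is trivial
    by [inner_homologous]. *)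
Lemma theta_conj (a h : G) (K H : groupClosed G) k l m (x : HZ K k) : k = l -> l = m ->
  (forall x, x \in K -> (x * h * x^-1)%g = h) ->
  (forall x, x \in H -> (x * (a * h * a^-1) * x^-1)%g = (a * h * a^-1)%g) ->
  (forall x, x \in K -> (a * x * a^-1)%g \in H) ->
  theta (a * h * a^-1)%g m (HZ_conj a H l x) = theta h m x.
Proof.
move=> kl lm Kh Hh KH; subst l m.
have conjP := conj_map_chain_map KH.
have thP := theta_map_chain_map Hh; have thP' := theta_map_chain_map Kh.
have xC := hrep_cycle x; have txC := chain_map_cycle thP' xC.
apply: etrans (hmapE thP (erefl k) (chain_map_cycle conjP xC)) _.
apply: etrans _ (inner_homologous a txC).
congr (hclass _ _); move: (hrep x); apply: malg_ext => [||j s].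
- have [cB _ _ _] := conjP; have [tB _ _ _] := thP; exact: zmorph_comp tB cB.
- have [tB _ _ _] := thP'; exact: zmorph_comp (bar_mapB (gactB _)) tB.
rewrite (bar_mapU (A := trivZ (subgrp K)) (B := trivZ (subgrp H))) //.
rewrite !theta_mapU (bar_mapU (gactB _)).
rewrite ad_actU -!map_comp; congr (<< _ *g _ >>); apply: eq_map => u.
exact: val_conj_map.
Qed.
End LoopClasses.

(** * The string product *)

Section CosetEvaluation.
Context {G : groupType} (K : groupClosed G) (h : G).

(* x K |-> x h x^-1, for K centralizing h *)
Definition coset_eval : Zcosets K -> @Ad G :=
  malg_lift (fun c m => << m *g (coset_rep c * h * (coset_rep c)^-1)%g >>).

Lemma coset_evalB : zmod_morphism coset_eval.
Proof. by apply: malg_lift_is_zmod_morphism => c m m'; rewrite monalgUB. Qed.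

Hypothesis Kh : forall x, x \in K -> (x * h * x^-1)%g = h.

Lemma coset_evalU m x : coset_eval << m *g lcoset K x >> = << m *g (x * h * x^-1)%g >>.
Proof.
rewrite /coset_eval malg_liftU ?monalgU0 //; set y := coset_rep _.
have yxK : (y^-1 * x)%g \in K by apply/lcoset_eqP; exact: coset_repK.
by rewrite -[in RHS](mulVKg y x) conj_actM (Kh yxK).
Qed.

Lemma coset_eval_act g x : coset_eval (gact g x) = gact g (coset_eval x).
Proof.
move: x; apply: malg_ext => [||m c].
- exact: zmorph_comp coset_evalB (@gactB _ (Zcosets K) g).
- exact: zmorph_comp (@gactB _ Ad g) coset_evalB.
rewrite Zcosets_actE -[c]coset_repK lcoset_actE !coset_evalU ad_actU.
by rewrite conj_actM.
Qed.

Definition coset_eval_map : chain (Zcosets K) -> chain (@Ad G) :=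
  bar_map (A := Zcosets K) (B := Ad) id coset_eval.

Lemma coset_eval_chain_map :
  chain_map (C := bar_chains (Zcosets K)) (C' := bar_chains Ad) coset_eval_map.
Proof.
by apply: bar_map_chain_map => //; [exact: coset_evalB | exact: coset_eval_act].
Qed.

Lemma coset_eval_shapiro c : coset_eval_map (@shapiro_map G K c) = theta_map h c.
Proof.
move: c; apply: malg_ext => [||m s].
- have [SB _ _ _] := shapiro_map_chain_map K; exact: zmorph_comp (bar_mapB coset_evalB) SB.
- exact: theta_mapB.
rewrite shapiro_mapU theta_mapU [LHS](bar_mapU coset_evalB) map_id.
by rewrite coset_evalU mul1g invg1 mulg1.
Qed.

Lemma theta_shapiro k l (x : HZ K k) : k = l ->
  hmap (C := bar_chains (Zcosets K)) (C' := bar_chains Ad) l coset_eval_map (shapiro x)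
  = theta h l x.
Proof.
move=> kl; subst l.
apply: etrans (hmapE coset_eval_chain_map (erefl k)
  (chain_map_cycle (shapiro_map_chain_map K) (hrep_cycle x))) _.
by rewrite coset_eval_shapiro.
Qed.
End CosetEvaluation.

(** * The embedding of the loop homology in H_*(G; Ad) *)

Section LoopHomology.
Context {G : groupType} (n : nat) (cc_rep : conj_classes G -> G).
Hypothesis cc_repK : forall c, conj_class (cc_rep c) = c.

Lemma conj_class_eqP (x y : G) : conj_class x = conj_class y <-> exists a, y = (a * x * a^-1)%g.
Proof.
split=> [/eqmodP/asboolP//|xy]; apply/eqmodP; exact/asboolP.
Qed.

Lemma theta_centralizerB (h : G) k l : k = l ->
  zmod_morphism (@theta G h (centralizer h) k l).
Proof. exact/hmapB/theta_map_chain_map/centralizer_fix. Qed.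

(* The isomorphism of the loop homology with H_*(G; Ad), of which only the
   injectivity is needed. *)
Definition loop_class p (x : loop_homology n cc_rep p) : group_homology (@Ad G) (p + n%:Z) :=
  dsum_lift (fun c (xc : HZ (centralizer (cc_rep c)) (p + n%:Z)) =>
    theta (cc_rep c) (p + n%:Z) xc) x.

Lemma loop_classB p : zmod_morphism (@loop_class p).
Proof. by apply: dsum_liftB => c; exact: theta_centralizerB. Qed.

Lemma loop_class_dinj p c (xc : HZ (centralizer (cc_rep c)) (p + n%:Z)) :
  loop_class (dinj (A := fun c => HZ (centralizer (cc_rep c)) (p + n%:Z)) xc)
  = theta (cc_rep c) (p + n%:Z) xc.
Proof. by apply: dsum_lift_dinj => d; exact: theta_centralizerB. Qed.

(** The conjugating element hidden in [summand] disappears by [theta_conj]; this also shows that the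
    identification of summands does not depend on it. *)
Lemma loop_class_summand p (h : G) (x : HZ (centralizer h) (p + n%:Z)) :
  loop_class (summand cc_rep x) = theta h (p + n%:Z) x.
Proof.
rewrite /summand; set c := conj_class h; set a := xget _ _.
have aP : (a * h * a^-1)%g = cc_rep c.
  rewrite /a; case: xgetP => [//|none].
  have /conj_class_eqP[b bh] : conj_class h = conj_class (cc_rep c) by rewrite cc_repK.
  by case: (none b).
apply: etrans (loop_class_dinj _) _.
have := @theta_conj _ a h (centralizer h) (centralizer (cc_rep c)) (p + n%:Z) (p + n%:Z)
  (p + n%:Z) x erefl erefl; rewrite aP; apply.
- exact: centralizer_fix.
- exact: centralizer_fix.
by move=> y; rewrite !centralizerE -aP !conj_actMr => /eqP ->.
Qed.

Definition conj_rep (y : G) : G :=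
  xget 1%g [set a | y = (a * cc_rep (conj_class y) * a^-1)%g]%classic.

Lemma conj_repP y : y = (conj_rep y * cc_rep (conj_class y) * (conj_rep y)^-1)%g.
Proof.
rewrite /conj_rep; case: xgetP => [//|none].
have /conj_class_eqP[b bh] : conj_class (cc_rep (conj_class y)) = conj_class y.
  by rewrite cc_repK.
by case: (none b).
Qed.

(** Two elements that conjugate [cc_rep c] to the same y differ by the centralizer of [cc_rep c].
    This is what makes the projection onto a conjugacy class equivariant. *)
Lemma lcoset_conj_rep c a :
  lcoset (centralizer (cc_rep c)) (conj_rep (a * cc_rep c * a^-1)%g)
  = lcoset (centralizer (cc_rep c)) a.
Proof.
set y := (a * _ * _)%g; have yc : conj_class y = c.
  by rewrite -[RHS]cc_repK; apply/esym/conj_class_eqP; exists a.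
have := conj_repP y; rewrite yc => e; apply/lcoset_eqP; rewrite centralizerE.
set b := conj_rep y in e *; apply/eqP.
have : (b^-1 * y * b = cc_rep c)%g by rewrite {1}e !mulgA mulVg mul1g mulgVK.
by rewrite /y => eb; rewrite -[in RHS]eb !mulgA mulgK mulgVK.
Qed.

(* The component at c of Z[G] = (+)_c Z[G / C_c] *)
Definition class_proj c : @Ad G -> Zcosets (centralizer (cc_rep c)) :=
  malg_lift (fun y m => if conj_class y == c
    then << m *g lcoset (centralizer (cc_rep c)) (conj_rep y) >> else 0).

Lemma class_projB c : zmod_morphism (class_proj c).
Proof.
apply: malg_lift_is_zmod_morphism => y m m'.
by case: ifP => _; [exact: zmorph_malgU | exact: esym (subrr _)].
Qed.

Lemma class_projU c m y : class_proj c << m *g y >> =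
  if conj_class y == c then << m *g lcoset (centralizer (cc_rep c)) (conj_rep y) >> else 0.
Proof. by rewrite /class_proj malg_liftU ?monalgU0 ?if_same. Qed.

Lemma class_proj_act c g x : class_proj c (gact g x) = gact g (class_proj c x).
Proof.
move: x; apply: malg_ext => [||m y].
- exact: zmorph_comp (class_projB c) (@gactB _ Ad g).
- exact: zmorph_comp (@gactB _ (Zcosets _) g) (class_projB c).
rewrite ad_actU !class_projU.
have -> : conj_class (g * y * g^-1)%g = conj_class y by apply/esym/conj_class_eqP; exists g.
case: eqP => [yc|_]; last by rewrite (zmorph0 (gactB _)).
rewrite Zcosets_actE lcoset_actE; congr (<< _ *g _ >>).
by rewrite {1}(conj_repP y) yc -conj_actM lcoset_conj_rep.
Qed.

Definition class_proj_map c : chain (@Ad G) -> chain (Zcosets (centralizer (cc_rep c))) :=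
  bar_map (A := Ad) (B := Zcosets _) id (class_proj c).

Lemma class_proj_chain_map c : chain_map (C := bar_chains Ad)
  (C' := bar_chains (Zcosets (centralizer (cc_rep c)))) (class_proj_map c).
Proof.
by apply: bar_map_chain_map => //; [exact: class_projB | exact: class_proj_act].
Qed.

(** The coefficient map obtained by including the orbit of one class and projecting to another:
    Shapiro's map when the classes agree and zero otherwise. *)
Definition coset_if (b : bool) (K : groupClosed G) (m : int) : Zcosets K :=
  if b then << m *g lcoset K 1%g >> else 0.

Lemma coset_ifB b K : zmod_morphism (coset_if b K : int -> Zcosets K).
Proof.
by case: b => m m'; [exact: zmorph_malgU | exact: esym (subrr _)].
Qed.

Lemma class_proj_theta c d (t : chain (trivZ (subgrp (centralizer (cc_rep d))))) :
  class_proj_map c (theta_map (cc_rep d) t)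
  = bar_map (A := trivZ (subgrp (centralizer (cc_rep d))))
      (B := Zcosets (centralizer (cc_rep c))) val
      (fun m => coset_if (d == c) (centralizer (cc_rep c)) m) t.
Proof.
have fB := @coset_ifB (d == c) (centralizer (cc_rep c)).
move: t; apply: malg_ext => [||m s].
- exact: zmorph_comp (bar_mapB (class_projB c)) (@theta_mapB _ _ _).
- exact: bar_mapB.
rewrite theta_mapU [LHS](bar_mapU (class_projB c)) map_id class_projU cc_repK.
rewrite [RHS](bar_mapU (A := trivZ (subgrp (centralizer (cc_rep d)))) fB).
congr (<< _ *g _ >>); rewrite /coset_if; case: eqP => // e; subst d; congr (<< _ *g _ >>).
by have := lcoset_conj_rep c 1%g; rewrite conj_act1.
Qed.

(** Each component of x is recovered up to Shapiro's map, which is injective; injectivity of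
    [loop_class] follows componentwise. *)
Lemma loop_class_proj p c (x : loop_homology n cc_rep p) :
  hmap (C := bar_chains Ad) (C' := bar_chains (Zcosets (centralizer (cc_rep c)))) (p + n%:Z)
    (class_proj_map c) (loop_class x)
  = shapiro (dsum_fun x c).
Proof.
have hB := hmapB (class_proj_chain_map c) (erefl (p + n%:Z)).
have sB := @shapiroB _ (centralizer (cc_rep c)) (p + n%:Z).
move: x; apply: dsum_ext => [||d a].
- exact: zmorph_comp hB (@loop_classB p).
- exact: zmorph_comp sB (dsum_coefB c).
rewrite loop_class_dinj.
apply: etrans (hmapE (class_proj_chain_map c) (erefl _) (chain_map_cycle
  (theta_map_chain_map (@centralizer_fix _ (cc_rep d))) (hrep_cycle a))) _.
rewrite class_proj_theta; case: eqP => [e|dc].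
  by subst d; rewrite dinj_same.
have -> : bar_map (A := trivZ (subgrp (centralizer (cc_rep d))))
    (B := Zcosets (centralizer (cc_rep c))) val
    (fun m => coset_if false (centralizer (cc_rep c)) m) (hrep a) = 0.
  by apply: big1 => s _; exact: monalgU0.
apply: etrans (@hclass0 (bar_chains (Zcosets (centralizer (cc_rep c)))) _) _.
have e := @dinj_other _ (fun c => HZ (centralizer (cc_rep c)) (p + n%:Z)) d c a dc.
apply: esym; apply: etrans (congr1 (@shapiro G (centralizer (cc_rep c)) (p + n%:Z)) e) _.
exact: zmorph0 sB.
Qed.

Lemma loop_class_inj p : injective (@loop_class p).
Proof.
move=> x y xy; apply: dsumP => c; apply: shapiro_inj.
by rewrite -!loop_class_proj xy.
Qed.

End LoopHomology.

(** * The double coset decomposition and the evaluation of intersections in Ad *)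

Section Intersection.
Context {G : groupType} (dc_rep : forall K H : groupClosed G, dcosets K H -> G).
Hypothesis dc_repK : forall (K H : groupClosed G) (d : dcosets K H),
  dcoset K H (dc_rep d) = d.

Lemma dcoset_eqP (K H : groupClosed G) (x y : G) :
  dcoset K H x = dcoset K H y <-> exists k h, [/\ k \in K, h \in H & y = (k * x * h)%g].
Proof.
split=> [/eqmodP/asboolP//|xy]; apply/eqmodP; exact/asboolP.
Qed.

Section Psi.
Variables K H : groupClosed G.

Local Notation meet := (meet_module dc_rep K H).

Lemma lcoset_repr (L : groupClosed G) (c : lcosets L) :
  lcoset L (repr (c : {eq_quot (lcoset_rel L)}%qT)) = c.
Proof. exact: reprK. Qed.

Definition meet_inj (d : dcosets K H) (x : Zcosets (meet_at dc_rep d)) : meet :=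
  dinj (A := fun d => Zcosets (meet_at dc_rep d)) (i := d) x.

Lemma psi_basis_common (c : lcosets K) (c' : lcosets H) :
  exists (d : dcosets K H) a, lcoset K a = c /\ lcoset H (a * dc_rep d)%g = c'.
Proof.
set x := repr (c : {eq_quot (lcoset_rel K)}%qT); set y := repr (c' : {eq_quot (lcoset_rel H)}%qT).
have [d /dcoset_eqP[k [h [kK hH e]]]] : exists d : dcosets K H,
    dcoset K H (dc_rep d) = dcoset K H (x^-1 * y)%g.
  by exists (dcoset K H (x^-1 * y)%g); rewrite dc_repK.
(* From x^-1 y = k g h with g the representative: x k lies in x K, and x k g = y h^-1 lies in y
   H. *)
exists d, (x * k)%g; split.
  rewrite -[RHS]lcoset_repr; apply/lcoset_eqP.
  by rewrite invgM -mulgA mulVg mulg1 gpredV.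
rewrite -[RHS]lcoset_repr -/y; apply/lcoset_eqP.
have -> : y = (x * k * dc_rep d * h)%g.
  by rewrite -[LHS](mulVKg x) [in LHS]e !mulgA.
by rewrite mulKg.
Qed.

(** Any a with these two properties determines the double coset, and two such elements for the same
    d differ on the right by an element of both K and g H g^-1. So the choice made in [psi_basis]
    does not matter. *)
Lemma psi_basisE (c : lcosets K) (c' : lcosets H) (d : dcosets K H) a :
  lcoset K a = c -> lcoset H (a * dc_rep d)%g = c' ->
  psi_basis dc_rep c c' = meet_inj << lcoset (meet_at dc_rep d) a >>.
Proof.
move=> ac ac'; rewrite /psi_basis.
have -> : dcoset K H ((repr (c : {eq_quot (lcoset_rel K)}%qT))^-1
                      * repr (c' : {eq_quot (lcoset_rel H)}%qT))%g = d.
  rewrite -[RHS]dc_repK; apply/esym/dcoset_eqP.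
  set x := repr (c : _); set y := repr (c' : _).
  exists (x^-1 * a)%g, ((a * dc_rep d)^-1 * y)%g; split.
  - by apply/lcoset_eqP; rewrite lcoset_repr.
  - by apply/lcoset_eqP; rewrite [RHS]lcoset_repr.
  by rewrite invgM !mulgA !mulgK.
case: xgetP => [b _ [/= bc bc']|none]; last by case: (none a).
congr (meet_inj << _ >>); apply/lcoset_eqP; apply/andP; split.
  by apply/lcoset_eqP; rewrite bc.
rewrite conjgE; have /lcoset_eqP : lcoset H (b * dc_rep d)%g = lcoset H (a * dc_rep d)%g.
  by rewrite bc' ac'.
by rewrite invgM !mulgA.
Qed.

Lemma psiE (x : Zcosets K) (y : Zcosets H) :
  psi dc_rep (tens x y) = bilift (@psi_basis G dc_rep K H) x y.
Proof. by apply: tensor_lift_tens; [exact: biliftBl | exact: biliftBr]. Qed.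

Lemma psiB : zmod_morphism (@psi G dc_rep K H).
Proof. by apply: tensor_liftB; [exact: biliftBl | exact: biliftBr]. Qed.

Lemma meet_injB d : zmod_morphism (@meet_inj d).
Proof. exact: dinjB. Qed.

Lemma meet_inj_act d g x : meet_inj (gact g x) = gact g (@meet_inj d x).
Proof.
apply: dsumP => e; rewrite [RHS]/(gact g (dsum_fun (meet_inj x) e)) /meet_inj.
have [de|de] := pselect (d = e); first by subst e; rewrite !dinj_same.
rewrite [LHS]dinj_other //; apply: esym; rewrite -[RHS](zmorph0 (gactB g)).
by congr (gact g _); exact: dinj_other.
Qed.

Lemma psi_basis_act g (c : lcosets K) (c' : lcosets H) :
  psi_basis dc_rep (lcoset_act g c) (lcoset_act g c') = gact g (psi_basis dc_rep c c').
Proof.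
have [d [a [ac ac']]] := psi_basis_common c c'.
rewrite (psi_basisE ac ac') (@psi_basisE _ _ d (g * a)%g); last 2 first.
- by rewrite -lcoset_actE ac.
- by rewrite -mulgA -lcoset_actE ac'.
by rewrite -meet_inj_act Zcosets_actE lcoset_actE.
Qed.

Lemma psi_act g (t : tensor_gmodule (Zcosets K) (Zcosets H)) :
  psi dc_rep (gact g t) = gact g (psi dc_rep t).
Proof.
move: t; apply: tensor_ext => [||x y].
- exact: zmorph_comp psiB (@gactB _ (tensor_gmodule (Zcosets K) (Zcosets H)) g).
- exact: zmorph_comp (@gactB _ meet g) psiB.
apply: etrans (congr1 (@psi G dc_rep K H) (tens_act g x y)) (etrans (psiE _ _) _).
apply: etrans _ (congr1 (@gact _ meet g) (esym (psiE x y))).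
move: x y; apply: bilift_ext => [y|x|y|x|c c'].
- exact: zmorph_comp (biliftBl _ _) (@gactB _ (Zcosets K) g).
- exact: zmorph_comp (biliftBr _ _) (@gactB _ (Zcosets H) g).
- exact: zmorph_comp (@gactB _ meet g) (biliftBl _ _).
- exact: zmorph_comp (@gactB _ meet g) (biliftBr _ _).
rewrite !Zcosets_actE; apply: etrans (biliftU _ _ _ _ _) _.
by rewrite biliftU mulr1 !mulr1z psi_basis_act.
Qed.

Definition psi_map : chain (tensor_gmodule (Zcosets K) (Zcosets H)) -> chain meet :=
  bar_map (A := tensor_gmodule (Zcosets K) (Zcosets H)) (B := meet) id (@psi G dc_rep K H).

Lemma psi_chain_map : chain_map (C := bar_chains (tensor_gmodule (Zcosets K) (Zcosets H)))
  (C' := bar_chains meet) psi_map.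
Proof. by apply: bar_map_chain_map => //; [exact: psiB | exact: psi_act]. Qed.

Lemma meet_shapiro_summandB k (d : dcosets K H) :
  zmod_morphism (fun w : HZ (meet_at dc_rep d) k =>
    hmap (C := bar_chains (Zcosets (meet_at dc_rep d))) (C' := bar_chains meet) k
      (@dsum_inj_map _ _ (fun d => Zcosets (meet_at dc_rep d)) d) (shapiro w)).
Proof.
have hB := hmapB (@dsum_inj_chain_map _ _ (fun d => Zcosets (meet_at dc_rep d)) d) (erefl k).
exact: zmorph_comp hB (@shapiroB _ _ k).
Qed.

Lemma meet_shapiroB k : zmod_morphism (@meet_shapiro G dc_rep K H k).
Proof. by apply: dsum_liftB => d; exact: meet_shapiro_summandB. Qed.

Lemma meet_shapiro_dinj k d (w : HZ (meet_at dc_rep d) k) :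
  meet_shapiro (dinj (A := fun d => HZ (meet_at dc_rep d) k) w)
  = hmap (C := bar_chains (Zcosets (meet_at dc_rep d))) (C' := bar_chains meet) k
      (@dsum_inj_map _ _ (fun d => Zcosets (meet_at dc_rep d)) d) (shapiro w).
Proof. by apply: dsum_lift_dinj => e; exact: meet_shapiro_summandB. Qed.

(** Each component of a class lies in the image of Shapiro's map for its double coset. Consequently
    the preimage chosen in [intersection] exists and is not the default value of [xget]. *)
Lemma meet_shapiro_surj k (y : group_homology meet k) :
  exists w, @meet_shapiro G dc_rep K H k w = y.
Proof.
have [r ->] := dsum_homology y.
pose w d := projT1 (cid (shapiro_surj
  (hmap (C := bar_chains meet) (C' := bar_chains (Zcosets (meet_at dc_rep d))) k
    (@dsum_proj_map _ _ (fun d => Zcosets (meet_at dc_rep d)) d) y))).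
exists (\sum_(d <- r) dinj (A := fun d => HZ (meet_at dc_rep d) k) (w d)).
rewrite (zmorph_sum (@meet_shapiroB k)); apply: eq_bigr => d _.
apply: etrans (meet_shapiro_dinj (w d)) _.
exact: (congr1 (hmap (C := bar_chains (Zcosets (meet_at dc_rep d))) (C' := bar_chains meet) k
  (@dsum_inj_map _ _ (fun d => Zcosets (meet_at dc_rep d)) d)) (projT2 (cid (shapiro_surj _)))).
Qed.

Lemma intersectionP n (z : group_homology (trivZ G) n%:Z) i j (x : HZ K i) (y : HZ H j) :
  meet_shapiro (intersection dc_rep z x y)
  = hmap (C := bar_chains (tensor_gmodule (Zcosets K) (Zcosets H))) (C' := bar_chains meet)
      (i + j - n%:Z) psi_map
      (cap (i + j - n%:Z) z (cup (dual_inv z (shapiro x)) (dual_inv z (shapiro y)))).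
Proof.
rewrite /intersection; case: xgetP => [w _ //|none].
set v := hmap _ _ _; have [w wv] := meet_shapiro_surj v.
by case: (none w).
Qed.
End Psi.

Section MeetEvaluation.
Variables alpha beta : G.
Local Notation K := (centralizer alpha).
Local Notation H := (centralizer beta).
Local Notation meet := (meet_module dc_rep K H).

Definition meet_elt (d : dcosets K H) : G := (alpha * dc_rep d * beta * (dc_rep d)^-1)%g.

Lemma meet_fix d x : x \in meet_at dc_rep d -> (x * meet_elt d * x^-1)%g = meet_elt d.
Proof.
case/andP=> /centralizer_fix xa /centralizer_fix xb.
have xg : (x * (dc_rep d * beta * (dc_rep d)^-1) * x^-1)%g
    = (dc_rep d * beta * (dc_rep d)^-1)%g.
  move: xb; move: (dc_rep d) => g xb.
  by rewrite -conj_actM -[in RHS]xb -conj_actM conjgE mulVKg.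
have -> : meet_elt d = (alpha * (dc_rep d * beta * (dc_rep d)^-1))%g.
  by rewrite /meet_elt !mulgA.
by rewrite -conj_actMr xa xg.
Qed.

Definition meet_eval : meet -> @Ad G :=
  dsum_lift (fun d : dcosets K H => @coset_eval G (meet_at dc_rep d) (meet_elt d)).

Lemma meet_evalB : zmod_morphism meet_eval.
Proof. by apply: dsum_liftB => d; exact: coset_evalB. Qed.

Lemma meet_eval_inj d (x : Zcosets (meet_at dc_rep d)) :
  meet_eval (meet_inj x) = coset_eval (meet_elt d) x.
Proof. by apply: dsum_lift_dinj => e; exact: coset_evalB. Qed.

Lemma meet_eval_act g x : meet_eval (gact g x) = gact g (meet_eval x).
Proof.
move: x; apply: dsum_ext => [||d a].
- exact: zmorph_comp meet_evalB (@gactB _ meet g).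
- exact: zmorph_comp (@gactB _ Ad g) meet_evalB.
apply: etrans (congr1 meet_eval (esym (meet_inj_act g a))) _.
apply: etrans (meet_eval_inj _) _.
apply: etrans (coset_eval_act (@meet_fix d) g a) _.
exact: (congr1 (@gact _ Ad g) (esym (meet_eval_inj a))).
Qed.

Lemma meet_eval_psi (x : Zcosets K) (y : Zcosets H) :
  meet_eval (psi dc_rep (tens x y)) = ad_mul (coset_eval alpha x) (coset_eval beta y).
Proof.
apply: etrans (congr1 meet_eval (psiE x y)) _.
move: x y; apply: bilift_ext => [y|x|y|x|c c'].
- exact: zmorph_comp meet_evalB (biliftBl _ _).
- exact: zmorph_comp meet_evalB (biliftBr _ _).
- exact: zmorph_comp (ad_mulBl _) (@coset_evalB _ _ _).
- exact: zmorph_comp (ad_mulBr _) (@coset_evalB _ _ _).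
have [d [a [ac ac']]] := psi_basis_common c c'.
rewrite biliftU mulr1 mulr1z (psi_basisE ac ac') meet_eval_inj.
rewrite -ac -ac' (coset_evalU (@meet_fix d)).
rewrite (coset_evalU (@centralizer_fix _ alpha)) (coset_evalU (@centralizer_fix _ beta)).
by rewrite ad_mulU mulr1 [in RHS]conj_actM conj_actMr /meet_elt !mulgA.
Qed.

Definition meet_eval_map : chain meet -> chain (@Ad G) :=
  bar_map (A := meet) (B := Ad) id meet_eval.

Lemma meet_eval_chain_map : chain_map (C := bar_chains meet) (C' := bar_chains Ad) meet_eval_map.
Proof. by apply: bar_map_chain_map => //; [exact: meet_evalB | exact: meet_eval_act]. Qed.

Lemma meet_eval_homB k l : k = l ->
  zmod_morphism (hmap (C := bar_chains meet) (C' := bar_chains Ad) (k := k) l meet_eval_map).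
Proof. by move=> kl; have := hmapB meet_eval_chain_map kl. Qed.

Lemma meet_eval_hom_inj k l d (s : group_homology (Zcosets (meet_at dc_rep d)) k) : k = l ->
  hmap (C := bar_chains meet) (C' := bar_chains Ad) l meet_eval_map
    (hmap (C := bar_chains (Zcosets (meet_at dc_rep d))) (C' := bar_chains meet) k
      (@dsum_inj_map _ _ (fun d => Zcosets (meet_at dc_rep d)) d) s)
  = hmap (C := bar_chains (Zcosets (meet_at dc_rep d))) (C' := bar_chains Ad) l
      (@coset_eval_map _ (meet_at dc_rep d) (meet_elt d)) s.
Proof.
move=> kl.
apply: etrans (hmap_comp s (erefl k) kl
  (@dsum_inj_chain_map _ _ (fun d => Zcosets (meet_at dc_rep d)) d)
  meet_eval_chain_map) _.
apply: eq_hmap => t.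
have e := @bar_map_comp _ _ _ (Zcosets (meet_at dc_rep d)) meet Ad id id _ _ t
  (@meet_injB _ _ d) meet_evalB.
apply: etrans e _.
by apply: eq_bar_map => // x; exact: meet_eval_inj.
Qed.

Lemma theta_meet k l d (w : HZ (meet_at dc_rep d) k) : k = l ->
  theta (meet_elt d) l (HZ_conj 1%g (centralizer (meet_elt d)) l w) = theta (meet_elt d) l w.
Proof.
move=> kl; have := @theta_conj _ 1%g (meet_elt d) (meet_at dc_rep d)
  (centralizer (meet_elt d)) k l l w kl erefl.
rewrite conj_act1; apply.
- exact: meet_fix.
- exact: centralizer_fix.
by move=> x /meet_fix e; rewrite conj_act1 centralizerE -[in X in _ == X]e mulgVK.
Qed.

(** The right-hand side sees t only through [meet_shapiro t], so whichever preimage [intersection]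
    picks, the resulting class in H_*(G; Ad) is the same. *)
Lemma meet_class k l (t : dsum (fun d : dcosets K H => HZ (meet_at dc_rep d) k)) : k = l ->
  dsum_lift (fun d w => theta (meet_elt d) l (HZ_conj 1%g (centralizer (meet_elt d)) l w)) t
  = hmap (C := bar_chains meet) (C' := bar_chains Ad) l meet_eval_map (meet_shapiro t).
Proof.
move=> kl.
have E d (w : HZ (meet_at dc_rep d) k) :
    theta (meet_elt d) l (HZ_conj 1%g (centralizer (meet_elt d)) l w)
    = hmap (C := bar_chains meet) (C' := bar_chains Ad) l meet_eval_map
        (meet_shapiro (dinj (A := fun d => HZ (meet_at dc_rep d) k) w)).
  apply: etrans (theta_meet w kl) _.
  apply: etrans (esym (theta_shapiro (@meet_fix d) w kl)) _.
  apply: etrans (esym (meet_eval_hom_inj _ kl)) _.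
  exact: (congr1 (hmap (C := bar_chains meet) (C' := bar_chains Ad) l meet_eval_map)
    (esym (meet_shapiro_dinj w))).
have rB := zmorph_comp (meet_eval_homB kl) (@meet_shapiroB K H k).
have fB d : zmod_morphism (fun w : HZ (meet_at dc_rep d) k =>
    theta (meet_elt d) l (HZ_conj 1%g (centralizer (meet_elt d)) l w)).
  rewrite (funext (@E d)).
  exact: (zmorph_comp rB (@dinjB _ (fun d => HZ (meet_at dc_rep d) k) d)).
move: t; apply: dsum_ext => [||d w]; [exact: dsum_liftB | exact: rB | ].
by apply: etrans (dsum_lift_dinj fB w) _; exact: E.
Qed.

End MeetEvaluation.
End Intersection.

(** * Intersections as cup products of dual cocycles *)

Section StringProductClass.
Context {G : groupType} {n : nat} (z : group_homology (trivZ G) n%:Z).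
Hypothesis z_fundamental : poincare_duality z.

Section ThetaDual.
Variables (K : groupClosed G) (h : G) (p : int) (x : HZ K (p + n%:Z)).
Hypothesis Kh : forall y, y \in K -> (y * h * y^-1)%g = h.

Definition shapiro_dual : cochain (Zcosets K) := hrep (dual_inv z (shapiro x)).

Lemma shapiro_dual_deg : n%:Z - (n%:Z - (p + n%:Z)) = p + n%:Z.
Proof. by rewrite opprB addrC subrK. Qed.

Lemma shapiro_dual_cocycle : shapiro_dual \in cocycle (n%:Z - (p + n%:Z)).
Proof. exact: hrep_cycle. Qed.

Definition theta_dual : cochain (@Ad G) := fun s => coset_eval h (shapiro_dual s).

Lemma theta_dual_cocycle : theta_dual \in cocycle (- p).
Proof.
have -> : - p = n%:Z - (p + n%:Z) by rewrite opprD addrCA subrr addr0.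
by apply: coef_cocycle shapiro_dual_cocycle; [exact: coset_evalB | exact: coset_eval_act].
Qed.

(** Coefficient maps commute with capping by z: evaluating cosets in a cocycle dual to the Shapiro
    class of x gives a cocycle dual to its image in H_*(G; Ad). *)
Lemma theta_dualE :
  theta h (p + n%:Z) x = hclass (C := bar_chains Ad) (p + n%:Z) (capz z theta_dual).
Proof.
have uC := capz_cycle z shapiro_dual_deg shapiro_dual_cocycle.
have xE : hclass (C := bar_chains (Zcosets K)) (p + n%:Z) (capz z shapiro_dual) = shapiro x.
  have := @dual_invP _ _ z _ z_fundamental _ (shapiro x).
  by [].
apply: etrans (esym (theta_shapiro Kh x erefl)) _.
apply: etrans (congr1 _ (esym xE)) _.
apply: etrans (hmapE (coset_eval_chain_map Kh) erefl uC) _.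
exact: (congr1 (hclass (C := bar_chains Ad) (p + n%:Z))
  (bar_map_cap _ _ (@coset_evalB _ _ _) (coset_eval_act Kh))).
Qed.
End ThetaDual.

Section IntersectionClass.
Context (dc_rep : forall K H : groupClosed G, dcosets K H -> G).
Hypothesis dc_repK : forall (K H : groupClosed G) (d : dcosets K H),
  dcoset K H (dc_rep d) = d.
Variables (alpha beta : G) (p q : int).
Local Notation K := (centralizer alpha).
Local Notation H := (centralizer beta).
Variables (x : HZ K (p + n%:Z)) (y : HZ H (q + n%:Z)).

Let u := shapiro_dual x.
Let v := shapiro_dual y.
Let w : cochain (tensor_gmodule (Zcosets K) (Zcosets H)) := cup_cochain u v.

Let r : int := n%:Z - (p + n%:Z) + (n%:Z - (q + n%:Z)).

Lemma cup_cochain_cocycle : w \in cocycle r.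
Proof.
exact: (@cup_cocycle _ _ _ (tensor_gmodule (Zcosets K) (Zcosets H))
  (@tens G (Zcosets K) (Zcosets H))
  _ _ _ _ (@tensBl _ _ _) (@tensBr _ _ _) (fun g a b => esym (tens_act g a b))
  (shapiro_dual_cocycle x) (shapiro_dual_cocycle y)).
Qed.

Lemma intersection_deg : n%:Z - r = p + n%:Z + (q + n%:Z) - n%:Z.
Proof. rewrite /r; lia. Qed.

Lemma intersection_deg' : p + n%:Z + (q + n%:Z) - n%:Z = p + q + n%:Z.
Proof. lia. Qed.

Lemma star_theta_dual s :
  meet_eval (psi dc_rep (w s)) = star (theta_dual alpha x) (theta_dual beta y) s.
Proof.
have B := zmorph_comp (@meet_evalB _ dc_rep alpha beta) (@psiB _ dc_rep K H).
have e := zmorph_sum B (index_enum (ordinal (size s).+1)) xpredT (fun i =>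
  tens (u (take i s)) (gact (\prod_(g <- take i s) g)%g (v (drop i s)))).
apply: etrans e _; apply: eq_bigr => i _.
apply: etrans (meet_eval_psi dc_repK _ _) _.
by rewrite (coset_eval_act (@centralizer_fix _ beta)).
Qed.

(** The coefficient maps [psi] and [meet_eval] are carried through the cap product onto the cochain
    [w], where their composite turns a tensor of cosets into a product in Ad. What remains is the
    product of the two dual cocycles. *)
Lemma intersection_class :
  dsum_lift (fun d t => theta (meet_elt dc_rep d) (p + q + n%:Z)
    (HZ_conj 1%g (centralizer (meet_elt dc_rep d)) (p + q + n%:Z) t))
    (intersection dc_rep z x y)
  = dual_mul z (theta alpha (p + n%:Z) x) (theta beta (q + n%:Z) y).
Proof.
have wC := cup_cochain_cocycle; have wz := capz_cycle z intersection_deg wC.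
have psiP := @psi_chain_map _ _ dc_repK K H.
apply: etrans (meet_class (intersection dc_rep z x y) intersection_deg') _.
apply: etrans (congr1 _ (intersectionP dc_rep z x y)) _.
apply: etrans (congr1 (fun t => hmap _ _ (hmap _ _ t)) (cap_hclass z intersection_deg wC)) _.
apply: etrans (congr1 _ (hmapE psiP erefl wz)) _.
apply: etrans (hmapE (@meet_eval_chain_map _ dc_rep alpha beta) intersection_deg'
  (chain_map_cycle psiP wz)) _.
apply: etrans _ (esym (congr2 (@dual_mul _ _ z p q) (theta_dualE x (@centralizer_fix _ alpha))
  (theta_dualE y (@centralizer_fix _ beta)))).
apply: etrans _ (esym (dual_mulE z_fundamental (theta_dual_cocycle x (@centralizer_fix _ alpha))
  (theta_dual_cocycle y (@centralizer_fix _ beta)))).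
apply: (congr1 (hclass (C := bar_chains Ad) (p + q + n%:Z))).
pose w1 : cochain (meet_module dc_rep K H) := fun s => psi dc_rep (w s).
have e1 : psi_map dc_rep (capz z w) = capz z w1.
  have e := @bar_map_cap _ (tensor_gmodule (Zcosets K) (Zcosets H)) (meet_module dc_rep K H)
    _ (hrep z) w (@psiB _ dc_rep K H) (@psi_act _ _ dc_repK K H).
  exact e.
have e2 : meet_eval_map (capz z w1) = capz z (fun s => meet_eval (w1 s)).
  exact: (@bar_map_cap _ (meet_module dc_rep K H) Ad _ (hrep z) w1
    (@meet_evalB _ dc_rep alpha beta) (@meet_eval_act _ dc_rep alpha beta)).
have e3 : (fun s => meet_eval (w1 s)) = star (theta_dual alpha x) (theta_dual beta y).
  by apply/funext => s; exact: star_theta_dual.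
refine (etrans (congr1 (@meet_eval_map _ dc_rep alpha beta) e1) (etrans e2 _)).
exact (congr1 (@capz _ _ z Ad) e3).
Qed.
End IntersectionClass.
End StringProductClass.

(** [dsum_lift] is a finite sum over the support of x whatever its components are, so h can be moved
    inside before the components of the string product are known to be additive. *)
Lemma dsum_lift_comp (I : choiceType) (A : I -> zmodType) (C D : zmodType) (h : C -> D)
    (f : forall i, A i -> C) (x : dsum A) : zmod_morphism h ->
  h (dsum_lift f x) = dsum_lift (fun i a => h (f i a)) x.
Proof.
move=> hB; have /asboolP /finite_fsetP[X xX] := valP x.
rewrite /dsum_lift xX -!fsbig_seq ?fset_uniq //; exact: (zmorph_sum hB).
Qed.

(** * The algebra laws for the string product *)

Section StringAlgebra.
Context {G : groupType} {n : nat} (z : group_homology (trivZ G) n%:Z).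
Hypothesis z_fundamental : poincare_duality z.
Context (cc_rep : conj_classes G -> G).
Hypothesis cc_repK : forall c, conj_class (cc_rep c) = c.
Context (dc_rep : forall K H : groupClosed G, dcosets K H -> G).
Hypothesis dc_repK : forall (K H : groupClosed G) (d : dcosets K H),
  dcoset K H (dc_rep d) = d.

Local Notation mu := (@string_product G n z cc_rep dc_rep).
Local Notation L := (loop_homology n cc_rep).
Local Notation cls m u := (hclass (C := bar_chains (@Ad G)) m (capz z u)).

(** Additivity of [loop_class] and biadditivity of [dual_mul] bring both sides to sums over the same
    supports. On one pair of conjugacy classes the claim is [intersection_class], the summand of
    each double coset being evaluated by [loop_class_summand]. *)
Lemma loop_class_mul p q (x : L p) (y : L q) :
  loop_class (mu x y) = dual_mul z (loop_class x) (loop_class y).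
Proof.
pose f c d (xc : HZ (centralizer (cc_rep c)) (p + n%:Z))
    (yd : HZ (centralizer (cc_rep d)) (q + n%:Z)) : L (p + q) :=
  dsum_lift (fun e w => let g := dc_rep e in let h := (cc_rep c * g * cc_rep d * g^-1)%g in
    summand cc_rep (h := h) (HZ_conj 1%g (centralizer h) (p + q + n%:Z) w))
    (intersection dc_rep z xc yd).
have fE c d xc yd : loop_class (@f c d xc yd)
    = dual_mul z (theta (cc_rep c) (p + n%:Z) xc) (theta (cc_rep d) (q + n%:Z) yd).
  apply: etrans (dsum_lift_comp _ _ (@loop_classB _ _ _ _)) _.
  apply: etrans _ (intersection_class z_fundamental dc_repK xc yd).
  congr dsum_lift; apply: functional_extensionality_dep => e; apply/funext => w.
  exact: loop_class_summand.
apply: etrans (dsum_lift_comp _ _ (@loop_classB _ _ _ _)) _.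
apply: etrans _ (esym (dsum_lift_comp _ x (dual_mulBl z_fundamental (loop_class y)))).
congr dsum_lift; apply: functional_extensionality_dep => c; apply/funext => xc.
apply: etrans (dsum_lift_comp _ _ (@loop_classB _ _ _ _)) _.
apply: etrans _ (esym (dsum_lift_comp _ y (dual_mulBr z_fundamental _))).
congr dsum_lift; apply: functional_extensionality_dep => d; apply/funext => yd.
exact: fE.
Qed.

Lemma loop_class_dual p (x : L p) :
  exists2 u, u \in cocycle (- p) & loop_class x = cls (p + n%:Z) u.
Proof.
have [uC xu] := dual_repP z_fundamental (loop_class x).
by exists (dual_rep z (loop_class x)).
Qed.

Lemma star_cocycleN p q (u v : cochain (@Ad G)) :
  u \in cocycle (- p) -> v \in cocycle (- q) -> star u v \in cocycle (- (p + q)).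
Proof.
have -> : - (p + q) = - p + - q by rewrite opprD.
by move=> uC vC; apply: (star_cocycle uC vC).
Qed.

Lemma loop_class_cup p q (x : L p) (y : L q) u v :
  u \in cocycle (- p) -> v \in cocycle (- q) ->
  loop_class x = cls (p + n%:Z) u -> loop_class y = cls (q + n%:Z) v ->
  loop_class (mu x y) = cls (p + q + n%:Z) (star u v).
Proof.
move=> uC vC xu yv; apply: etrans (loop_class_mul x y) _.
apply: etrans (congr2 (@dual_mul _ _ z p q) xu yv) _.
exact: dual_mulE.
Qed.

Lemma loop_class_recast p q (e : p = q) (x : L p) u :
  loop_class x = cls (p + n%:Z) u -> loop_class (recast e x) = cls (q + n%:Z) u.
Proof. by case: _ / e. Qed.

Lemma string_product_biadditive : graded_biadditive (@string_product G n z cc_rep dc_rep).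
Proof.
have loopB r := @loop_classB _ n cc_rep r.
split=> p q => [y x x'|x y y']; apply: (loop_class_inj cc_repK).
  apply: etrans (loop_class_mul _ _) _.
  apply: etrans (congr1 (fun t => dual_mul z t _) (loopB p x x')) _.
  apply: etrans (dual_mulBl z_fundamental _ _ _) _.
  apply: etrans _ (esym (loopB _ _ _)).
  exact: (congr2 (fun s t : group_homology Ad (p + q + n%:Z) => s - t)
    (esym (loop_class_mul x y)) (esym (loop_class_mul x' y))).
apply: etrans (loop_class_mul _ _) _.
apply: etrans (congr1 (dual_mul z _) (loopB q y y')) _.
apply: etrans (dual_mulBr z_fundamental _ _ _) _.
apply: etrans _ (esym (loopB _ _ _)).
exact: (congr2 (fun s t : group_homology Ad (p + q + n%:Z) => s - t)
  (esym (loop_class_mul x y)) (esym (loop_class_mul x y'))).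
Qed.

Lemma string_product_associative : graded_associative (@string_product G n z cc_rep dc_rep).
Proof.
move=> p q r x y w; apply: (loop_class_inj cc_repK).
have [u uC xu] := loop_class_dual x; have [v vC yv] := loop_class_dual y.
have [t tC wt] := loop_class_dual w.
have uvC := star_cocycleN uC vC.
have vtC := star_cocycleN vC tC.
have yw := loop_class_cup vC tC yv wt; have xy := loop_class_cup uC vC xu yv.
apply: etrans (loop_class_recast (addrA p q r) (loop_class_cup uC vtC xu yw)) _.
apply: etrans _ (esym (loop_class_cup uvC tC xy wt)).
exact: (congr1 (fun c => cls (p + q + r + n%:Z) c) (esym (starA u v t))).
Qed.

Lemma string_product_commutative : graded_commutative (@string_product G n z cc_rep dc_rep).
Proof.
move=> p q x y; apply: (loop_class_inj cc_repK).
have [u uC xu] := loop_class_dual x; have [v vC yv] := loop_class_dual y.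
apply: etrans (loop_class_recast (addrC q p) (loop_class_cup vC uC yv xu)) _.
apply: etrans (star_comm z (dual_mul_deg p q) uC vC) _.
apply: etrans _ (esym (zmorphMz (@loop_classB _ n cc_rep _) _ _)).
(* The dual cocycles have degrees -p and -q, and (-p)(-q) = pq gives the sign. *)
rewrite mulrNN; exact: (congr1 (fun c : group_homology Ad (p + q + n%:Z) => c *~ parity (p * q))
  (esym (loop_class_cup uC vC xu yv))).
Qed.

Definition unit_cochain : cochain (@Ad G) := fun s => if s is [::] then << 1%g >> else 0.

Lemma unit_cochain_nil : unit_cochain [::] = << 1%g >>.
Proof. by []. Qed.

Lemma star_unitl u : star unit_cochain u = u.
Proof.
apply/funext => s; rewrite /star /cup_with big_ord_recl [X in _ + X]big1 => [|i _].
  rewrite addr0 take0 drop0 big_nil gact1 unit_cochain_nil.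
  move: (u s : Ad); apply: malg_ext => [||m y]; [exact: ad_mulBr | by move=> x y |].
  by rewrite ad_mulU mul1r mul1g.
by case: s i => [[]//|g s] i; exact: (zmorph0 (ad_mulBl _)).
Qed.

Lemma star_unitr u : star u unit_cochain = u.
Proof.
apply/funext => s; rewrite /star /cup_with big_ord_recr /= [X in X + _]big1 => [|i _].
  rewrite add0r take_size drop_size unit_cochain_nil.
  rewrite perm_actU [gset_act _ _]/= mulg1 mulgV.
  move: (u s : Ad); apply: malg_ext => [||m y]; [exact: ad_mulBl | by move=> x y |].
  by rewrite ad_mulU mulr1 mulg1.
have -> : unit_cochain (drop i s) = 0.
  have := size_drop i s; case: (drop i s) => // /esym/eqP.
  by rewrite subn_eq0 leqNgt ltn_ord.
by rewrite [perm_act _ _](zmorph0 (perm_actB _)) (zmorph0 (ad_mulBr _)).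
Qed.

Lemma unit_cocycle : unit_cochain \in cocycle (- 0).
Proof.
apply/andP; split; first by apply/asboolP => -[|g s].
apply/eqP/funext => -[|g [|h s]] //=.
  rewrite big_ord0 addr0 perm_actU [gset_act _ _]/= mulg1 mulgV expr1 mulrN1z.
  exact: subrr.
have merge0 i : unit_cochain (bar_merge i [:: g, h & s]) = 0 by case: i.
rewrite (zmorph0 (perm_actB _)) add0r mul0rz addr0 big1 // => i _.
by rewrite merge0 mul0rz.
Qed.

Lemma capz_unit : capz z unit_cochain
  = bar_map (A := trivZ G) (B := Ad) id (fun m : int => << m *g 1%g >>) (hrep z).
Proof.
rewrite /capz; move: (hrep z); apply: malg_ext => [||m s].
- exact: cap_chainBl.
- by apply: bar_mapB; exact: zmorph_malgU.
rewrite /cap_chain malg_liftU; last by rewrite big1 // => i _; rewrite mulr0z monalgU0.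
rewrite big_ord_recl [X in _ + X]big1 => [|i _]; last first.
  case: s i => [[]//|g s] i; rewrite [unit_cochain _](erefl : _ = 0).
  by rewrite (zmorph0 (gactB _)) mul0rz monalgU0.
rewrite addr0 take0 drop0 big_nil invg1 gact1 bar_mapU ?map_id; last exact: zmorph_malgU.
congr (<< _ *g _ >>); rewrite unit_cochain_nil.
by rewrite -(zmorphMz (@zmorph_malgU _ _ _)) intz.
Qed.

(** The centralizer of 1 is all of G, but as a subtype; this map carries z to a class of its
    homology, from which the unit of the algebra is made. *)
Definition to_centralizer1 (g : G) : subgrp (centralizer (1%g : G)) := insubd 1%g g.

Lemma val_to_centralizer1 g : val (to_centralizer1 g) = g.
Proof. by rewrite insubdK // centralizerE mul1g mulg1. Qed.

Definition fundamental_centralizer1 : HZ (centralizer (1%g : G)) (0 + n%:Z) :=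
  hclass (C := bar_chains (trivZ (subgrp (centralizer (1%g : G))))) (0 + n%:Z)
    (bar_map (A := trivZ G) (B := trivZ (subgrp (centralizer (1%g : G)))) to_centralizer1
      (fun m : int => m) (hrep z)).

Definition loop_unit : L 0 := summand cc_rep (h := 1%g) fundamental_centralizer1.

Lemma loop_class_unit : loop_class loop_unit = cls (0 + n%:Z) unit_cochain.
Proof.
apply: etrans (loop_class_summand cc_repK _) _.
have toP : chain_map (C := bar_chains (trivZ G))
    (C' := bar_chains (trivZ (subgrp (centralizer (1%g : G)))))
    (bar_map (A := trivZ G) (B := trivZ (subgrp (centralizer (1%g : G)))) to_centralizer1
      (fun m : int => m)).
  apply: bar_map_chain_map => // x y; apply: val_inj.
  by rewrite [RHS]/= -/(val _) -/(val _) !val_to_centralizer1.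
have zC : hrep z \in Defs.cycle (C := bar_chains (trivZ G)) (0 + n%:Z).
  by rewrite add0r; exact: hrep_cycle.
apply: etrans (hmapE (theta_map_chain_map (@centralizer_fix _ (1%g : G))) erefl
  (chain_map_cycle toP zC)) _.
refine (congr1 (hclass (C := bar_chains Ad) (0 + n%:Z)) (etrans _ (esym capz_unit))).
move: (hrep z); apply: malg_ext => [||m s].
- by have [tB _ _ _] := toP; exact: zmorph_comp (@theta_mapB _ _ _) tB.
- by apply: bar_mapB; exact: zmorph_malgU.
rewrite (bar_mapU (A := trivZ G) (B := trivZ (subgrp (centralizer (1%g : G))))) //.
rewrite theta_mapU bar_mapU ?map_id; last exact: zmorph_malgU.
by rewrite -map_comp (eq_map val_to_centralizer1) map_id.
Qed.

Lemma string_product_unital : graded_unital (@string_product G n z cc_rep dc_rep).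
Proof.
exists loop_unit => p x; have [u uC xu] := loop_class_dual x.
have eC := unit_cocycle; have e1 := loop_class_unit.
split; apply: (loop_class_inj cc_repK).
  apply: etrans (loop_class_recast (add0r p) (loop_class_cup eC uC e1 xu)) _.
  exact: etrans (congr1 (fun c => cls (p + n%:Z) c) (star_unitl u)) (esym xu).
apply: etrans (loop_class_recast (addr0 p) (loop_class_cup uC eC xu e1)) _.
exact: etrans (congr1 (fun c => cls (p + n%:Z) c) (star_unitr u)) (esym xu).
Qed.

End StringAlgebra.

Theorem theorem5 (G : groupType) (n : nat) (z : group_homology (trivZ G) n%:Z)
    (z_fundamental : poincare_duality z)
    (cc_rep : conj_classes G -> G)
    (cc_repK : forall c, conj_class (cc_rep c) = c)
    (dc_rep : forall K H : groupClosed G, dcosets K H -> G)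
    (dc_repK : forall (K H : groupClosed G) (d : dcosets K H),
       dcoset K H (dc_rep K H d) = d) :
  let mu := @string_product G n z cc_rep dc_rep in
  [/\ graded_biadditive mu, graded_associative mu, graded_commutative mu
    & graded_unital mu].
Proof.
split.
- exact: string_product_biadditive.
- exact: string_product_associative.
- exact: string_product_commutative.
- exact: string_product_unital.
Qed.
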